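(* Let $q$ be an odd prime power. Let $\Phi$ be a positive function of $g$ and suppose that $S(\theta,\chi_D)\ll\Phi(g)$ uniformly for $\theta\in[0,1]$ and $D\in\mathbb{F}_q[x]$ monic square-free of degree $2g+1$. Then for integers $K\ge (g\log g)/\Phi(g)$ we have $S_K(\theta,\chi_D)\ll\Phi(g)$ (uniformly in $\theta$ and $D$). In particular, $$S_K(\theta,\chi_D)\ll\frac{g}{\log_q g}$$ whenever $K\ge\log_q g\cdot\log g$.
   Context: $\chi_D(f)=(D/f)$ is the quadratic character (Jacobi symbol) on $\mathbb{F}_q[x]$; $\mathcal{L}(u,\chi_D)=\sum_{f\ \mathrm{monic}}\chi_D(f)u^{\deg f}$, a real polynomial of degree $2g$ whose zeros lie on $|u|=q^{-1/2}$. $e(x)=e^{2\pi ix}$. $\Lambda(f)=\deg P$ if $f=P^n$ with $P$ monic irreducible, $n\ge1$, else $0$; $P_K(u,\chi_D)=\exp\big(\sum_{k=1}^{K}\sum_{f\ \mathrm{monic},\ \deg f=k}\Lambda(f)\chi_D(f)u^k/k\big)$. Let $\Gamma(\theta)$ be the positively oriented arc from $q^{-2}$ to $q^{-2}e(\theta)$ followed by the radial segment to $q^{-1/2}e(\theta)$. For $F=\mathcal{L}$ or $F=P_K$, $\arg F(q^{-1/2}e(\theta),\chi_D)$ is minus the continuous change in argument of $F$ along $\Gamma(\theta)$ starting from $0$; for $\mathcal{L}$ at a zero it is the right limit $\lim_{\epsilon\to0^+}\arg\mathcal{L}(q^{-1/2}e(\theta+\epsilon),\chi_D)$. $S(\theta,\chi_D)=\frac1\pi\arg\mathcal{L}(q^{-1/2}e(\theta),\chi_D)$,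 $S_K(\theta,\chi_D)=\frac1\pi\arg P_K(q^{-1/2}e(\theta),\chi_D)$. Asymptotic notation refers to $g\to\infty$ with $q$ fixed. *)

(* Defs.v *)
From HB Require Import structures.
From mathcomp Require Import all_boot all_order all_algebra.
From mathcomp Require Import all_classical all_reals all_analysis.
From mathcomp Require Import complex.
Set Implicit Arguments.
Unset Strict Implicit.
Unset Printing Implicit Defensive.
Import Order.TTheory GRing.Theory Num.Theory numFieldNormedType.Exports.
Local Open Scope classical_set_scope.
Local Open Scope ring_scope.
Local Open Scope complex_scope.

(* Throughout, F is a finite field, q = #|F|, and polynomials over F play the
   role of F_q[x]. *)

Definition squarefree_poly (F : fieldType) (D : {poly F}) : Prop :=
  forall P : {poly F}, P ^+ 2 %| D -> (size P <= 1)%N.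

(* The family of D of degree 2g+1 (the size of a polynomial is its degree
   plus one). *)
Definition oddHyperelliptic (F : fieldType) (g : nat) : set {poly F} :=
  [set D | [/\ D \is monic, squarefree_poly D & size D = (2 * g + 1).+1]].

Definition monic_of_deg (F : fieldType) (n : nat) : pred {poly F} :=
  [pred f : {poly F} | (f \is monic) && (size f == n.+1)].

(* (D / P) for P monic irreducible. *)
Definition legendre (F : fieldType) (D P : {poly F}) : int :=
  if P %| D then 0
  else if `[< exists y : {poly F}, P %| y ^+ 2 - D >] then 1 else -1.

Definition multiplicity (F : fieldType) (P f : {poly F}) : nat :=
  \max_(m < size f | P ^+ m %| f) m.

(* chi_D f = (D / f) for f monic: the Legendre symbol extended
   multiplicatively in f. The bound size P <= size f on P is harmless, since
   larger P do not divide f. *)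
Definition chi (F : finFieldType) (D f : {poly F}) : int :=
  \prod_(P : {poly_(size f) F} |
           ((P : {poly F}) \is monic) && irreducibleb (P : {poly F}))
     legendre D P ^+ multiplicity P f.

(* The von Mangoldt function; the degree of P is determined by f = P ^+ n. *)
Definition vonMangoldt (F : fieldType) (f : {poly F}) : nat :=
  xget 0%N [set d | exists (P : {poly F}) (n : nat),
    [/\ P \is monic, irreducible_poly P, (0 < n)%N, f = P ^+ n
      & d = (size P).-1]].

Definition cis {R : realType} (x : R) : R[i] := cos x +i* sin x.

Definition e_ {R : realType} (x : R) : R[i] := cis (2 * pi * x).

Definition cexp {R : realType} (z : R[i]) : R[i] :=
  (expR (complex.Re z))%:C * cis (complex.Im z).

(* The L-function is the sum of the whole series grouped by degree; its terms
   of degree larger than 2g vanish when D is in oddHyperelliptic F g. The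
   topology on R[i] is carried by the copy R[i]^o. *)
Definition Lfun (R : realType) (F : finFieldType) (D : {poly F}) (u : R[i])
    : R[i] :=
  limn (series (fun n : nat =>
    \sum_(f : {poly_(n.+1) F} | monic_of_deg n (f : {poly F}))
       (chi D f)%:~R * u ^+ n : R[i]^o)).

Definition PKfun (R : realType) (F : finFieldType) (K : nat) (D : {poly F})
    (u : R[i]) : R[i] :=
  cexp (\sum_(1 <= k < K.+1)
          \sum_(f : {poly_(k.+1) F} | monic_of_deg k (f : {poly F}))
             (vonMangoldt (f : {poly F}))%:R * (chi D f)%:~R * u ^+ k / k%:R).

(* The point q^(-1/2) e(theta). *)
Definition critical_point (R : realType) (q : nat) (theta : R) : R[i] :=
  ((Num.sqrt q%:R)^-1)%:C * e_ theta.

(* The path Gamma(theta), parametrized by [0, 2]: the circular arc for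
   t in [0, 1], then the radial segment for t in [1, 2]. *)
Definition Gamma_path (R : realType) (q : nat) (theta t : R) : R[i] :=
  if t <= 1 then (q%:R ^- 2)%:C * e_ (t * theta)
  else ((2 - t) * q%:R ^- 2 + (t - 1) * (Num.sqrt q%:R)^-1)%:C * e_ theta.

(* phi is a continuous argument of G along Gamma(theta), starting from 0; in
   particular G does not vanish on the path. *)
Definition is_argument_along (R : realType) (q : nat) (G : R[i] -> R[i])
    (theta : R) (phi : R -> R) : Prop :=
  [/\ {within `[0, 2], continuous phi},
      phi 0 = 0 &
      forall t : R, 0 <= t <= 2 ->
        G (Gamma_path q theta t) != 0 /\
        G (Gamma_path q theta t)
          = `|G (Gamma_path q theta t)| * cis (phi t)].

(* Minus the change of argument of G along Gamma(theta). Junk value 0 when no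
   continuous argument exists (G vanishing on the path). *)
Definition arg_along (R : realType) (q : nat) (G : R[i] -> R[i]) (theta : R)
    : R :=
  - xget 0 [set a | exists2 phi, is_argument_along q G theta phi & a = phi 2].

Definition argL (R : realType) (F : finFieldType) (D : {poly F}) (theta : R)
    : R :=
  if Lfun D (critical_point #|F| theta) == 0
  then lim (arg_along #|F| (@Lfun R F D) (theta + eps) @[eps --> 0^'+])
  else arg_along #|F| (@Lfun R F D) theta.

Definition argPK (R : realType) (F : finFieldType) (K : nat) (D : {poly F})
    (theta : R) : R :=
  arg_along #|F| (@PKfun R F K D) theta.

Definition S_ (R : realType) (F : finFieldType) (theta : R) (D : {poly F})
    : R :=
  pi^-1 * argL D theta.

Definition SK (R : realType) (F : finFieldType) (K : nat) (theta : R)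
    (D : {poly F}) : R :=
  pi^-1 * argPK K D theta.

Definition logb {R : realType} (b : nat) (x : R) : R := ln x / ln b%:R.

(* Main.v *)
Require Import Defs.
From HB Require Import structures.
From mathcomp Require Import all_boot all_order all_algebra all_field.
From mathcomp Require Import all_classical all_reals all_analysis.
From mathcomp Require Import complex zify ring lra.
Set Implicit Arguments.
Unset Strict Implicit.
Unset Printing Implicit Defensive.
Import Order.TTheory GRing.Theory Num.Theory numFieldNormedType.Exports.
Local Open Scope classical_set_scope.
Local Open Scope ring_scope.

(* Quadratic reciprocity expresses chi_D(f) through the product of the values of
   f at the roots of D. This makes the coefficients of L vanish beyond degree
   2g and turns the sums of Lambda chi_D over degree k into character sums over
   the points of the field with q^k elements, which Stepanov's method bounds;
   together with the modulus of the leading coefficient of L this puts all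
   zeros on |u| = q^(-1/2). If they are the q^(-1/2) e(t_j), then S(theta) is
   the sum of the sawtooths 1/2 - {theta - t_j}, and S_K(theta) is the sum of
   the K-th partial sums of their Fourier series.

   A K-th partial sum is within O(min(1, 1/(K ||x||))) of the sawtooth. Since S
   decreases with slope 2g between its unit jumps, |S| <= M forces
   O(M + g delta) angles into an interval of length delta; summing the errors
   over intervals of length M / 2g gives the first claim. The second one needs
   S << g / log_q g: average the partial sums over n <= K < 2n, where q^(2n) is
   about g, and count the angles in intervals of length 1/(8n) by the Fejer
   kernel. *)

(** * Roots of irreducible polynomials over a finite field *)

(** The arithmetic takes place in an algebraic closure of F, where chi is a power of a product of
    values; as q is odd, its values 0, 1, -1 stay distinct there and can be read back as integers.
    The square-root bound is obtained only for sums of even degree 2k with q^k >= 2g + 3, where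
    Stepanov's auxiliary polynomial can use x -> x^(q^k). It gives |a|^2 <= q for every inverse zero
    a; equality follows from the product of all |a|, which takes the place of the functional
    equation. In the first claim Phi is arbitrary, so the angles can only be counted through the
    bound on S itself. The weights 1/(K m delta) over the m-th interval sum to a logarithm, and
    delta about Phi/g turns this into K >= (g log g)/Phi. In the bound S << g / log_q g such a
    logarithm would be lost: averaging over K replaces 1/m by 1/m^2, whose sum converges. *)

Section Frobenius.
Variables (F : finFieldType) (K : closedFieldType) (phi : {rmorphism F -> K}).
Local Notation q := #|F|.
Local Notation "p ^i" := (map_poly phi p) (at level 2, format "p ^i").

Lemma card_pchar_nat : [pchar K].-nat q.
Proof.
have [p p_pr pc] := finPcharP F.
have pcK : p \in [pchar K] by rewrite (fmorph_pchar phi).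
rewrite (card_pprimeChar pc) pnatX; apply/orP; left.
by rewrite pnatE.
Qed.

Lemma card_gt1 : (1 < q)%N. Proof. exact: finNzRing_gt1. Qed.

Lemma frobD n (x y : K) : (x + y) ^+ (q ^ n) = x ^+ (q ^ n) + y ^+ (q ^ n).
Proof. by apply: exprDn_pchar; rewrite pnatX card_pchar_nat. Qed.

Lemma frob_sum n (I : Type) (r : seq I) (P : pred I) (G : I -> K) :
  (\sum_(i <- r | P i) G i) ^+ (q ^ n) = \sum_(i <- r | P i) G i ^+ (q ^ n).
Proof.
apply: (big_morph (fun x => x ^+ (q ^ n)) (frobD n)).
by rewrite expr0n expn_eq0 -leqn0 leqNgt (ltnW card_gt1).
Qed.

Lemma frobN n (x : K) : (- x) ^+ (q ^ n) = - x ^+ (q ^ n).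
Proof.
apply/eqP; rewrite -subr_eq0 opprK -frobD addNr expr0n expn_eq0.
by rewrite -leqn0 leqNgt (ltnW card_gt1).
Qed.

Lemma frob_inj n : injective (fun x : K => x ^+ (q ^ n)).
Proof.
move=> x y /= /eqP; rewrite -subr_eq0 -frobN -frobD expf_eq0 => /andP[_].
by rewrite subr_eq0 => /eqP.
Qed.

Lemma frob_base n a : phi a ^+ (q ^ n) = phi a.
Proof.
by elim: n => [|n IHn]; rewrite ?expr1 // expnS exprM -rmorphXn expf_card.
Qed.

Lemma frob_horner n (p : {poly F}) x : p^i.[x ^+ (q ^ n)] = p^i.[x] ^+ (q ^ n).
Proof.
rewrite !horner_coef frob_sum; apply: eq_bigr => i _.
by rewrite exprMn coef_map /= frob_base -!exprM mulnC.
Qed.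

Lemma frob_fixed x : x ^+ q = x -> exists a, x = phi a.
Proof.
move=> xq; have := congr1 (fun p => (p^i).[x]) (finField_genPoly F).
rewrite rmorphB /= map_polyXn map_polyX !hornerE xq subrr.
rewrite rmorph_prod horner_prod => /esym/eqP/prodf_eq0[a _].
by rewrite /= map_polyXsubC hornerXsubC subr_eq0 => /eqP; exists a.
Qed.

Definition frob (x : K) := x ^+ q.

Fact frob_zmod : zmod_morphism frob.
Proof.
by move=> x y; rewrite /frob -[q]expn1 frobD frobN.
Qed.
Fact frob_monoid : monoid_morphism frob.
Proof. by split=> [|x y]; rewrite /frob ?expr1n ?exprMn. Qed.
HB.instance Definition _ := GRing.isZmodMorphism.Build K K frob frob_zmod.
HB.instance Definition _ := GRing.isMonoidMorphism.Build K K frob frob_monoid.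

Lemma frob_poly (p : {poly K}) : map_poly frob p = p -> exists p0, p = p0^i.
Proof.
move=> frobp.
have pi j : exists a, p`_j = phi a.
  by apply: frob_fixed; rewrite -{2}frobp coef_map.
have [c pc] := choice pi.
exists (\poly_(j < size p) c j); apply/polyP => j.
rewrite coef_map coef_poly; case: ltnP => [_|le]; first exact: pc.
by rewrite nth_default //; apply/esym/(rmorph0 phi).
Qed.

(** For [a] in the field with q^n elements this is its characteristic polynomial over [F]:
    conjugates repeat when the degree of [a] is a proper divisor of [n]. *)
Definition orb n (a : K) : {poly K} := \prod_(0 <= i < n) ('X - (a ^+ (q ^ i))%:P).

Lemma size_orb n a : size (orb n a) = n.+1.
Proof. by rewrite size_prod_XsubC size_iota subn0. Qed.

Lemma monic_orb n a : orb n a \is monic.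
Proof. exact: monic_prod_XsubC. Qed.

Lemma frob_orb n a : (0 < n)%N -> a ^+ (q ^ n) = a -> map_poly frob (orb n a) = orb n a.
Proof.
case: n => // n _ an; rewrite /orb rmorph_prod /=.
rewrite [RHS]big_nat_recl // expr1 big_nat_recr //= mulrC; congr (_ * _).
  by rewrite map_polyXsubC /= /frob -exprM -expnSr an.
by apply: eq_bigr => i _; rewrite map_polyXsubC /= /frob -exprM -expnSr.
Qed.

Lemma orb_period d k a : a ^+ (q ^ d) = a -> orb (k * d) a = orb d a ^+ k.
Proof.
move=> ad; have adk j : a ^+ (q ^ (j * d)) = a.
  elim: j => [|j IHj]; first by rewrite mul0n expr1.
  by rewrite mulSn expnD exprM ad.
elim: k => [|k IHk]; first by rewrite mul0n /orb big_geq.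
rewrite exprSr -IHk mulSn addnC /orb (big_cat_nat (n := (k * d)%N)) ?leq_addr //=.
congr (_ * _); rewrite -{1}[(k * d)%N]add0n big_addn addKn.
by apply: eq_bigr => i _; rewrite addnC expnD exprM adk.
Qed.

Lemma root_orb n a b :
  root (orb n a) b = (b \in [seq a ^+ (q ^ i) | i <- iota 0 n]).
Proof.
rewrite /orb /index_iota subn0.
by rewrite -(big_map (fun i => a ^+ (q ^ i)) xpredT (fun c => 'X - c%:P)) root_prod_XsubC.
Qed.

Lemma conj_uniq e (a : K) :
  (forall i, (0 < i < e)%N -> a ^+ (q ^ i) != a) ->
  uniq [seq a ^+ (q ^ i) | i <- iota 0 e].
Proof.
move=> amin; rewrite map_inj_in_uniq ?iota_uniq // => i j.
wlog le_ij : i j / (i <= j)%N.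
  by move=> H; case: (leqP i j) => [/H//|/ltnW/H h] ? ? ?; apply/esym/h.
rewrite !mem_iota /= !add0n => ie je.
rewrite -(subnK le_ij) expnD exprM => /frob_inj/esym ha.
case: (posnP (j - i)) => [->//|ji].
have := amin (j - i)%N; rewrite ji ltn_subLR // (leq_trans je) ?leq_addl //.
by rewrite ha eqxx => /(_ isT).
Qed.

Lemma root_conj (p : {poly F}) a n : root p^i a -> root p^i (a ^+ (q ^ n)).
Proof. by rewrite /root frob_horner => /eqP ->; rewrite expr0n expn_eq0 -leqn0 leqNgt (ltnW card_gt1). Qed.

Lemma ex_root (p : {poly F}) : size p != 1%N -> exists a, root p^i a.
Proof.
move=> sp; have : size p^i != 1%N by rewrite size_map_poly.
by case/closed_rootP => a; exists a.
Qed.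

(** A nonconstant divisor over [F] has some conjugate of [a] as a root, hence all of them, and these
    are [e] distinct elements. *)
Lemma orb_irr e (a : K) : (0 < e)%N -> a ^+ (q ^ e) = a ->
  (forall i, (0 < i < e)%N -> a ^+ (q ^ i) != a) ->
  exists2 P : {poly F}, P \is monic /\ irreducible_poly P & P^i = orb e a.
Proof.
move=> e0 ea amin; have [P defP] := frob_poly (frob_orb e0 ea).
have sP : size P = e.+1 by rewrite -(size_map_poly phi) -defP size_orb.
exists P => //; split.
  by rewrite -(map_monic phi) -defP monic_orb.
split; first by rewrite sP.
move=> Q sQ1 QP.
have [b rb] := ex_root sQ1.
have : root (orb e a) b.
  by have := QP; rewrite -(dvdp_map phi) defP => /dvdpP[c ->]; rewrite rootM rb orbT.
rewrite root_orb; case/mapP => i; rewrite mem_iota add0n /= => ie bE.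
have Qa : root Q^i a.
  have := root_conj (e - i) rb.
  by rewrite bE -exprM -expnD subnKC 1?ltnW // ea.
rewrite /eqp QP -(dvdp_map phi) -defP.
have -> : orb e a = \prod_(b <- [seq a ^+ (q ^ i) | i <- iota 0 e]) ('X - b%:P).
  by rewrite big_map /orb /index_iota subn0.
apply: uniq_roots_dvdp; last by rewrite uniq_rootsE conj_uniq.
by apply/allP => _ /mapP[j _ ->]; apply: root_conj.
Qed.

Lemma irr_eq (P Q : {poly F}) a : P \is monic -> irreducible_poly P ->
  Q \is monic -> irreducible_poly Q -> root P^i a -> root Q^i a -> P = Q.
Proof.
move=> mP iP mQ iQ Pa Qa.
have sG : size (gcdp P Q) != 1%N.
  rewrite -(size_map_poly phi) gcdp_map; apply/eqP => s1.
  have : root (gcdp P^i Q^i) a by rewrite root_gcd Pa Qa.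
  by have /size_poly1P[c c0 ->] := introT eqP s1; rewrite rootC (negPf c0).
have /eqP := (iP.2 _ sG (dvdp_gcdl _ _)); have /eqP := (iQ.2 _ sG (dvdp_gcdr _ _)).
move=> /eqP eQ /eqP eP; apply/eqP; rewrite -eqp_monic //.
by rewrite (eqp_trans _ eQ) // eqp_sym.
Qed.

(** Frobenius maps the finite set of roots injectively into itself, so the iterates of [a] cannot
    all differ. *)
Lemma root_periodic (p : {poly F}) a : p != 0 -> root p^i a ->
  exists2 n, (0 < n)%N & a ^+ (q ^ n) = a.
Proof.
move=> p0 pa; have [rs defp] := closed_field_poly_normal p^i.
have mem n : a ^+ (q ^ n) \in rs.
  have := root_conj n pa; rewrite defp rootZ ?root_prod_XsubC //.
  by rewrite lead_coef_eq0 map_poly_eq0.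
have : ~~ uniq [seq a ^+ (q ^ i) | i <- iota 0 (size rs).+1].
  apply/negP => /uniq_leq_size - /(_ rs).
  rewrite size_map size_iota ltnn => H.
  by suff: false by []; apply: H => _ /mapP[i _ ->]; exact: mem.
move=> nu; apply: contrapT => H; move/negP: nu; apply; apply: conj_uniq.
by move=> i /andP[i0 _]; apply/eqP => ai; apply: H; exists i.
Qed.

Lemma min_period (a : K) n : (0 < n)%N -> a ^+ (q ^ n) = a ->
  exists e, [/\ (0 < e)%N, a ^+ (q ^ e) = a, (e %| n)%N &
    forall i, (0 < i < e)%N -> a ^+ (q ^ i) != a].
Proof.
move=> n0 an.
have ex : exists e, (0 < e)%N && (a ^+ (q ^ e) == a) by exists n; rewrite n0 an eqxx.
case: (ex_minnP ex) => e /andP[e0 /eqP ea] emin.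
have amin i : (0 < i < e)%N -> a ^+ (q ^ i) != a.
  case/andP=> i0 ie; apply/eqP => ai; have := emin i; rewrite i0 ai eqxx => /(_ isT).
  by rewrite leqNgt ie.
exists e; split => //.
have aej j : a ^+ (q ^ (j * e)) = a.
  by elim: j => [|j IHj]; rewrite ?mul0n ?expr1 // mulSn expnD exprM ea.
rewrite /dvdn; case: posnP => // r0.
have := amin (n %% e)%N; rewrite r0 ltn_mod e0 => /(_ isT)/negP[].
by rewrite -{2}an {2}(divn_eq n e) expnD exprM aej.
Qed.

Lemma irr_root (P : {poly F}) a : P \is monic -> irreducible_poly P -> root P^i a ->
  let d := (size P).-1 in
  [/\ (0 < d)%N, P^i = orb d a, a ^+ (q ^ d) = a &
    forall i, (0 < i < d)%N -> a ^+ (q ^ i) != a].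
Proof.
move=> mP iP Pa.
have [n n0 an] := root_periodic (monic_neq0 mP) Pa.
have [e [e0 ea _ amin]] := min_period n0 an.
have [Q [mQ iQ] defQ] := orb_irr e0 ea amin.
have -> : P = Q.
  apply: (irr_eq mP iP mQ iQ Pa); rewrite defQ root_orb.
  by apply/mapP; exists 0; rewrite ?mem_iota ?expr1.
by rewrite /= -(size_map_poly phi) defQ size_orb.
Qed.

Lemma fixed_irr (a : K) n : (0 < n)%N -> a ^+ (q ^ n) = a ->
  exists P : {poly F}, [/\ P \is monic, irreducible_poly P, root P^i a,
    ((size P).-1 %| n)%N & orb n a = (P ^+ (n %/ (size P).-1))^i].
Proof.
move=> n0 an.
have [e [e0 ea en amin]] := min_period n0 an.
have [P [mP iP] defP] := orb_irr e0 ea amin.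
have sP : (size P).-1 = e by rewrite -(size_map_poly phi) defP size_orb.
exists P; split => //; rewrite ?sP //.
  by rewrite defP root_orb; apply/mapP; exists 0; rewrite ?mem_iota ?expr1.
by rewrite rmorphXn /= defP -orb_period // divnK.
Qed.

(** The q^d polynomials of degree less than d take distinct values at [a], all of them roots of
    X^(q^d) - X; one more root [x] would exceed its degree. *)
Lemma fixed_value (P : {poly F}) a : P \is monic -> irreducible_poly P -> root P^i a ->
  forall x : K, x ^+ (q ^ (size P).-1) = x ->
  exists y : {poly F}, x = y^i.[a].
Proof.
move=> mP iP Pa x xd; set d := (size P).-1 in xd.
have [d0 _ ad _] := irr_root mP iP Pa.
pose s := [seq (val y)^i.[a] | y <- enum {poly_d F}].
suff : x \in s by case/mapP => y _ ->; exists (val y).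
apply: contrapT => xs.
have us : uniq (x :: s).
  rewrite cons_uniq; apply/andP; split; first exact/negP.
  rewrite map_inj_uniq ?enum_uniq // => y z yz.
  apply/val_inj/eqP; rewrite /= -subr_eq0; apply/negPn/negP => n0.
  have : root (val y - val z)^i a by rewrite /root rmorphB hornerD hornerN yz subrr.
  have cop : coprimep P (val y - val z).
    have [iP1 iP2] := iP.
    rewrite /coprimep; apply: contraT => /iP2 - /(_ (dvdp_gcdl _ _)) ncop.
    have : P %| val y - val z by move/andP: ncop => [_ h]; rewrite (dvdp_trans h) ?dvdp_gcdr.
    move/dvdp_leq => /(_ n0); rewrite leqNgt => /negP[].
    rewrite -(ltn_predK iP1) ltnS (leq_trans (size_polyD _ _)) // size_polyN geq_max.
    by rewrite !size_npoly.
  rewrite -(coprimep_map phi) in cop.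
  by move/(coprimep_root cop)/negP: Pa => /[apply].
have := max_poly_roots (p := 'X^(q ^ d) - 'X) _ _ us.
have q1 : (1 < q ^ d)%N by rewrite (leq_trans card_gt1) // -[X in (X <= _)%N]expn1 leq_exp2l ?card_gt1.
have sz : size ('X^(q ^ d) - 'X : {poly K}) = (q ^ d).+1.
  by rewrite size_polyDl ?size_polyXn // size_polyN size_polyX.
rewrite -size_poly_eq0 sz => /(_ isT).
rewrite [size (_ :: _)]/= size_map -cardT card_npoly ltnS ltnn => H.
suff: false by []; apply: H.
rewrite [all _ _]/= {1}/root !hornerE xd subrr eqxx andTb.
apply/allP => _ /mapP[y _ ->]; rewrite /root !hornerE -frob_horner ad.
by rewrite subrr.
Qed.

End Frobenius.

(** * Quadratic reciprocity as a product over roots *)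

Section Factorization.
Variable F : finFieldType.
Implicit Types P Q f g D : {poly F}.

Lemma multiplicityP P f m : f != 0 -> (1 < size P)%N ->
  (P ^+ m %| f) = (m <= multiplicity P f)%N.
Proof.
move=> f0 sP; apply/idP/idP => [Pm|le_m].
  have lt_m : (m < size f)%N.
    apply: leq_trans (dvdp_leq f0 Pm).
    have -> : size (P ^+ m) = ((size P).-1 * m).+1.
      by rewrite -size_exp prednK // size_poly_gt0 expf_neq0 // -size_poly_gt0 ltnW.
    by rewrite ltnS leq_pmull // -ltnS (ltn_predK sP).
  exact: (leq_bigmax_cond (Ordinal lt_m)).
apply: dvdp_trans (dvdp_exp2l _ le_m) _.
have f1 : (0 < size f)%N by rewrite size_poly_gt0.
rewrite /multiplicity; case: (@eq_bigmax_cond _ [pred m : 'I_(size f) | P ^+ m %| f] (fun m => m)).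
  by apply/card_gt0P; exists (Ordinal f1); rewrite inE /= expr0 dvd1p.
by move=> i Pi ->.
Qed.

Lemma irr_coprime P Q : P \is monic -> irreducible_poly P ->
  Q \is monic -> irreducible_poly Q -> P != Q -> coprimep P Q.
Proof.
move=> mP [_ iP] mQ [_ iQ] PQ; apply: contraT; rewrite /coprimep => s1.
have eP := iP _ s1 (dvdp_gcdl _ _); have eQ := iQ _ s1 (dvdp_gcdr _ _).
case/negP: PQ; rewrite -eqp_monic //.
by rewrite (eqp_trans _ eQ) // eqp_sym.
Qed.

Lemma prod_coprime_dvdp (I : eqType) (s : seq I) (G : I -> {poly F}) f :
  uniq s -> {in s &, forall i j, i != j -> coprimep (G i) (G j)} ->
  {in s, forall i, G i %| f} -> \prod_(i <- s) G i %| f.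
Proof.
elim: s => [|i s IHs]; first by rewrite big_nil dvd1p.
rewrite cons_uniq big_cons => /andP[i_s us] cop dv.
rewrite Gauss_dvdp; last first.
  rewrite big_seq; elim/big_rec: _ => [|j g js IH]; first by rewrite coprimep1.
  rewrite coprimepMr IH andbT cop ?mem_head ?in_cons ?js ?orbT //.
  by apply: contraNneq i_s => ->.
rewrite dv ?mem_head // IHs // => [j k js ks|j js].
  by apply: cop; rewrite in_cons ?js ?ks orbT.
by rewrite dv // in_cons js orbT.
Qed.

Lemma ex_irr_dvdp f : (1 < size f)%N ->
  exists P, [/\ P \is monic, irreducible_poly P & P %| f].
Proof.
move: {2}(size f).+1 (ltnSn (size f)) => n; elim: n f => // n IHn f.
rewrite ltnS => fn f1; have f0 : f != 0 by rewrite -size_poly_gt0 ltnW.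
case: (pselect (irreducible_poly f)) => [irrf|].
  exists ((lead_coef f)^-1 *: f).
  have l0 : (lead_coef f)^-1 != 0 by rewrite invr_eq0 lead_coef_eq0.
  split; last by rewrite dvdpZl.
    by rewrite monicE lead_coefZ mulVf ?lead_coef_eq0.
  split; first by rewrite size_scale.
  move=> Q Q1; rewrite dvdpZr // => /(irrf.2 _ Q1) H.
  by apply: (eqp_trans H); rewrite eqp_sym eqp_scale.
move=> nirr.
have [Q [Q1 Qf nQ]] : exists Q, [/\ size Q != 1%N, Q %| f & ~~ (Q %= f)].
  apply: contrapT => H; apply: nirr; split => // Q Q1 Qf.
  by apply: contrapT => nQ; apply: H; exists Q; split => //; apply/negP.
have Q0 : Q != 0 by apply: contraTneq Qf => ->; rewrite dvd0p.
have sQ : (1 < size Q)%N by rewrite ltn_neqAle eq_sym Q1 size_poly_gt0.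
have Qlt : (size Q < size f)%N.
  by rewrite ltn_neqAle dvdp_leq // andbT dvdp_size_eqp.
have [P [mP iP PQ]] := IHn Q (leq_trans Qlt fn) sQ.
by exists P; split => //; apply: dvdp_trans PQ Qf.
Qed.

(** An irreducible factor of the cofactor would raise a multiplicity, so the cofactor is 1. *)
Lemma prod_multiplicity f : f \is monic ->
  \prod_(P : {poly_(size f) F} | ((P : {poly F}) \is monic) && irreducibleb (P : {poly F}))
     (P : {poly F}) ^+ multiplicity P f = f.
Proof.
move=> mf; have f0 := monic_neq0 mf.
set g := \prod_(P | _) _.
have mg : g \is monic by apply: monic_prod => P /andP[mP _]; apply: monic_exp.
have gf : g %| f.
  rewrite /g -big_filter; apply: prod_coprime_dvdp.
  - by rewrite filter_uniq // index_enum_uniq.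
  - move=> P Q; rewrite !mem_filter => /andP[/andP[mP /irreducibleP iP] _].
    move=> /andP[/andP[mQ /irreducibleP iQ] _] PQ.
    by rewrite coprimep_expl // coprimep_expr // irr_coprime.
  - move=> P; rewrite mem_filter => /andP[/andP[mP /irreducibleP iP] _].
    by rewrite multiplicityP // iP.1.
have /dvdpP[u fE] := gf.
have u0 : u != 0 by apply: contraNneq f0 => u0; rewrite fE u0 mul0r.
have mu : u \is monic.
  by have := mf; rewrite fE monicMr.
case: (ltnP 1 (size u)) => [su|su]; last first.
  rewrite fE; have /size1_polyC uE := su; rewrite uE.
  by move: mu; rewrite {1}uE monicE lead_coefC => /eqP ->; rewrite mul1r.
have [P [mP iP Pu]] := ex_irr_dvdp su.
have Pf : P %| f by rewrite fE dvdp_mulr.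
have sP : (size P <= size f)%N by apply: dvdp_leq.
have : P ^+ (multiplicity P f).+1 %| f.
  rewrite exprS {2}fE dvdp_mul // /g (bigD1 (NPoly (sP : P \is a poly_of_size (size f)))) /=.
    by rewrite dvdp_mulr.
  by rewrite mP; apply/irreducibleP.
by rewrite multiplicityP ?ltnn // iP.1.
Qed.

End Factorization.

(** * Euler's criterion and the reciprocity law *)

Section Reciprocity.
Variables (F : finFieldType) (hq : odd #|F|).
Variables (K : closedFieldType) (phi : {rmorphism F -> K}).
Local Notation q := #|F|.
Local Notation h := (#|F|./2).
Local Notation "p ^i" := (map_poly phi p) (at level 2, format "p ^i").

Lemma card_half : (h.*2.+1 = q)%N.
Proof. by rewrite -[RHS]odd_double_half hq. Qed.

Lemma card_half_gt0 : (0 < h)%N.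
Proof. by have := card_half; have := card_gt1 F; lia. Qed.

Lemma two_neq0 : (2%:R : K) != 0.
Proof.
apply/negP => /eqP K2.
have pc : 2%N \in [pchar K] by rewrite inE /= K2 eqxx.
have := card_pchar_nat phi; rewrite (eq_pnat _ (pcharf_eq pc)) => /p_natP[k qE].
have := hq; rewrite qE oddX orbF => /eqP k0.
by have := card_gt1 F; rewrite qE k0.
Qed.

Lemma oneN1 : (1 : K) != -1.
Proof. by rewrite -subr_eq0 opprK -[1 + 1]/(2%:R) two_neq0. Qed.

(** The exponent (q^d - 1)/2 of Euler's criterion, in a form that exhibits the power as the [h]-th
    power of a norm to [F]. *)
Lemma half_geometric d : ((\sum_(0 <= i < d) q ^ i * h)%N.*2.+1 = q ^ d)%N.
Proof.
elim: d => [|d IHd]; first by rewrite big_geq.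
rewrite big_nat_recr //= doubleD -addSn IHd -muln2.
have := card_half; set x := h; set y := (q ^ d)%N => E.
by rewrite expnS -/y -E -muln2; nia.
Qed.

Lemma irr_dvdp (P f : {poly F}) a : irreducible_poly P -> root P^i a ->
  (P %| f) = root f^i a.
Proof.
move=> iP Pa; apply/idP/idP => [|fa].
  by rewrite -(dvdp_map phi) => /dvdpP[c ->]; rewrite rootM Pa orbT.
have [_ iP2] := iP.
case: (boolP (coprimep P f)) => [|ncop].
  by rewrite -(coprimep_map phi) => cop; move/(coprimep_root cop): Pa; rewrite (eqP fa) eqxx.
by have /andP[_ h] := iP2 _ ncop (dvdp_gcdl _ _); apply: dvdp_trans h (dvdp_gcdr _ _).
Qed.

Variable D : {poly F}.

(** Euler's criterion in F[x]/P, identified through [a] with the field of q^d elements. If the power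
    is 1, a square root [w] taken in [K] is fixed by x -> x^(q^d), hence is the value at [a] of a
    polynomial. *)
Lemma legendre_pow (P : {poly F}) a : P \is monic -> irreducible_poly P -> root P^i a ->
  (legendre D P)%:~R = D^i.[a] ^+ (\sum_(0 <= i < (size P).-1) q ^ i * h)%N.
Proof.
move=> mP iP Pa; have [d0 _ ad _] := irr_root mP iP Pa.
set d := (size P).-1 in d0 ad *; set E := (\sum_(0 <= i < d) _)%N.
have EE : (E.*2.+1 = q ^ d)%N by rewrite half_geometric.
have E0 : (0 < E)%N.
  rewrite -double_gt0 -ltnS EE -{1}(expn0 q) ltn_exp2l ?card_gt1 //.
rewrite /legendre (irr_dvdp _ iP Pa) /root; case: eqP => [->|/eqP z0].
  by rewrite expr0n -leqn0 leqNgt E0.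
have pow x : x ^+ (q ^ d) = x -> x != 0 -> (x ^+ 2) ^+ E = 1 :> K.
  move=> xd x0; apply: (mulfI x0); rewrite mulr1 -exprM -exprS.
  by rewrite mul2n EE.
have zd : D^i.[a] ^+ (q ^ d) = D^i.[a] by rewrite -frob_horner ad.
case: asboolP => [[y yD]|ny].
  have : root (y ^+ 2 - D)^i a by rewrite -(irr_dvdp _ iP Pa).
  rewrite /root rmorphB rmorphXn hornerD hornerN horner_exp subr_eq0 => /eqP zE.
  rewrite -zE pow //; first by rewrite -frob_horner ad.
  by apply: contraNneq z0 => y0; rewrite -zE y0 expr0n.
have : (D^i.[a] ^+ E) ^+ 2 == 1 by rewrite -exprM mulnC exprM pow.
rewrite sqrf_eq1 => /orP[/eqP z1|/eqP ->]; last by rewrite mulrN1z.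
have [w wE] : exists w : K, w ^+ 2 = D^i.[a].
  have /closed_rootP[w] : size ('X^2 - (D^i.[a])%:P) != 1%N.
    by rewrite size_polyDl ?size_polyXn ?size_polyN ?(leq_ltn_trans (size_polyC_leq1 _)).
  by rewrite /root !hornerE subr_eq0 => /eqP; exists w.
have wd : w ^+ (q ^ d) = w by rewrite -EE exprS -mul2n exprM wE z1 mulr1.
have [y yE] := fixed_value mP iP Pa wd.
case: ny; exists y; rewrite (irr_dvdp _ iP Pa) /root rmorphB rmorphXn.
by rewrite hornerD hornerN horner_exp -yE wE subrr.
Qed.

Variable rsD : seq K.
Hypothesis defD : D^i = \prod_(c <- rsD) ('X - c%:P).

(** With [rsD] the roots of the monic [D], this is the resultant of [D] and [f]. *)
Definition resD (f : {poly F}) : K := \prod_(c <- rsD) f^i.[c].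

Lemma resDM f g : resD (f * g) = resD f * resD g.
Proof.
by rewrite /resD -big_split; apply: eq_bigr => c _; rewrite rmorphM hornerM.
Qed.

(* By reciprocity, (D / f) for f monic, read off the values of f at the roots of D. *)
Definition jacobiK (f : {poly F}) : K :=
  ((-1) ^+ (size rsD * (size f).-1) * resD f) ^+ h.

Lemma jacobiKM f g : f \is monic -> g \is monic -> jacobiK (f * g) = jacobiK f * jacobiK g.
Proof.
move=> mf mg; rewrite /jacobiK -exprMn resDM; congr (_ ^+ _).
rewrite size_monicM ?monic_neq0 // mulrACA -exprD -mulnDr.
congr ((-1) ^+ (_ * _) * _).
by have := size_poly_gt0 f; have := size_poly_gt0 g; rewrite !monic_neq0 //; lia.
Qed.

Lemma jacobiK1 : jacobiK 1 = 1.
Proof.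
rewrite /jacobiK size_poly1 muln0 mul1r /resD big1 ?expr1n // => c _.
by rewrite rmorph1 hornerC.
Qed.

Lemma jacobiKX f n : f \is monic -> jacobiK (f ^+ n) = jacobiK f ^+ n.
Proof.
move=> mf; elim: n => [|n IHn]; first by rewrite jacobiK1.
by rewrite !exprS jacobiKM ?monic_exp // IHn.
Qed.

Lemma jacobiK_prod (I : finType) (P : pred I) (G : I -> {poly F}) :
  (forall i, P i -> G i \is monic) ->
  jacobiK (\prod_(i | P i) G i) = \prod_(i | P i) jacobiK (G i).
Proof.
move=> mG; suff [] : (\prod_(i | P i) G i) \is monic /\
   jacobiK (\prod_(i | P i) G i) = \prod_(i | P i) jacobiK (G i) by [].
elim/big_ind2: _ => [|f x g y [mf <-] [mg <-]|i /mG //].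
  by rewrite monic1 jacobiK1.
by rewrite monicMl // jacobiKM.
Qed.

(** Exchanging the roots of [D] with those of [f] in the double product of differences costs the
    sign (-1)^(deg D deg f) that [jacobiK] contains; then D(a^(q^i)) = D(a)^(q^i). *)
Lemma orb_jacobiK n a (f : {poly F}) : f^i = orb F n a ->
  jacobiK f = D^i.[a] ^+ (\sum_(0 <= i < n) q ^ i * h)%N.
Proof.
move=> fE; rewrite /jacobiK.
have sf : size f = n.+1 by rewrite -(size_map_poly phi) fE size_orb.
have -> : (\sum_(0 <= i < n) q ^ i * h = (\sum_(0 <= i < n) q ^ i) * h)%N by rewrite big_distrl.
rewrite [in RHS]exprM; congr (_ ^+ h); rewrite -prodrXr.
transitivity (\prod_(0 <= i < n) \prod_(c <- rsD) (-1 * (c - a ^+ (q ^ i)))).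
  rewrite exchange_big /= sf /= mulnC exprM -[_ ^+ size _]iter_mulr_1.
  rewrite -count_predT -big_const_seq /resD -big_split /=.
  apply: eq_bigr => c _; rewrite fE /orb horner_prod big_split /= prodr_const_nat subn0.
  by congr (_ * _); apply: eq_bigr => i _; rewrite hornerXsubC.
apply: eq_bigr => i _; rewrite -frob_horner defD horner_prod.
by apply: eq_bigr => c _; rewrite hornerXsubC mulN1r opprB.
Qed.

(** Lifts 0, 1, -1 from [K] back to integers, faithfully because the characteristic is odd. *)
Definition sgnK (w : K) : int := if w == 0 then 0 else if w == 1 then 1 else -1.

Lemma sgnK0 : sgnK 0 = 0. Proof. by rewrite /sgnK eqxx. Qed.
Lemma sgnK1 : sgnK 1 = 1. Proof. by rewrite /sgnK oner_eq0 eqxx. Qed.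
Lemma sgnKN1 : sgnK (-1) = -1.
Proof. by rewrite /sgnK oppr_eq0 oner_eq0 eq_sym (negPf oneN1). Qed.

Definition signs : seq int := [:: 0; 1; -1].

Lemma sgnK_intr (z : int) : z \in signs -> sgnK z%:~R = z.
Proof.
by rewrite !inE => /or3P[]/eqP->; rewrite ?mulrN1z ?sgnK0 ?sgnK1 ?sgnKN1.
Qed.

Lemma signsM (y z : int) : y \in signs -> z \in signs -> y * z \in signs.
Proof. by rewrite !inE => /or3P[]/eqP-> /or3P[]/eqP->. Qed.

Lemma legendre_signs P : legendre D P \in signs.
Proof. by rewrite /legendre; case: ifP => // _; case: ifP. Qed.

Lemma chi_signs f : chi D f \in signs.
Proof.
rewrite /chi; elim/big_ind: _ => // [y z|P _]; first exact: signsM.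
elim: (multiplicity _ _) => [|n IHn]; first by rewrite expr0.
by rewrite exprS signsM ?legendre_signs.
Qed.

Theorem chi_jacobiK f : f \is monic -> (chi D f)%:~R = jacobiK f.
Proof.
move=> mf; rewrite -{2}(prod_multiplicity mf) jacobiK_prod; last first.
  by move=> P /andP[mP _]; apply: monic_exp.
rewrite /chi rmorph_prod /=; apply: eq_bigr => P /andP[mP /irreducibleP iP].
rewrite rmorphXn /= jacobiKX //; congr (_ ^+ _).
have [|a Pa] := ex_root phi (p := P); first by rewrite neq_ltn iP.1 orbT.
rewrite (legendre_pow mP iP Pa).
have [_ defP _ _] := irr_root mP iP Pa.
by rewrite (orb_jacobiK defP).
Qed.

Corollary chiE f : f \is monic -> chi D f = sgnK (jacobiK f).
Proof. by move=> mf; rewrite -chi_jacobiK // sgnK_intr ?chi_signs. Qed.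

Lemma chiM f g : f \is monic -> g \is monic -> chi D (f * g) = chi D f * chi D g.
Proof.
move=> mf mg; rewrite chiE ?monicMl // jacobiKM // -!chi_jacobiK // -rmorphM.
by rewrite sgnK_intr // signsM // chi_signs.
Qed.

End Reciprocity.

(** * Coefficients of the L-function and character sums *)

Section Degree.
Variable F : finFieldType.
Implicit Types P Q f g D : {poly F}.
Local Notation q := #|F|.

Lemma monic_of_degE n (f : {poly F}) : (size f <= n.+1)%N ->
  monic_of_deg n f = (f`_n == 1).
Proof.
move=> sf; rewrite /monic_of_deg inE monicE.
apply/idP/idP => [/andP[/eqP lf /eqP s]|/eqP fn].
  by rewrite -lf lead_coefE s.
suff s : size f = n.+1 by rewrite lead_coefE s fn !eqxx.
apply/eqP; rewrite eqn_leq sf /= ltnNge; apply/negP => le.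
by move: fn; rewrite nth_default // => /esym/eqP; rewrite oner_eq0.
Qed.

Definition degsum (V : nmodType) n (G : {poly F} -> V) : V :=
  \sum_(f : {poly_(n.+1) F} | monic_of_deg n (f : {poly F})) G f.

Lemma vonMangoldt_pow P n : P \is monic -> irreducible_poly P -> (0 < n)%N ->
  vonMangoldt (P ^+ n) = (size P).-1.
Proof.
move=> mP iP n0; rewrite /vonMangoldt; set S := (X in xget _ X).
have [Q [k [mQ iQ k0 E ->]]] : S (xget 0%N S).
  by apply: (@xgetPex _ 0%N S); exists (size P).-1, P, n.
congr (size _).-1; apply/eqP; apply: contraT => QP.
have : coprimep P (Q ^+ k) by rewrite coprimep_expr // irr_coprime // eq_sym.
rewrite -E coprimep_pexpr // coprimepp => /eqP s1.
by have := iP.1; rewrite s1.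
Qed.

Lemma pow_irr_inj P Q n k : P \is monic -> irreducible_poly P -> (0 < n)%N ->
  Q \is monic -> irreducible_poly Q -> P ^+ n = Q ^+ k -> P = Q /\ n = k.
Proof.
move=> mP iP n0 mQ iQ E.
have sz (R : {poly F}) j : R \is monic -> size (R ^+ j) = ((size R).-1 * j).+1.
  by move=> mR; rewrite -size_exp prednK // size_poly_gt0 monic_neq0 // monic_exp.
have PQ : P = Q.
  apply/eqP; apply: contraT => PQ.
  have : coprimep P (Q ^+ k) by rewrite coprimep_expr // irr_coprime.
  rewrite -E coprimep_pexpr // coprimepp => /eqP s1.
  by have := iP.1; rewrite s1.
split => //; have := sz P n mP; rewrite E -PQ sz // => -[/eqP].
rewrite eqn_pmul2l; first by move/eqP->.
by rewrite -ltnS (ltn_predK iP.1) iP.1.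
Qed.

Definition irr n (P : {poly_n F}) :=
  ((P : {poly F}) \is monic) && irreducibleb (P : {poly F}).

(** At most one prime power matches [f]. As a finite sum, the value chosen in [vonMangoldt] can take
    part in exchanges of summation. *)
Lemma vonMangoldtE N f : (size f <= N.+1)%N ->
  vonMangoldt f = (\sum_(P : {poly_N.+1 F} | irr P) \sum_(1 <= j < N.+1)
     (f == (P : {poly F}) ^+ j) * (size P).-1)%N.
Proof.
move=> sf; case: (pselect (exists P n, [/\ P \is monic, irreducible_poly P, (0 < n)%N & f = P ^+ n])).
  case=> P [n [mP iP n0 fE]].
  have f0 : f != 0 by rewrite fE monic_neq0 // monic_exp.
  have sfE : size f = ((size P).-1 * n).+1.
    by rewrite fE -size_exp prednK // size_poly_gt0 -fE.
  have d0 : (0 < (size P).-1)%N by rewrite -ltnS (ltn_predK iP.1) iP.1.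
  have sP : (size P <= N.+1)%N.
    by rewrite (leq_trans _ sf) // sfE -(ltn_predK iP.1) ltnS leq_pmulr.
  have nN : (n < N.+1)%N by rewrite (leq_trans _ sf) // sfE ltnS leq_pmull.
  rewrite fE vonMangoldt_pow // (bigD1 (NPoly (sP : P \is a poly_of_size N.+1))) /=; last first.
    by rewrite /irr mP; apply/irreducibleP.
  rewrite [X in (_ + X)%N]big1 ?addn0; last first.
    move=> Q /andP[/andP[mQ /irreducibleP iQ] QP]; rewrite big_seq big1 // => j _.
    case: eqP => // /(pow_irr_inj mP iP n0 mQ iQ)[PQ _].
    by case/eqP: QP; apply: val_inj.
  rewrite (bigD1_seq n) ?mem_index_iota ?n0 ?iota_uniq //= eqxx mul1n big1 ?addn0 //.
  move=> j jn; case: eqP => // /(pow_irr_inj mP iP n0 mP iP)[_ nj].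
  by rewrite nj eqxx in jn.
move=> nex; rewrite /vonMangoldt xgetPN; last first.
  by move=> d [P [n [? ? ? ? _]]]; apply: nex; exists P, n.
rewrite big1 // => P /andP[mP /irreducibleP iP]; rewrite big_nat big1 // => j /andP[j0 _].
by case: eqP => // fE; case: nex; exists P, j.
Qed.

Lemma size_prod_monic (I : finType) (A : pred I) (G : I -> {poly F}) :
  (forall i, A i -> G i \is monic) ->
  (size (\prod_(i | A i) G i)).-1 = (\sum_(i | A i) (size (G i)).-1)%N.
Proof.
move=> mG; suff [] : (\prod_(i | A i) G i) \is monic /\
   (size (\prod_(i | A i) G i)).-1 = (\sum_(i | A i) (size (G i)).-1)%N by [].
elim/big_ind2: _ => [|x f y g [mf <-] [mg <-]|i /mG //].
  by rewrite monic1 size_poly1.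
rewrite monicMl // size_monicM ?monic_neq0 //; split => //.
by have := size_poly_gt0 f; have := size_poly_gt0 g; rewrite !monic_neq0 //; lia.
Qed.

(** The identity deg f = sum of Lambda(d) over d dividing f, with d running over the prime powers
    P^j. *)
Lemma degree_sum n f : f \is monic -> size f = n.+1 ->
  n = (\sum_(P : {poly_n.+1 F} | irr P) \sum_(1 <= j < n.+1)
         ((P : {poly F}) ^+ j %| f)%R * (size P).-1)%N.
Proof.
move=> mf sf; have f0 := monic_neq0 mf.
have := congr1 (fun g : {poly F} => (size g).-1) (prod_multiplicity mf).
rewrite size_prod_monic => [|P /andP[mP _]]; last exact: monic_exp.
rewrite sf /= => {1}<-.
apply: eq_bigr => P /andP[mP /irreducibleP iP].
rewrite size_exp -big_distrl /= mulnC; congr (_ * _)%N.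
rewrite (eq_bigr (fun j => (j <= multiplicity P f)%N : nat)); last first.
  by move=> j _; rewrite multiplicityP // iP.1.
have mn : (multiplicity P f <= n)%N.
  by apply/bigmax_leqP => j _; rewrite -ltnS -sf.
rewrite (big_cat_nat (n := (multiplicity P f).+1)) //=.
rewrite (eq_big_nat _ _ (F2 := fun=> 1%N)); last first.
  by move=> j /andP[_]; rewrite ltnS => ->.
rewrite [X in (_ + X)%N](eq_big_nat _ _ (F2 := fun=> 0%N)); last first.
  by move=> j /andP[j1 _]; rewrite leqNgt j1.
by rewrite !sum_nat_const_nat subn1 muln1 muln0 addn0.
Qed.

End Degree.

(** * Newton's identities for the coefficients of L *)

Section Sums.
Variables (F : finFieldType) (hq : odd #|F|).
Variables (K : closedFieldType) (phi : {rmorphism F -> K}).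
Local Notation q := #|F|.
Local Notation h := (#|F|./2).
Local Notation "p ^i" := (map_poly phi p) (at level 2, format "p ^i").
Variables (D : {poly F}) (rsD : seq K).
Hypothesis defD : D^i = \prod_(c <- rsD) ('X - c%:P).

(** [Lcoef] and [psi] are the coefficients of L(u) and of u L'(u)/L(u). *)
Definition Lcoef n : int := degsum n (chi D).
Definition psi n : int := degsum n (fun f => (vonMangoldt f)%:Z * chi D f).

Lemma sum_multiples n k (d : {poly F}) : d \is monic -> size d = k.+1 -> (k <= n)%N ->
  degsum n (fun f => if d %| f then chi D f else 0) = chi D d * Lcoef (n - k).
Proof.
move=> md sd kn; rewrite /Lcoef /degsum big_distrr /= -big_mkcondr /=.
have d0 := monic_neq0 md.
rewrite (reindex_onto (fun e : {poly_(n - k).+1 F} => npolyp n.+1 (d * e))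
  (fun f : {poly_n.+1 F} => npolyp (n - k).+1 ((f : {poly F}) %/ d))); last first.
  move=> f /andP[/andP[mf /eqP sf] df]; apply: val_inj => /=.
  rewrite !npolypK ?divpKC // ?size_divp ?sf ?sd /= ?subSn //.
have sde (e : {poly F}) : (size e <= (n - k).+1)%N -> (size (d * e)%R <= n.+1)%N.
  move=> se; have := size_polyMleq d e; rewrite sd addSn /= => h1.
  by rewrite -(leq_add2l k) addnS subnKC // in se; exact: leq_trans h1 se.
apply: eq_big => [e|e] /=; rewrite !npolypK ?sde ?size_npoly //.
  rewrite mulKp // dvdp_mulr // andbT.
  have -> : npolyp (n - k).+1 e = e by apply: val_inj; rewrite /= npolypK ?size_npoly.
  rewrite eqxx andbT /monic_of_deg !inE monicMl //; apply: andb_id2l => me.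
  rewrite size_monicM ?monic_neq0 // sd; have := size_poly_gt0 e; rewrite monic_neq0 //.
  by move=> e0; apply/eqP/eqP => E; lia.
rewrite mulKp // dvdp_mulr // => /andP[/andP[/andP[m _] _] _].
by rewrite (chiM hq defD) //; move: m; rewrite monicMl.
Qed.

Lemma sum_multiples0 n k (d : {poly F}) : size d = k.+1 -> (n < k)%N ->
  degsum n (fun f => if d %| f then chi D f else 0) = 0.
Proof.
move=> sd nk; rewrite /degsum big1 // => f /andP[mf /eqP sf]; case: ifP => // df.
by have := dvdp_leq (monic_neq0 mf) df; rewrite sd sf; lia.
Qed.

Lemma psiE N k : (k <= N)%N ->
  psi k = \sum_(P : {poly_N.+1 F} | irr P) \sum_(1 <= j < N.+1)
    (if (j * (size P).-1 == k)%N then chi D ((P : {poly F}) ^+ j) * (size P).-1%:R else 0).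
Proof.
move=> kN; rewrite /psi /degsum.
transitivity (\sum_(f : {poly_k.+1 F} | monic_of_deg k (f : {poly F}))
  \sum_(P : {poly_N.+1 F} | irr P) \sum_(1 <= j < N.+1)
    ((f : {poly F}) == (P : {poly F}) ^+ j)%:R * (size P).-1%:R * chi D f).
  apply: eq_bigr => f _; rewrite (vonMangoldtE (N := N)); last first.
    by rewrite (leq_trans (size_npoly f)).
  rewrite -[Posz _]natz natr_sum big_distrl; apply: eq_bigr => P _ /=.
  by rewrite natr_sum big_distrl; apply: eq_bigr => j _ /=; rewrite natrM.
rewrite exchange_big; apply: eq_bigr => P /andP[mP _] /=.
rewrite exchange_big; apply: eq_bigr => j _ /=.
have sPj : size ((P : {poly F}) ^+ j) = (j * (size P).-1).+1.
  by rewrite mulnC -size_exp prednK // size_poly_gt0 monic_neq0 // monic_exp.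
case: eqP => E.
  have sPj' : (size ((P : {poly F}) ^+ j) <= k.+1)%N by rewrite sPj E.
  rewrite (bigD1 (NPoly (sPj' : _ \is a poly_of_size k.+1))) /=; last first.
    by rewrite /monic_of_deg inE monic_exp //= sPj E.
  rewrite eqxx mul1r mulrC big1 ?addr0 // => f /andP[_ nf].
  by case: eqP => [fE|_]; rewrite ?mul0r //; case/eqP: nf; apply: val_inj.
rewrite big1 // => f /andP[_ /eqP sf]; case: eqP => [fE|_]; rewrite ?mul0r //.
by case: E; apply: succn_inj; rewrite -sPj -fE sf.
Qed.

(** Compares coefficients in u L' = (u L'/L) L: replace deg f by the sum of Lambda(d) over d
    dividing f, write f = d e and use multiplicativity. *)
Theorem Lcoef_newton n : n%:R * Lcoef n = \sum_(1 <= k < n.+1) psi k * Lcoef (n - k).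
Proof.
transitivity (\sum_(P : {poly_n.+1 F} | irr P) \sum_(1 <= j < n.+1)
   if (j * (size P).-1 <= n)%N then
     chi D ((P : {poly F}) ^+ j) * Lcoef (n - j * (size P).-1) * (size P).-1%:R else 0).
  transitivity (\sum_(f : {poly_n.+1 F} | monic_of_deg n (f : {poly F}))
   \sum_(P : {poly_n.+1 F} | irr P) \sum_(1 <= j < n.+1)
    (if (P : {poly F}) ^+ j %| f then chi D f else 0) * (size P).-1%:R).
    rewrite /Lcoef /degsum big_distrr; apply: eq_bigr => f /andP[mf /eqP sf] /=.
    rewrite {1}(degree_sum mf sf) natr_sum big_distrl; apply: eq_bigr => P _ /=.
    rewrite natr_sum big_distrl; apply: eq_bigr => j _ /=; rewrite natrM.
    by case: ifP => _; rewrite ?mul1r ?mul0r // mulrC.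
  rewrite exchange_big; apply: eq_bigr => P /andP[mP _] /=.
  rewrite exchange_big; apply: eq_bigr => j _ /=.
  have sPj : size ((P : {poly F}) ^+ j) = (j * (size P).-1).+1.
    by rewrite mulnC -size_exp prednK // size_poly_gt0 monic_neq0 // monic_exp.
  rewrite -big_distrl /=; case: leqP => jn.
    by have := sum_multiples (monic_exp j mP) sPj jn; rewrite /degsum => ->.
  by have := sum_multiples0 sPj jn; rewrite /degsum => ->; rewrite mul0r.
rewrite [RHS](eq_big_nat _ _ (F2 := fun k => \sum_(P : {poly_n.+1 F} | irr P) \sum_(1 <= j < n.+1)
    (if (j * (size P).-1 == k)%N then chi D ((P : {poly F}) ^+ j) * (size P).-1%:R else 0) *
    Lcoef (n - k))); last first.
  move=> k /andP[_]; rewrite ltnS => kn; rewrite (psiE kn) big_distrl; apply: eq_bigr => P _ /=.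
  by rewrite big_distrl.
rewrite [RHS]exchange_big; apply: eq_bigr => P /andP[mP /irreducibleP iP] /=.
rewrite [RHS]exchange_big; apply: eq_big_nat => j /andP[j0 _] /=.
have d0 : (0 < (size P).-1)%N by rewrite -ltnS (ltn_predK iP.1) iP.1.
case: leqP => jn.
  rewrite (bigD1_seq (j * (size P).-1)%N) ?iota_uniq //=; last first.
    by rewrite mem_index_iota muln_gt0 j0 d0 ltnS jn.
  rewrite eqxx mulrAC big1 ?addr0 // => k; rewrite eq_sym => /negPf ->.
  by rewrite mul0r.
rewrite big_nat big1 // => k /andP[_ kn]; case: eqP => [E|]; rewrite ?mul0r //.
by move: jn; rewrite E; lia.
Qed.

End Sums.

(** * Vanishing beyond degree 2g, and character sums over points *)

Section Values.
Variables (F : finFieldType) (hq : odd #|F|).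
Variables (K : closedFieldType) (phi : {rmorphism F -> K}).
Local Notation q := #|F|.
Local Notation h := (#|F|./2).
Local Notation "p ^i" := (map_poly phi p) (at level 2, format "p ^i").

Lemma card_natr n : (0 < n)%N -> (q ^ n)%:R = 0 :> K.
Proof.
case: n => // n _; rewrite expnS natrM.
have pK : pdiv q \in [pchar K].
  by apply: (pnatPpi (card_pchar_nat phi)); rewrite pi_pdiv card_gt1.
have := pdiv_dvd q => /dvdnP[k {1}->].
by rewrite [(k * _)%:R]natrM (pcharf0 pK) mulr0 mul0r.
Qed.

(** X^(q^n) - X is separable, its derivative being -1. *)
Lemma fixed_points n : (0 < n)%N ->
  exists s : seq K, [/\ uniq s, size s = (q ^ n)%N &
    forall a, (a \in s) = (a ^+ (q ^ n) == a)].
Proof.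
move=> n0; pose p : {poly K} := 'X^(q ^ n) - 'X.
have q1 : (1 < q ^ n)%N by rewrite -{1}(expn0 q) ltn_exp2l ?card_gt1.
have sp : size p = (q ^ n).+1.
  by rewrite /p size_polyDl ?size_polyXn // size_polyN size_polyX.
have mp : p \is monic by rewrite monicE lead_coefDl ?lead_coefXn // size_polyXn size_polyN size_polyX.
have [s] := closed_field_poly_normal p; rewrite (monicP mp) scale1r => ps.
exists s; split.
- rewrite -separable_prod_XsubC -ps separable_poly.unlock /p derivB derivXn derivX.
  rewrite -mulr_natr -polyC_natr card_natr // polyC0 mulr0 sub0r.
  by rewrite -(scaleN1r 1) coprimepZr ?coprimep1 // oppr_eq0 oner_eq0.
- by apply: succn_inj; rewrite -sp ps size_prod_XsubC.
- move=> a; rewrite -root_prod_XsubC -ps /root /p !hornerE subr_eq0.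
  by [].
Qed.

Lemma nonresidue : exists c : F, phi c ^+ h = -1.
Proof.
have [c c0 cN] : exists2 c : F, c != 0 & c ^+ h != 1.
  apply: contrapT => H.
  have sE : size ('X^h - 1%:P : {poly F}) = h.+1 by rewrite size_XnsubC // card_half_gt0 //.
  have := @max_poly_roots _ ('X^h - 1%:P : {poly F}) (enum [pred c : F | c != 0%R]).
  rewrite -size_poly_gt0 sE enum_uniq -cardE => /(_ isT) mx.
  suff : (#|[pred c : F | c != 0%R]| < h.+1)%N.
    have := cardC1 (0 : F); rewrite -(card_half hq) => ->; have := card_half_gt0 hq; lia.
  apply: mx => //; apply/allP => c; rewrite mem_enum inE => c0.
  rewrite /root !hornerE subr_eq0; apply: contraT => cN.
  by case: H; exists c.
exists c; have : (c ^+ h) ^+ 2 == 1.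
  rewrite -exprM muln2; apply/eqP/(mulfI c0).
  by rewrite -exprS (card_half hq) expf_card mulr1.
by rewrite sqrf_eq1 (negPf cN) -rmorphXn => /eqP ->; rewrite rmorphN1.
Qed.

Variables (D : {poly F}) (rsD : seq K).
Hypothesis defD : D^i = \prod_(c <- rsD) ('X - c%:P).

Lemma size_defD : size D = (size rsD).+1.
Proof. by rewrite -(size_map_poly phi) defD size_prod_XsubC. Qed.

Lemma monic_defD : D \is monic.
Proof. by rewrite -(map_monic phi) defD monic_prod_XsubC. Qed.

Lemma horner_defD c : c \in rsD -> D^i.[c] = 0.
Proof. by move=> cD; apply/eqP; rewrite -/(root _ _) defD root_prod_XsubC. Qed.

Lemma resD_mod f : resD phi rsD (f %% D) = resD phi rsD f.
Proof.
apply: eq_big_seq => c /horner_defD Dc.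
by rewrite [f in RHS](divp_eq f D) rmorphD rmorphM hornerD hornerM Dc mulr0 add0r.
Qed.

Lemma resD_scale a f : resD phi rsD (a *: f) = phi a ^+ size rsD * resD phi rsD f.
Proof.
rewrite /resD -[_ ^+ size _]iter_mulr_1 -count_predT -big_const_seq -big_split /=.
by apply: eq_bigr => c _; rewrite map_polyZ hornerZ.
Qed.

Hypothesis odd_deg : odd (size rsD).

Lemma Lcoef_eq0 n : (size rsD <= n)%N -> Lcoef D n = 0.
Proof.
move=> mn; have [a ah] := nonresidue.
(* For n >= deg D the residue of [f] modulo [D] can be multiplied by the nonresidue [a] without
   touching the leading coefficient. As deg D is odd, this changes the sign of [chi D]. *)
pose sigma (f : {poly F}) : {poly F} := f + (a - 1) *: (f %% D).
have D0 := monic_neq0 monic_defD.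
have a0 : a != 0.
  apply/eqP => a0; move/eqP: ah; rewrite a0 rmorph0 expr0n -leqn0 leqNgt (card_half_gt0 hq) /=.
  by rewrite eq_sym oppr_eq0 oner_eq0.
have szr (f : {poly F}) : (size ((a - 1) *: (f %% D))%R <= n)%N.
  rewrite (leq_trans (size_scale_leq _ _)) // (leq_trans _ mn) //.
  by rewrite -ltnS -size_defD ltn_modp.
have sz (f : {poly F}) : (size f <= n.+1)%N -> (size (sigma f) <= n.+1)%N.
  by move=> sf; rewrite (leq_trans (size_polyD _ _)) // geq_max sf (leq_trans (szr f)).
have sigmod f : sigma f %% D = a *: (f %% D).
  by rewrite modpD modpZl (@modp_small _ (f %% D)) ?ltn_modp // scalerBl scale1r addrC subrK.
have inj : injective (fun f : {poly_n.+1 F} => npolyp n.+1 (sigma f)).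
  move=> f g /(congr1 (fun x : {poly_n.+1 F} => (x : {poly F}))).
  rewrite /= !npolypK ?sz ?size_npoly // => E.
  have := congr1 (fun x => x %% D) E; rewrite !sigmod => /(scalerI a0) E2.
  by apply: val_inj; move: E; rewrite /sigma E2 => /addIr.
have chis (f : {poly F}) : f \is monic -> size f = n.+1 -> sigma f \is monic ->
    size (sigma f) = n.+1 -> chi D (sigma f) = - chi D f.
  move=> mf sf ms ss.
  have : ((chi D (sigma f))%:~R : K) = (- chi D f)%:~R.
    rewrite mulrNz (chi_jacobiK hq defD ms) (chi_jacobiK hq defD mf) /jacobiK ss sf !exprMn -!exprM.
    rewrite -resD_mod sigmod resD_scale resD_mod exprMn exprAC ah.
    have -> : (-1) ^+ size rsD = -1 :> K by rewrite -signr_odd odd_deg.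
    by rewrite mulN1r mulrN.
  have sN z : z \in signs -> - z \in signs by rewrite !inE => /or3P[]/eqP->.
  by move/(congr1 (@sgnK K)); rewrite !(sgnK_intr hq phi) ?sN ?chi_signs.
have mon (f : {poly_n.+1 F}) : monic_of_deg n (sigma f) = monic_of_deg n (f : {poly F}).
  rewrite !monic_of_degE ?sz ?size_npoly // coefD.
  by rewrite [X in _ + X]nth_default ?addr0.
have : Lcoef D n = - Lcoef D n.
  rewrite {1}/Lcoef /degsum (reindex_inj inj) /= -sumrN.
  apply: eq_big => [f|f]; rewrite npolypK ?sz ?size_npoly // mon //.
  move=> mf; have ms := mon f; rewrite mf in ms.
  case/andP: mf => mf /eqP sf; case/andP: ms => ms /eqP ss.
  exact: chis.
lia.
Qed.

Definition point_sum n (s : seq K) : int :=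
  \sum_(a <- s) sgnK (D^i.[a] ^+ (\sum_(0 <= i < n) q ^ i * h)%N).

(** Group the points by minimal polynomial P. If d = deg P divides n, each of its d roots
    contributes [chi D (P ^+ (n %/ d))], in total the term of P^(n/d) in [psi]. *)
Lemma psi_points n s : (0 < n)%N -> uniq s ->
  (forall a, (a \in s) = (a ^+ (q ^ n) == a)) -> psi D n = point_sum n s.
Proof.
move=> n0 us mems; rewrite (psiE D (leqnn n)) /point_sum.
transitivity (\sum_(a <- s) \sum_(P : {poly_n.+1 F} | irr P)
   if root (P : {poly F})^i a then sgnK (D^i.[a] ^+ (\sum_(0 <= i < n) q ^ i * h)%N) else 0).
  rewrite [RHS]exchange_big /=; apply: eq_bigr => P /andP[mP /irreducibleP iP].
  have [|a0 Pa0] := ex_root phi (p := (P : {poly F})); first by rewrite neq_ltn iP.1 orbT.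
  have [d0 defP ad amin] := irr_root mP iP Pa0.
  set d := (size P).-1 in d0 defP ad amin *.
  symmetry; rewrite -big_mkcond -big_filter.
  case: (boolP (d %| n)%N) => dn.
    have perm : perm_eq [seq a <- s | root (P : {poly F})^i a]
        [seq a0 ^+ (q ^ i) | i <- iota 0 d].
      apply: uniq_perm; [by rewrite filter_uniq|exact: conj_uniq|move=> a].
      rewrite mem_filter mems -root_orb -defP; apply: andb_idr => Pa.
      have [_ _ ada _] := irr_root mP iP Pa.
      have aj j : a ^+ (q ^ (j * d)) = a.
        by elim: j => [|j IHj]; rewrite ?mul0n ?expr1 // mulSn expnD exprM ada.
      by rewrite -(divnK dn) aj.
    rewrite (eq_big_seq (fun=> chi D ((P : {poly F}) ^+ (n %/ d)))); last first.
      move=> a; rewrite mem_filter => /andP[Pa _].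
      have [_ defPa ada _] := irr_root mP iP Pa.
      rewrite (chiE hq defD) ?monic_exp // (orb_jacobiK defD (n := n) (a := a)) //.
      by rewrite rmorphXn /= defPa -orb_period // divnK.
    rewrite big_const_seq count_predT iter_addr_0 (perm_size perm) size_map size_iota.
    rewrite (bigD1_seq (n %/ d)%N) ?iota_uniq //=; last first.
      by rewrite mem_index_iota divn_gt0 // dvdn_leq //= ltnS leq_div.
    rewrite divnK // eqxx mulr_natr big1 ?addr0 // => j jn.
    by case: eqP => // E; case/eqP: jn; rewrite -E mulnK.
  rewrite [RHS]big1; last first.
    by move=> j _; case: eqP => // E; case/negP: dn; rewrite -E dvdn_mull.
  rewrite big1_seq // => a; rewrite mem_filter mems => /andP[_ /andP[Pa /eqP an]].
  have [Q [mQ iQ Qa dQ _]] := fixed_irr phi n0 an.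
  by case/negP: dn; rewrite /d (irr_eq mP iP mQ iQ Pa Qa).
apply: eq_big_seq => a; rewrite mems => /eqP an.
have [P [mP iP Pa dP _]] := fixed_irr phi n0 an.
have sP : (size P <= n.+1)%N.
  by rewrite -(ltn_predK iP.1) ltnS dvdn_leq.
rewrite (bigD1 (NPoly (sP : P \is a poly_of_size n.+1))) /=; last first.
  by rewrite /irr mP; apply/irreducibleP.
rewrite Pa [X in _ + X]big1 ?addr0 // => Q /andP[/andP[mQ /irreducibleP iQ] QP].
case: ifP => // Qa; case/eqP: QP; apply: val_inj => /=.
exact: (irr_eq mQ iQ mP iP Qa Pa).
Qed.

(** The trivial bound, each point contributing 0, 1 or -1. It is what the second claim uses, with k
    at most about log_q g; the square-root bound serves to locate the zeros. *)
Lemma psi_bound n : (0 < n)%N -> `|psi D n| <= (q ^ n)%:R.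
Proof.
move=> n0; have [s [us ss mems]] := fixed_points n0.
rewrite (psi_points n0 us mems) (le_trans (ler_norm_sum _ _ _)) // -ss.
rewrite -[X in _ <= X]mul1r mulr_natr -count_predT -iter_addr_0 -big_const_seq /=.
by apply: ler_sum => a _; rewrite /sgnK; case: ifP => // _; case: ifP.
Qed.

End Values.

(** * Stepanov's method *)

Section Bivariate.
Variables (F : finFieldType) (a b : nat).
Implicit Types A B : {ffun 'I_a * 'I_b -> F}.

(** [A] holds the coefficients of a polynomial in two variables, evaluated here at (X^s, X^t). *)
Definition bip s t A : {poly F} :=
  \sum_(x : 'I_a * 'I_b) A x *: 'X^(x.1 * s + x.2 * t).

Lemma bipB s t A B : bip s t (A - B) = bip s t A - bip s t B.
Proof.
by rewrite /bip -sumrB; apply: eq_bigr => x _; rewrite !ffunE scalerBl.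
Qed.

Lemma size_bip s t A n : (forall x : 'I_a * 'I_b, (x.1 * s + x.2 * t < n)%N) ->
  (size (bip s t A) <= n)%N.
Proof.
move=> H; rewrite (leq_trans (size_sum _ _ _)) //; apply/bigmax_leqP => x _.
by rewrite (leq_trans (size_scale_leq _ _)) // size_polyXn.
Qed.

(** As b <= r, the exponent i r + j determines i and j as quotient and remainder, so no two
    monomials collide. *)
Lemma coef_bipE r A (x : 'I_a * 'I_b) : (b <= r)%N ->
  (bip r 1 A)`_(x.1 * r + x.2) = A x.
Proof.
move=> br; rewrite /bip coef_sum (bigD1 x) //= coefZ coefXn muln1 eqxx mulr1.
rewrite big1 ?addr0 // => y yx; rewrite coefZ coefXn muln1.
case: eqP => [E|_]; last by rewrite mulr0.
have lr (z : 'I_b) : (z < r)%N by apply: leq_trans (ltn_ord z) br.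
have r0 : (0 < r)%N by apply: leq_ltn_trans (lr x.2).
case/eqP: yx; case: y x E => [y1 y2] [x1 x2] /= E.
congr (_, _); apply: val_inj => /=.
  have := congr1 (fun z => z %/ r)%N E.
  by rewrite !divnMDl // !divn_small // !addn0.
have := congr1 (fun z => z %% r)%N E.
by rewrite !modnMDl !modn_small.
Qed.

Lemma coef_bip r A n : (b <= r)%N -> (bip r 1 A)`_n != 0 ->
  exists x : 'I_a * 'I_b, n = (x.1 * r + x.2)%N /\ (bip r 1 A)`_n = A x.
Proof.
move=> br nz.
have [x /= _ Hx] : exists2 x : 'I_a * 'I_b, true & (A x *: 'X^(x.1 * r + x.2 * 1))`_n != 0.
  apply: contrapT => nH; move/eqP: nz; apply; rewrite /bip coef_sum; apply: big1 => x _.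
  by apply/eqP; apply: contraT => Hx; case: nH; exists x.
have nx : n = (x.1 * r + x.2)%N.
  move: Hx; rewrite coefZ coefXn muln1; case: (n =P _) => // _.
  by rewrite mulr0 eqxx.
by exists x; rewrite nx coef_bipE.
Qed.

End Bivariate.

Section Stepanov.
Variables (F : finFieldType) (K : closedFieldType) (phi : {rmorphism F -> K}).
Local Notation q := #|F|.
Local Notation "p ^i" := (map_poly phi p) (at level 2, format "p ^i").

(** With r = q^k, the map x -> x^r exchanges x and x^r at points of the field with r^2 elements, so
    the r-th power of a value is again the value of a polynomial of low degree. *)
Lemma bip_frob a b k (A : {ffun 'I_a * 'I_b -> F}) x : x ^+ (q ^ k * q ^ k) = x ->
  (bip (q ^ k) 1 A)^i.[x] ^+ (q ^ k) = (bip 1 (q ^ k) A)^i.[x].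
Proof.
move=> xr; rewrite /bip !rmorph_sum !horner_sum (frob_sum phi).
apply: eq_bigr => y _; rewrite /= !map_polyZ !hornerZ !map_polyXn !hornerXn exprMn (frob_base phi).
rewrite -exprM mulnDl !muln1 exprD -mulnA mulnC exprM xr.
by rewrite exprD.
Qed.

Variables (D : {poly F}) (g d k : nat).
Hypothesis sD : size D = (2 * g + 1).+1.
Hypothesis qk : (q ^ k = 2 * g + 2 * d + 3)%N.
Local Notation r := (q ^ k)%N.
Local Notation c := (g + d).+2.

(** Since r = 2c - 1, the space [T] has dimension c (c + g) + c (d + 1) = c r, which exceeds the
    number [N] of linear conditions below by d + 1. *)
Let T := ({ffun 'I_(c + g) * 'I_c -> F} * {ffun 'I_c * 'I_d.+1 -> F})%type.

Let sDc : size (D ^+ c) = ((2 * g + 1) * c).+1.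
Proof.
have -> : (2 * g + 1 = (size D).-1)%N by rewrite sD.
by rewrite -size_exp prednK // size_poly_gt0 expf_neq0 // -size_poly_gt0 sD.
Qed.

Let gr : ((2 * g + 1) * c = g * r + g + c)%N.
Proof. by rewrite qk; nia. Qed.

(* Hhat eps t agrees with H t ^+ r at the points x fixed by x |-> x ^+ (r * r)
   where the relevant power of D is eps. Asking Hhat eps t = 0 imposes fewer
   linear conditions than t has coordinates, so some nonzero H t vanishes at
   all these points. *)
Let Hhat (eps : F) (t : T) : {poly F} :=
  bip 1 r t.1 + eps *: (D ^+ c * bip 1 r t.2).
Let N := (c + g + (g + d).+1 * r)%N.

Let size_Hhat eps t : (size (Hhat eps t) <= N)%N.
Proof.
rewrite (leq_trans (size_polyD _ _)) // geq_max; apply/andP; split.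
  apply: size_bip => x; rewrite muln1 /N.
  have := ltn_ord x.1; have : (x.2 * r <= (g + d).+1 * r)%N.
    by rewrite leq_mul2r; have := ltn_ord x.2; lia.
  by lia.
have sb : (size (bip 1 r t.2) <= c + d * r)%N.
  apply: size_bip => x; rewrite muln1.
  have := ltn_ord x.1; have : (x.2 * r <= d * r)%N.
    by rewrite leq_mul2r; have := ltn_ord x.2; lia.
  by lia.
rewrite (leq_trans (size_scale_leq _ _)) //.
rewrite (leq_trans (size_polyMleq _ _)) // sDc addSn /=.
rewrite (leq_trans (n := (2 * g + 1) * c + (c + d * r))) ?leq_add2l //.
by rewrite /N qk; nia.
Qed.

Let ex_kernel (eps : F) : exists t : T, t != 0 /\ Hhat eps t = 0.
Proof.
pose f (t : T) : {poly_N F} := NPoly (size_Hhat eps t : _ \is a poly_of_size N).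
have : ~ injective f.
  move=> /leq_card; rewrite card_npoly card_prod !card_ffun !card_prod !card_ord -expnD.
  rewrite leq_exp2l ?card_gt1 // leqNgt => /negP; apply.
  by rewrite /N qk; nia.
move=> ninj; apply: contrapT => H; apply: ninj => t u tu.
apply/eqP; apply: contraT => ntu; case: H; exists (t - u); split; first by rewrite subr_eq0.
have E : Hhat eps t = Hhat eps u by have := congr1 (fun p : {poly_N F} => (p : {poly F})) tu.
rewrite /Hhat /= !bipB mulrBr scalerBr addrACA -opprD.
by move: E; rewrite /Hhat => ->; rewrite subrr.
Qed.

Let H (t : T) : {poly F} := bip r 1 t.1 + D ^+ c * bip r 1 t.2.

(** The two summands cannot cancel: modulo r the exponents in the first are less than c, whereas the
    degree of the second is g + c + j with j <= d, hence at least c and less than r = g + c + d +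
    1. *)
Let H_neq0 t : t != 0 -> H t != 0.
Proof.
have cr : (c <= r)%N by rewrite qk; lia.
have dr : (d.+1 <= r)%N by rewrite qk; lia.
have zero a b (A : {ffun 'I_a * 'I_b -> F}) : (b <= r)%N -> bip r 1 A = 0 -> A = 0.
  move=> br A0; apply/ffunP => x; rewrite ffunE -(coef_bipE A x br) A0.
  exact: coef0.
apply: contraNneq => H0.
have B0 : bip r 1 t.2 = 0.
  apply/eqP; apply: contraT => nB; set B := bip r 1 t.2 in nB H0.
  have [x [nx _]] : exists x : 'I_c * 'I_d.+1, (size B).-1 = (x.1 * r + x.2)%N /\ B`_(size B).-1 = t.2 x.
    by apply: coef_bip => //; rewrite -lead_coefE lead_coef_eq0.
  have D0 : D ^+ c != 0 by rewrite expf_neq0 // -size_poly_gt0 sD.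
  set n := (size (D ^+ c * B)).-1.
  have nE : n = ((g + x.1) * r + (g + c + x.2))%N.
    have := size_mul D0 nB; rewrite /n sDc => ->.
    rewrite addSn /= -subn1; have -> : size B = (x.1 * r + x.2).+1.
      by rewrite -nx prednK // size_poly_gt0.
    by rewrite gr mulnDl; move: (g * r)%N (x.1 * r)%N => u v; lia.
  have : (bip r 1 t.1)`_n != 0.
    have -> : bip r 1 t.1 = - (D ^+ c * B) by apply/eqP; rewrite -addr_eq0; apply/eqP.
    by rewrite coefN oppr_eq0 -lead_coefE lead_coef_eq0 mulf_neq0.
  case/coef_bip => // y [ny _].
  have := congr1 (fun z => z %% r)%N (etrans (esym ny) nE); rewrite !modnMDl.
  have := ltn_ord y.2; have := ltn_ord x.2; rewrite !ltnS => xd yc.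
  by rewrite !modn_small ?qk; lia.
have A0 : bip r 1 t.1 = 0 by move: H0; rewrite /H B0 mulr0 addr0.
by apply/eqP; case: t {H0} A0 B0 => A B /= /zero -> // /zero ->.
Qed.

Let size_H t : (size (H t) <= (c + g) * r)%N.
Proof.
have xr m n i : (i < m.+1)%N -> (i * n <= m * n)%N by rewrite ltnS leq_mul2r orbC => ->.
have cg : ((c + g) * r = (g + d).+1 * r + g * r + r)%N.
  by rewrite -mulnDl -mulSnr; congr (_ * _)%N; lia.
rewrite (leq_trans (size_polyD _ _)) // geq_max; apply/andP; split.
  apply: size_bip => x; rewrite muln1.
  have x1 : (x.1 < ((g + d).+1 + g).+1)%N by rewrite (leq_trans (ltn_ord x.1)) // addSn.
  rewrite cg -mulnDl -addnS leq_add ?xr //.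
  by rewrite (leq_trans (ltn_ord x.2)) // qk; lia.
have sb : (size (bip r 1 t.2) <= (g + d).+1 * r + d.+1)%N.
  apply: size_bip => x; rewrite muln1.
  have := xr _ r _ (ltn_ord x.1); have := ltn_ord x.2.
  by lia.
rewrite (leq_trans (size_polyMleq _ _)) // sDc addSn /=.
rewrite (leq_trans (n := (2 * g + 1) * c + ((g + d).+1 * r + d.+1))) ?leq_add2l //.
by rewrite gr cg; lia.
Qed.

(** At these points D^(c r) = eps D^c, because c r = (r^2 - 1)/2 + c and (r^2 - 1)/2 = 2c (c - 1).
    So the r-th power of [H t] agrees there with [Hhat eps t] = 0, while the degree of [H t] is less
    than (c + g) r = (r^2 + (2g + 1) r)/2. *)
Lemma stepanov (eps : F) (s : seq K) : uniq s ->
  (forall x, x \in s -> x ^+ (r * r) = x /\ D^i.[x] ^+ (2 * c * c.-1) = phi eps) ->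
  (size s < (c + g) * r)%N.
Proof.
move=> us Hs; have [t [t0 Ht]] := ex_kernel eps.
have := @max_poly_roots _ (H t)^i s.
rewrite map_poly_eq0 size_map_poly => /(_ (H_neq0 t0)) mx.
apply: leq_trans (size_H t); apply: mx => //; apply/allP => x /Hs[xr xe].
suff : (H t)^i.[x] ^+ r == 0 by rewrite expf_eq0 => /andP[].
rewrite /H rmorphD rmorphM rmorphXn hornerD hornerM horner_exp (frobD phi) exprMn.
rewrite !bip_frob // -exprM.
have -> : (c * r = 2 * c * c.-1 + c)%N by rewrite qk; nia.
rewrite exprD xe; have := congr1 (fun p => p^i.[x]) Ht.
rewrite /Hhat rmorphD /= map_polyZ rmorphM rmorphXn hornerD hornerZ hornerM horner_exp.
by rewrite rmorph0 horner0 mulrA => ->.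
Qed.

End Stepanov.

(** * Square-root bound for the sums of even degree *)

Section PsiEven.
Variables (F : finFieldType) (hq : odd #|F|).
Variables (K : closedFieldType) (phi : {rmorphism F -> K}).
Local Notation q := #|F|.
Local Notation h := (#|F|./2).
Local Notation "p ^i" := (map_poly phi p) (at level 2, format "p ^i").
Variables (D : {poly F}) (rsD : seq K) (g : nat).
Hypothesis defD : D^i = \prod_(c <- rsD) ('X - c%:P).
Hypothesis size_rsD : size rsD = (2 * g + 1)%N.

(** Stepanov's bound applies to the value 1 and to the value -1 alike. As the two counts add up to
    q^(2k) minus at most 2g + 1, an upper bound for each bounds their difference. *)
Lemma psi_even_bound k : (0 < k)%N -> (2 * g + 3 <= q ^ k)%N ->
  (`|psi D (2 * k)| <= (2 * g + 1) * (q ^ k + 1))%N.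
Proof.
move=> k0 gk; have sD := size_defD defD; rewrite size_rsD in sD.
have [d qk] : exists d, (q ^ k = 2 * g + 2 * d + 3)%N.
  have o : odd (q ^ k) by rewrite oddX hq orbT.
  exists ((q ^ k)./2 - g.+1)%N.
  by have := odd_double_half (q ^ k); rewrite o; lia.
have k2 : (0 < 2 * k)%N by lia.
have [s [us ss mems]] := fixed_points phi k2.
have odd_rsD : odd (size rsD) by rewrite size_rsD; lia.
rewrite (psi_points hq defD k2 us mems) /point_sum.
set E := (\sum_(0 <= i < 2 * k) _)%N.
have q2 : (q ^ (2 * k) = q ^ k * q ^ k)%N by rewrite mul2n -addnn expnD.
have EE : (E = 2 * (g + d).+2 * (g + d).+1)%N.
  by have := half_geometric hq (2 * k); rewrite -/E q2 qk; nia.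
have fixs x : x \in s -> x ^+ (q ^ k * q ^ k) = x by rewrite mems q2 => /eqP.
have st (eps : F) : (count (fun x => D^i.[x] ^+ E == phi eps) s < ((g + d).+2 + g) * q ^ k)%N.
  rewrite -size_filter; apply: (stepanov (phi := phi) (D := D) sD qk (eps := eps)).
    by rewrite filter_uniq.
  move=> x; rewrite mem_filter => /andP[/eqP Hx xs]; split; first exact: fixs.
  by rewrite -EE.
have vals x : x \in s -> D^i.[x] ^+ E \in [:: 0; 1; -1].
  move=> /fixs xs; rewrite !inE.
  have := frob_horner phi (2 * k) D x; rewrite q2 xs -q2 -(half_geometric hq) -/E exprS.
  rewrite -mul2n mulnC exprM; set w := D^i.[x]; case: (eqVneq w 0) => [->|w0].
    rewrite expr0n eqn0Ngt; have -> : (0 < E)%N by rewrite EE.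
    by rewrite eqxx.
  rewrite -{1}[w]mulr1 => /(mulfI w0)/esym/eqP; rewrite sqrf_eq1.
  by move=> ->; rewrite orbT.
have c0 : (count (fun x => D^i.[x] ^+ E == 0%R) s <= 2 * g + 1)%N.
  rewrite -size_filter -size_rsD; apply: uniq_leq_size; first by rewrite filter_uniq.
  move=> x; rewrite mem_filter expf_eq0 => /andP[/andP[_ Dx] _].
  by rewrite -root_prod_XsubC -defD.
have e10 : (1 == 0 :> K) = false by rewrite oner_eq0.
have e01 : (0 == 1 :> K) = false by rewrite eq_sym.
have eN0 : (-1 == 0 :> K) = false by rewrite oppr_eq0.
have e0N : (0 == -1 :> K) = false by rewrite eq_sym.
have e1N : (1 == -1 :> K) = false by rewrite (negPf (oneN1 hq phi)).
have eN1 : (-1 == 1 :> K) = false by rewrite eq_sym.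
have [-> tot] : \sum_(a <- s) sgnK (D^i.[a] ^+ E) =
    (count (fun x => D^i.[x] ^+ E == 1%R) s)%:Z - (count (fun x => D^i.[x] ^+ E == (-1)%R) s)%:Z /\
   (count (fun x => D^i.[x] ^+ E == 0%R) s + count (fun x => D^i.[x] ^+ E == 1%R) s +
    count (fun x => D^i.[x] ^+ E == (-1)%R) s = size s)%N.
  elim: {us ss mems fixs st c0} s vals => [|x s IHs] vals; first by rewrite big_nil.
  rewrite big_cons /=; have [|-> <-] := IHs.
    by move=> y ys; apply: vals; rewrite in_cons ys orbT.
  have := vals x (mem_head _ _); rewrite !inE => /or3P[] /eqP ->.
  - by rewrite sgnK0 eqxx e01 e0N !add0n add0r !add1n !addSn.
  - by rewrite sgnK1 eqxx e10 e1N !add0n PoszD addrA !add1n addnS addSn.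
  - by rewrite (sgnKN1 hq phi) eqxx eN0 eN1 !add0n PoszD opprD addrCA !add1n addnS.
move: c0 tot (st 1) (st (-1)); rewrite rmorphN1 rmorph1 ss q2.
move: (count (fun x => D^i.[x] ^+ E == 0%R) s) => N0.
move: (count (fun x => D^i.[x] ^+ E == 1%R) s) => Np.
move: (count (fun x => D^i.[x] ^+ E == (-1)%R) s) => Nm.
have : (((g + d).+2 + g) * q ^ k * 2 = q ^ k * q ^ k + (2 * g + 1) * q ^ k)%N.
  by rewrite {1 3}qk; nia.
move: (q ^ k * q ^ k)%N => r2; rewrite mulnDr;
move: (((g + d).+2 + g) * q ^ k)%N ((2 * g + 1) * q ^ k)%N => u v.
lia.
Qed.

Lemma split_roots (P Q : {poly F}) c : P \is monic -> irreducible_poly P -> root P^i c ->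
  D = Q * P -> exists2 rsQ, Q^i = \prod_(b <- rsQ) ('X - b%:P) &
    perm_eq rsD (rsQ ++ [seq c ^+ (q ^ i) | i <- iota 0 (size P).-1]).
Proof.
move=> mP iP Pc DE; have [d0 defP _ _] := irr_root mP iP Pc.
have mQ : Q \is monic by have := monic_defD defD; rewrite DE monicMr.
have [rsQ] := closed_field_poly_normal Q^i.
rewrite lead_coef_map (monicP mQ) rmorph1 scale1r => QE.
exists rsQ => //; apply: prod_XsubC_eq.
rewrite big_cat /= -QE -defD DE rmorphM /= defP; congr (_ * _).
by rewrite big_map /orb /index_iota subn0.
Qed.

Hypothesis sqf : squarefree_poly D.

Lemma root_factor c : c \in rsD -> exists P Q : {poly F},
  [/\ P \is monic, irreducible_poly P, root P^i c, D = Q * P & ~~ (P %| Q)].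
Proof.
move=> cD; have D0 := monic_neq0 (monic_defD defD).
have Dc : root D^i c by rewrite defD root_prod_XsubC.
have [n n0 cn] := root_periodic D0 Dc.
have [P [mP iP Pc _ _]] := fixed_irr phi n0 cn.
have : P %| D by rewrite (irr_dvdp _ iP Pc).
case/dvdpP => Q DE; exists P, Q; split => //; apply/negP => PQ.
have := sqf (P := P); rewrite DE expr2 dvdp_mul // => /(_ isT).
by rewrite leqNgt iP.1.
Qed.

(** An irreducible factor of [D] occurs once, and its roots are distinct Frobenius conjugates. *)
Lemma squarefree_uniq : uniq rsD.
Proof.
apply: count_mem_uniq => c.
case: (boolP (c \in rsD)) => [cD|]; last by move/count_memPn.
have [P [Q [mP iP Pc DE PQ]]] := root_factor cD.
have [rsQ QE /permP ->] := split_roots mP iP Pc DE.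
have [d0 defP _ amin] := irr_root mP iP Pc.
rewrite count_cat (@count_uniq_mem _ [seq c ^+ (q ^ i) | i <- _]) ?conj_uniq //.
rewrite -root_orb -defP Pc.
suff /count_memPn -> : c \notin rsQ by [].
by rewrite -root_prod_XsubC -QE -(irr_dvdp _ iP Pc).
Qed.

End PsiEven.

(** * The leading coefficient of the L-function *)

Section LeadingCoefficient.
Variables (F : finFieldType) (hq : odd #|F|).
Variables (K : closedFieldType) (phi : {rmorphism F -> K}).
Local Notation q := #|F|.
Local Notation h := (#|F|./2).
Local Notation "p ^i" := (map_poly phi p) (at level 2, format "p ^i").
Variables (D : {poly F}) (rsD : seq K) (n : nat).
Hypothesis defD : D^i = \prod_(c <- rsD) ('X - c%:P).
Hypothesis size_rsD : size rsD = n.+1.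
Hypothesis even_n : ~~ odd n.
Hypothesis sqf : squarefree_poly D.
Local Notation V := {poly_n.+1 F}.

Let sD : size D = n.+2. Proof. by rewrite (size_defD defD) size_rsD. Qed.
Let D0 : D != 0. Proof. by rewrite -size_poly_gt0 sD. Qed.
Let ursD : uniq rsD. Proof. exact: (squarefree_uniq defD sqf). Qed.
Let e10 : (1 == 0 :> K) = false. Proof. by rewrite oner_eq0. Qed.

(** The character f -> (f / D), defined on all residues modulo [D]. It agrees with [chi D] on monic
    f of even degree, and is nontrivial on constants because deg D is odd. *)
Let X (f : {poly F}) : int := sgnK (resD phi rsD f ^+ h).

Let res_frob f : resD phi rsD f ^+ q = resD phi rsD f.
Proof.
rewrite /resD -prodrXl.
transitivity (\prod_(c <- [seq c ^+ q | c <- rsD]) f^i.[c]).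
  by rewrite big_map; apply: eq_bigr => c _; rewrite -{1}[q]expn1 -frob_horner expn1.
apply: perm_big; apply: uniq_perm => //.
  rewrite map_inj_uniq // => x y; rewrite -[q]expn1; exact: (frob_inj phi).
have sub : {subset [seq c ^+ q | c <- rsD] <= rsD}.
  move=> _ /mapP[c cD ->]; rewrite -root_prod_XsubC -defD -{1}[q]expn1.
  by apply: root_conj; rewrite defD root_prod_XsubC.
have [] := uniq_min_size _ sub; rewrite ?size_map //.
rewrite map_inj_uniq // => x y; rewrite -[q]expn1; exact: (frob_inj phi).
Qed.

Let res_signs f : resD phi rsD f ^+ h \in [:: 0; 1; -1].
Proof.
have := res_frob f; set z := resD phi rsD f; rewrite -{1}(card_half hq) exprS -mul2n mulnC exprM.
rewrite !inE; case: (eqVneq z 0) => [->|z0].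
  by rewrite expr0n eqn0Ngt card_half_gt0 // eqxx.
move=> E; have /(mulfI z0)/eqP : z * (z ^+ h ^+ 2) = z * 1 by rewrite mulr1.
by rewrite sqrf_eq1 => ->; rewrite orbT.
Qed.

Let X_signs f : X f \in signs.
Proof. by rewrite /X /sgnK; case: ifP => // _; case: ifP. Qed.

Let X_intr f : (X f)%:~R = resD phi rsD f ^+ h.
Proof.
have := res_signs f; rewrite /X !inE => /or3P[]/eqP ->.
- by rewrite sgnK0.
- by rewrite sgnK1.
- by rewrite (sgnKN1 hq phi).
Qed.

Let XE f z : z \in signs -> z%:~R = resD phi rsD f ^+ h -> X f = z.
Proof. by move=> zs E; rewrite /X -E (sgnK_intr hq phi). Qed.

Let XM f f' : X (f * f') = X f * X f'.
Proof. by apply: XE; rewrite ?signsM // rmorphM resDM exprMn -!X_intr. Qed.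

Let X_mod f : X (f %% D) = X f.
Proof. by rewrite /X (resD_mod defD). Qed.

Let X1 : X 1 = 1.
Proof. by apply: XE => //; rewrite /resD big1 ?expr1n // => c _; rewrite rmorph1 hornerC. Qed.

Let X_neq0 f : X f != 0 -> coprimep D f.
Proof.
apply: contraR; rewrite -(coprimep_map phi) coprimep_def => s1.
have [c] := closed_rootP _ s1; rewrite root_gcd => /andP[Dc fc].
rewrite /X /resD; suff -> : \prod_(b <- rsD) f^i.[b] = 0.
  by rewrite expr0n eqn0Ngt card_half_gt0 // sgnK0.
apply/eqP; rewrite prodf_seq_eq0; apply/hasP; exists c; last by rewrite (eqP fc) eqxx.
by rewrite -root_prod_XsubC -defD.
Qed.

Let chi_of (a : F) : int := X a%:P.
Let XZ a f : X (a *: f) = chi_of a * X f.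
Proof. by rewrite -mul_polyC XM. Qed.

Let X_sq f : X f != 0 -> X f ^+ 2 = 1.
Proof. by have := X_signs f; rewrite !inE => /or3P[]/eqP->. Qed.

Let chi_of_nonres : exists a, chi_of a = -1.
Proof.
have [a ah] := nonresidue hq phi; exists a; apply: XE => //.
rewrite /resD (eq_bigr (fun=> phi a)) => [|c _]; last by rewrite map_polyC hornerC.
rewrite big_const_seq count_predT iter_mulr_1 -exprM mulnC exprM ah size_rsD.
by rewrite -signr_odd /= even_n.
Qed.

Let chi_of_neq0 a : a != 0 -> chi_of a != 0.
Proof.
move=> a0; have : chi_of a * chi_of a^-1 = 1 by rewrite /chi_of -XM -polyCM divff.
by apply: contraPneq => ->; rewrite mul0r.
Qed.

(** Modulo [D], (f, g) -> [lam (f * g)] is a nondegenerate bilinear form; it takes the place of the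
    additive character in a Gauss sum. *)
Let lam (f : {poly F}) : F := (f %% D)`_n.
Let lamD f f' : lam (f + f') = lam f + lam f'.
Proof. by rewrite /lam modpD coefD. Qed.
Let lamZ a f : lam (a *: f) = a * lam f.
Proof. by rewrite /lam modpZl coefZ. Qed.
Let lamN f : lam (- f) = - lam f.
Proof. by rewrite -scaleN1r lamZ mulN1r. Qed.
Let lam_mod f f' : lam ((f %% D) * f') = lam (f * f').
Proof. by rewrite /lam mulrC modp_mul mulrC. Qed.

Let mulV (u : {poly F}) (f : V) : V := npolyp n.+1 (((f : {poly F}) * u) %% D).

Let mulVE u f : (mulV u f : {poly F}) = ((f : {poly F}) * u) %% D.
Proof. by rewrite /= npolypK // -ltnS -sD ltn_modp. Qed.

Let mulV_inj u : X u != 0 -> injective (mulV u).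
Proof.
move=> /X_neq0 cop f f' /(congr1 (fun x : V => (x : {poly F}))).
rewrite !mulVE => E; apply: val_inj; apply/eqP; rewrite /= -subr_eq0.
have : D %| ((f : {poly F}) - (f' : {poly F})).
  rewrite -(Gauss_dvdpl _ cop) mulrBl /dvdp modpD modpN E subrr eqxx.
  by [].
apply: contraTT => n0; apply/negP => /dvdp_leq => /(_ n0).
rewrite sD leqNgt => /negP; apply; rewrite ltnS (leq_trans (size_polyD _ _)) //.
by rewrite size_polyN geq_max !size_npoly.
Qed.

Let scV (a : F) (f : V) : V := npolyp n.+1 (a *: (f : {poly F})).
Let scVE a f : (scV a f : {poly F}) = a *: (f : {poly F}).
Proof. by rewrite /= npolypK // (leq_trans (size_scale_leq _ _)) // size_npoly. Qed.
Let scV_inj a : a != 0 -> injective (scV a).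
Proof.
move=> a0 f f' /(congr1 (fun x : V => (x : {poly F}))); rewrite !scVE => /(scalerI a0) E.
exact: val_inj.
Qed.

(* B 1 1 is the leading coefficient c of the L-function; B 1 g is c or - c when
   g is prime to D and 0 otherwise, so the second moment over g gives c ^+ 2. *)
Let B (t : F) (g : V) : int := \sum_(f : V | lam ((f : {poly F}) * (g : {poly F})) == t) X f.

Let B_scale a t g : a != 0 -> B (a * t) g = chi_of a * B t g.
Proof.
move=> a0; rewrite /B (reindex_inj (scV_inj a0)) big_distrr /=.
apply: eq_big => [f|f _]; rewrite scVE ?XZ // -scalerAl lamZ.
by rewrite (inj_eq (mulfI a0)).
Qed.

Let chi_of_nonres0 : exists2 a, a != 0 & chi_of a = -1.
Proof.
have [a aN] := chi_of_nonres; exists a => //.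
apply: contra_eq_neq aN => ->; rewrite /chi_of /X /resD.
rewrite (eq_bigr (fun=> 0)) => [|c _]; last by rewrite rmorph0 horner0.
rewrite big_const_seq count_predT iter_mulr_1 size_rsD exprS mul0r expr0n.
by rewrite eqn0Ngt card_half_gt0 // sgnK0.
Qed.

Let sumX : \sum_(f : V) X f = 0.
Proof.
have [a a0 aN] := chi_of_nonres0.
have : \sum_(f : V) X f = - \sum_(f : V) X f.
  rewrite {1}(reindex_inj (scV_inj a0)) -sumrN; apply: eq_bigr => f _.
  by rewrite scVE XZ aN mulN1r.
lia.
Qed.

Let B0 g : B 0 g = 0.
Proof.
have [a a0 aN] := chi_of_nonres0.
by have := B_scale 0 g a0; rewrite mulr0 aN mulN1r; move: (B 0 g) => x; lia.
Qed.

(** Scaling [f] by a constant carries [B 1 g] to each [B t g] with t nonzero, up to sign, and a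
    nonresidue constant forces [B 0 g] = 0. *)
Let sum_sq g : \sum_t B t g ^+ 2 = (q.-1)%:R * B 1 g ^+ 2.
Proof.
rewrite (bigD1 0) //= B0 expr0n add0r.
rewrite (eq_bigr (fun=> B 1 g ^+ 2)) => [|t t0].
  by rewrite sumr_const mulr_natl cardC1.
by rewrite -[t]mulr1 B_scale // exprMn X_sq ?mul1r // chi_of_neq0.
Qed.

Let sum_pairs g : \sum_t B t g ^+ 2 =
  \sum_(f : V) \sum_(f' : V) X f * X f' *
    (lam (((f : {poly F}) - (f' : {poly F})) * (g : {poly F})) == 0)%:R.
Proof.
transitivity (\sum_t \sum_(f : V) \sum_(f' : V)
   X f * X f' * ((lam ((f : {poly F}) * (g : {poly F})) == t) &&
     (lam ((f' : {poly F}) * (g : {poly F})) == t))%:R).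
  apply: eq_bigr => t _; rewrite expr2 /B big_mkcond big_distrl; apply: eq_bigr => f _ /=.
  rewrite [X in _ * X]big_mkcond big_distrr; apply: eq_bigr => f' _ /=.
  by case: (_ == t) => //=; case: (_ == t); rewrite /= ?mulr1 ?mulr0 ?mul0r.
rewrite exchange_big; apply: eq_bigr => f _; rewrite exchange_big; apply: eq_bigr => f' _ /=.
rewrite -big_distrr; congr (_ * _) => /=.
rewrite mulrBl lamD lamN subr_eq0 (bigD1 (lam ((f : {poly F}) * (g : {poly F})))) //= eqxx /=.
rewrite eq_sym big1 ?addr0 // => t; rewrite eq_sym => /negPf -> //.
Qed.

(** A suitable monomial multiple of [d] has degree exactly n, so g -> [lam (d * g)] is a nonzero
    linear form. *)
Let lam_count (d : {poly F}) : (size d <= n.+1)%N -> d != 0 ->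
  #|[pred g : V | lam (d * (g : {poly F})) == 0]| = (q ^ n)%N.
Proof.
move=> sd d0.
have [g0 lg0] : exists g0 : V, lam (d * (g0 : {poly F})) = 1.
  have sg : (size ((lead_coef d)^-1 *: 'X^(n.+1 - size d) : {poly F}) <= n.+1)%N.
    rewrite (leq_trans (size_scale_leq _ _)) // size_polyXn.
    by have := size_poly_gt0 d; rewrite d0; lia.
  exists (npolyp n.+1 ((lead_coef d)^-1 *: 'X^(n.+1 - size d))).
  rewrite npolypK // -scalerAr lamZ /lam.
  have sdx : size (d * 'X^(n.+1 - size d)) = n.+1.
    by rewrite (size_Mmonic d0 (monicXn _ _)) size_polyXn addnS subnKC.
  rewrite modp_small ?sdx ?sD // coefMXn; have := size_poly_gt0 d; rewrite d0 => s0.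
  rewrite ifF; last by lia.
  have -> : (n - (n.+1 - size d) = (size d).-1)%N by lia.
  by rewrite -lead_coefE mulVf // lead_coef_eq0.
pose fib t := [pred g : V | lam (d * (g : {poly F})) == t].
have cfib t : #|fib t| = #|fib 0|.
  have inj : injective (fun g : V => g + scV t g0) by move=> x y /addIr.
  rewrite -!sum1_card (reindex_inj inj); apply: eq_bigl => g.
  rewrite !inE /= mulrDr lamD npolypK -?scVE ?size_npoly //.
  by rewrite scVE -scalerAr lamZ lg0 mulr1 -subr_eq0 addrK.
have : #|{: V}| = (q * #|fib 0%R|)%N.
  rewrite -sum1_card (partition_big (fun g : V => lam (d * (g : {poly F}))) predT) //=.
  rewrite (eq_bigr (fun=> #|fib 0%R|)) => [|t _]; last by rewrite sum1_card -(cfib t).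
  by rewrite sum_nat_const.
rewrite card_npoly expnS => /eqP.
by rewrite eqn_pmul2l ?(ltnW (card_gt1 F)) // => /eqP.
Qed.

(** Primitivity of the character: [g] and [D] share an irreducible factor P, and since D = Q P with
    P and Q coprime, the Chinese remainder theorem provides a [u] that is 1 modulo Q and a
    nonresidue modulo P. *)
Let nonunit_twist g : X g = 0 -> exists u : {poly F}, X u = -1 /\ D %| g * (u - 1).
Proof.
move=> Xg; have [c cD gc] : exists2 c, c \in rsD & root g^i c.
  have : (X g)%:~R == 0 :> K by rewrite Xg.
  rewrite X_intr expf_eq0 card_half_gt0 //= prodf_seq_eq0 => /hasP[c cD /= gc].
  by exists c.
have [P [Q [mP iP Pc DE PQ]]] := root_factor defD sqf cD.
have [rsQ QE pm] := split_roots defD mP iP Pc DE.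
have [d0 defP cd amin] := irr_root mP iP Pc.
set d := (size P).-1 in d0 defP cd amin pm.
have cop : coprimep P Q.
  apply: contraT => nc; have [_ iP2] := iP.
  have /andP[_ h1] := iP2 _ nc (dvdp_gcdl _ _).
  by case/negP: PQ; apply: dvdp_trans h1 (dvdp_gcdr _ _).
pose E := (\sum_(0 <= i < d) q ^ i * h)%N.
have EE : (E.*2.+1 = q ^ d)%N by rewrite half_geometric.
have E0 : (0 < E)%N by rewrite -double_gt0 -ltnS EE -{1}(expn0 q) ltn_exp2l ?card_gt1.
have [z zE] : exists z : K, z ^+ E = -1.
  have /closed_rootP[z] : size ('X^E - (-1)%:P : {poly K}) != 1%N.
    by rewrite size_XnsubC ?eqSS -?lt0n.
  by rewrite /root !hornerE subr_eq0 => /eqP; exists z.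
have zd : z ^+ (q ^ d) = z by rewrite -EE exprS -mul2n mulnC exprM zE sqrrN expr1n mulr1.
have [u0 u0z] := fixed_value mP iP Pc zd.
have [[s t] /= st] := Bezout_eq1_coprimepP _ _ cop.
exists (1 + (u0 - 1) * (t * Q)); split; last first.
  have : P %| g by rewrite (irr_dvdp _ iP Pc).
  case/dvdpP => g' ->; rewrite [1 + _ - 1]addrC addKr DE.
  have -> : g' * P * ((u0 - 1) * (t * Q)) = (g' * (u0 - 1) * t) * (Q * P) by ring.
  exact: dvdp_mull.
apply: XE => //; rewrite /resD (perm_big _ pm) big_cat /= big1_seq; last first.
  move=> b /= bQ; have Qb : Q^i.[b] = 0.
    by apply/eqP; rewrite -/(root _ _) QE root_prod_XsubC.
  by rewrite !rmorphD !rmorphM rmorph1 hornerD !hornerM Qb !mulr0 hornerC addr0.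
rewrite mul1r big_map (eq_bigr (fun i => z ^+ (q ^ i))) => [|i _].
  have -> : iota 0 d = index_iota 0 d by rewrite /index_iota subn0.
  by rewrite prodrXr -exprM big_distrl /= -/E zE rmorphN1.
have Pb : P^i.[c ^+ (q ^ i)] = 0 by apply/eqP; exact: root_conj.
have tQ : (t * Q)^i.[c ^+ (q ^ i)] = 1.
  have := congr1 (fun p => p^i.[c ^+ (q ^ i)]) st.
  by rewrite /= rmorphD rmorphM hornerD hornerM Pb mulr0 add0r rmorph1 hornerC.
rewrite rmorphD rmorphM rmorphB rmorph1 hornerD hornerM tQ mulr1 hornerD hornerN hornerC.
by rewrite addrC subrK frob_horner -u0z.
Qed.

Let B_nonunit (g : V) : X g = 0 -> B 1 g = 0.
Proof.
move=> /nonunit_twist[u [Xu Dgu]].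
have : B 1 g = - B 1 g.
  rewrite {1}/B (reindex_inj (mulV_inj (u := u) _)) ?Xu // /B -sumrN.
  apply: eq_big => [f|f _]; rewrite mulVE ?X_mod ?XM ?Xu ?mulrN1 //.
  congr (_ == _); rewrite lam_mod.
  have -> : (f : {poly F}) * u * (g : {poly F}) =
      (f : {poly F}) * (g : {poly F}) + (f : {poly F}) * ((g : {poly F}) * (u - 1)) by ring.
  by rewrite lamD {2}/lam (eqP (dvdp_mull _ Dgu : D %| (f : {poly F}) * _)) coef0 addr0.
move: (B 1 g) => x; lia.
Qed.

Let one : V := npolyp n.+1 1.
Let oneE : (one : {poly F}) = 1. Proof. by rewrite /= npolypK // size_poly1. Qed.

Let B_unit (g : V) : X g != 0 -> B 1 g ^+ 2 = B 1 one ^+ 2.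
Proof.
move=> Xg; have -> : B 1 one = X g * B 1 g.
  rewrite {1}/B (reindex_inj (mulV_inj Xg)) big_distrr /=.
  apply: eq_big => [f|f _]; rewrite mulVE ?X_mod ?XM; last by rewrite mulrC.
  by rewrite oneE lam_mod mulr1.
by rewrite exprMn X_sq ?mul1r.
Qed.

Let Lcoef_B : Lcoef D n = B 1 one.
Proof.
have bigs (f : V) : monic_of_deg n (f : {poly F}) = (lam ((f : {poly F}) * (one : {poly F})) == 1).
  rewrite monic_of_degE ?size_npoly // oneE mulr1 /lam modp_small //.
  by rewrite sD ltnS size_npoly.
rewrite /Lcoef /degsum /B; apply: eq_big => // f /andP[mf /eqP sf].
rewrite (chiE hq defD mf) /jacobiK sf size_rsD -signr_odd /= oddM /= (negPf even_n) andbF.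
by rewrite mul1r.
Qed.

Let units := (\sum_(g : V) (X g != 0))%N.

Let units_gt0 : (0 < units)%N.
Proof. by rewrite /units (bigD1 one) //= oneE X1. Qed.

Let sum_XX : \sum_(f : V) X f ^+ 2 = units%:R.
Proof.
rewrite /units natr_sum; apply: eq_bigr => f _.
by case: eqP => [->|/eqP/X_sq ->]; rewrite ?expr0n.
Qed.

Let cardq : (q.-1.+1 = q)%N. Proof. by rewrite prednK // ltnW ?card_gt1. Qed.

(** The analogue of the modulus of a Gauss sum. Each pair (f, f') is counted q^n times, plus (q - 1)
    q^n more on the diagonal; as [X] sums to 0, only the diagonal excess survives. *)
Theorem Lcoef_sqr : Lcoef D n ^+ 2 = (q ^ n)%:R.
Proof.
have E1 : \sum_(g : V) \sum_t B t g ^+ 2 = (q.-1)%:R * (units%:R * Lcoef D n ^+ 2).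
  rewrite (eq_bigr _ (fun g _ => sum_sq g)) -big_distrr /=; congr (_ * _).
  rewrite /units natr_sum big_distrl /=; apply: eq_bigr => g _.
  case: eqP => [/B_nonunit ->|/eqP/B_unit ->]; first by rewrite expr0n mul0r.
  by rewrite mul1r Lcoef_B.
have E2 : \sum_(g : V) \sum_t B t g ^+ 2 = (q.-1)%:R * (units%:R * (q ^ n)%:R).
  rewrite (eq_bigr _ (fun g _ => sum_pairs g)) exchange_big /=.
  transitivity (\sum_(f : V) \sum_(f' : V)
      (X f * X f' * (q ^ n)%:R + (if f' == f then X f ^+ 2 * (q.-1 * q ^ n)%:R else 0))).
    apply: eq_bigr => f _; rewrite exchange_big; apply: eq_bigr => f' _ /=.
    rewrite -big_distrr -natr_sum /=.
    have -> : (\sum_(g : V) (lam (((f : {poly F}) - (f' : {poly F})) * (g : {poly F})) == 0)%R =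
       #|[pred g : V | lam (((f : {poly F}) - (f' : {poly F})) * (g : {poly F})) == 0%R]|)%N.
      by rewrite -sum1_card [RHS]big_mkcond; apply: eq_bigr => g _; rewrite inE /=; case: eqP.
    case: eqP => [->|ff]; last first.
      rewrite lam_count ?addr0 //; first
        by rewrite (leq_trans (size_polyD _ _)) // size_polyN geq_max !size_npoly.
      by rewrite subr_eq0; apply/eqP => E; apply: ff; apply: val_inj.
    rewrite (eq_card (B := predT)) ?card_npoly; last first.
      by move=> g; rewrite !inE subrr mul0r /lam mod0p coef0 eqxx.
    by rewrite -expr2 -mulrDr -natrD expnS -{1}cardq mulSn.
  rewrite (eq_bigr (fun f : V => X f * (q ^ n)%:R * (\sum_(f' : V) X f') +
      X f ^+ 2 * (q.-1 * q ^ n)%:R)) => [|f _].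
    rewrite sumX big_split /= [X in X + _]big1 ?add0r => [|f _]; last by rewrite mulr0.
    by rewrite -big_distrl /= sum_XX natrM mulrCA.
  rewrite big_split /= -big_mkcond big_pred1_eq big_distrr /=; congr (_ + _).
  by apply: eq_bigr => f' _; rewrite mulrAC.
have q1 : (q.-1)%:R != 0 :> int by rewrite pnatr_eq0 -lt0n -ltnS cardq card_gt1.
have u0 : units%:R != 0 :> int by rewrite pnatr_eq0 -lt0n.
by apply: (mulfI u0); apply: (mulfI q1); rewrite -E1.
Qed.

End LeadingCoefficient.

(** * The Riemann hypothesis *)

Section CharacterSums.
Variables (F : finFieldType) (hq : odd #|F|) (D : {poly F}) (g : nat).
Hypothesis HD : oddHyperelliptic g D.
Local Notation q := #|F|.

Lemma Lcoef_facts :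
  [/\ Lcoef D 0 = 1,
      forall n, (2 * g < n)%N -> Lcoef D n = 0,
      forall n, n%:R * Lcoef D n = \sum_(1 <= k < n.+1) psi D k * Lcoef D (n - k) &
      Lcoef D (2 * g) ^+ 2 = (q ^ (2 * g))%:R].
Proof.
have [K [phi _]] := countable_algebraic_closure F.
have [mD sqf sD] := HD.
have [rsD] := closed_field_poly_normal (map_poly phi D).
rewrite lead_coef_map (monicP mD) rmorph1 scale1r => defD.
have size_rsD : size rsD = (2 * g).+1.
  by apply: succn_inj; rewrite -(size_defD defD) sD addn1.
split.
- rewrite /Lcoef /degsum (bigD1 (npolyp 1 1)) /=; last first.
    by rewrite monic_of_degE ?size_npoly // npolypK ?size_poly1 // coefC.
  rewrite npolypK ?size_poly1 // (chiE hq defD) ?monic1 // jacobiK1 sgnK1.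
  rewrite big1 ?addr0 // => f; rewrite monic_of_degE ?size_npoly // => /andP[/eqP f0 f1].
  case/eqP: f1; apply: val_inj; rewrite /= npolypK ?size_poly1 //.
  by have /size1_polyC -> := size_npoly f; rewrite f0.
- by move=> n gn; apply: (Lcoef_eq0 hq defD); rewrite size_rsD ?gn //; lia.
- by move=> n; apply: (Lcoef_newton hq defD).
- by apply: (Lcoef_sqr hq defD size_rsD) => //; lia.
Qed.

Lemma psi_facts :
  (forall n, (0 < n)%N -> `|psi D n| <= (q ^ n)%:R) /\
  (forall k, (0 < k)%N -> (2 * g + 3 <= q ^ k)%N ->
     `|psi D (2 * k)| <= ((2 * g + 1) * (q ^ k + 1))%:R).
Proof.
have [K [phi _]] := countable_algebraic_closure F.
have [mD sqf sD] := HD.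
have [rsD] := closed_field_poly_normal (map_poly phi D).
rewrite lead_coef_map (monicP mD) rmorph1 scale1r => defD.
have size_rsD : size rsD = (2 * g + 1)%N.
  by apply: succn_inj; rewrite -(size_defD defD) sD.
split => [n n0|k k0 gk].
  by apply: (psi_bound hq defD) => //; rewrite size_rsD; lia.
have := psi_even_bound hq defD size_rsD k0 gk.
by rewrite -lez_nat abszE natz.
Qed.

End CharacterSums.

(** * Newton's identities and power sums *)

Section NewtonIdentities.
Variable C : fieldType.
Implicit Types (s : seq C) (p : {poly C}).

Definition revpoly s : {poly C} := \prod_(a <- s) (1 - a *: 'X).
Definition powersum s k : C := \sum_(a <- s) a ^+ k.
(** Truncation of X p'/p for p = [revpoly s]. *)
Definition powerpoly s n : {poly C} := \sum_(1 <= k < n.+1) - powersum s k *: 'X^k.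

Lemma powerpoly_cons a s n :
  powerpoly (a :: s) n = powerpoly [:: a] n + powerpoly s n.
Proof.
rewrite /powerpoly -big_split; apply: eq_bigr => k _.
by rewrite /powersum big_cons big_seq1 opprD scalerDl.
Qed.

Lemma revpoly_newton s n :
  'X^(n.+1) %| 'X * (revpoly s)^`() - revpoly s * powerpoly s n.
Proof.
elim: s => [|a s IHs].
  rewrite /revpoly big_nil derivC mulr0 mul1r /powerpoly big1 ?subrr ?dvdp0 // => k _.
  by rewrite /powersum big_nil oppr0 scale0r.
rewrite powerpoly_cons {1 2}/revpoly big_cons -/(revpoly s) derivM.
set f := 1 - a *: 'X; set p := revpoly s.
have -> : 'X * (f^`() * p + f * p^`()) - f * p * (powerpoly [:: a] n + powerpoly s n) =
  p * ('X * f^`() - f * powerpoly [:: a] n) + f * ('X * p^`() - p * powerpoly s n) by ring.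
rewrite dvdp_addl ?dvdp_mull // {IHs}.
have -> : 'X * f^`() - f * powerpoly [:: a] n = - a ^+ n.+1 *: 'X^(n.+1).
  rewrite /f derivB derivC derivZ derivX sub0r.
  have -> : powerpoly [:: a] n = - \sum_(1 <= k < n.+1) (a *: 'X) ^+ k.
    by rewrite -sumrN; apply: eq_bigr => k _; rewrite /powersum big_seq1 exprZn scaleNr.
  rewrite (mulrN (1 - a *: 'X)) opprK; set y := a *: 'X.
  have -> : (1 - y) * \sum_(1 <= k < n.+1) y ^+ k = y - y ^+ n.+1.
    elim: n => [|m IHm]; first by rewrite big_geq // mulr0 expr1 subrr.
    by rewrite big_nat_recr //= mulrDr IHm mulrBl mul1r -exprS addrA subrK.
  by rewrite mulrN mulr_algr -/y addrA addNr add0r /y exprZn scaleNr.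
by rewrite -mul_polyC dvdp_mull.
Qed.

Lemma revpoly0 s : (revpoly s)`_0 = 1.
Proof.
rewrite -horner_coef0 /revpoly horner_prod big1_seq // => a _.
by rewrite !hornerE ?mulr0 ?subr0.
Qed.

Lemma newton_coef s n : n%:R * (revpoly s)`_n =
  \sum_(1 <= k < n.+1) - powersum s k * (revpoly s)`_(n - k).
Proof.
have /dvdpP[c E] := revpoly_newton s n.
have : ('X * (revpoly s)^`() - revpoly s * powerpoly s n)`_n = 0.
  by rewrite E coefMXn ltnSn.
rewrite coefB coefXM coef_deriv => /eqP; rewrite subr_eq0 => /eqP.
have -> : (if n == 0%N then 0 else (revpoly s)`_n.-1.+1 *+ n.-1.+1) = n%:R * (revpoly s)`_n.
  by case: n {E} => [|n]; rewrite ?mul0r //= mulr_natl.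
move=> ->; rewrite coefMr -(big_mkord xpredT (fun i => (revpoly s)`_(n - i) * (powerpoly s n)`_i)).
have Tk k : (powerpoly s n)`_k = if (0 < k < n.+1)%N then - powersum s k else 0.
  rewrite /powerpoly coef_sum; case: ifP => kn.
    rewrite (bigD1_seq k) ?mem_index_iota ?iota_uniq //= coefZ coefXn eqxx mulr1.
    by rewrite big1 ?addr0 // => j jk; rewrite coefZ coefXn eq_sym (negPf jk) mulr0.
  rewrite big_nat big1 // => j jn; rewrite coefZ coefXn; case: eqP => [kj|]; last by rewrite mulr0.
  by rewrite kj jn in kn.
rewrite big_ltn // Tk mulr0 add0r; apply: eq_big_nat => k kn.
by rewrite Tk kn mulrC.
Qed.

(** The term k = n has coefficient 1, the constant term of [revpoly s], so the recursion determines
    [w]. *)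
Lemma newton_unique s (w : nat -> C) :
  (forall n, n%:R * (revpoly s)`_n = \sum_(1 <= k < n.+1) w k * (revpoly s)`_(n - k)) ->
  forall n, (0 < n)%N -> w n = - powersum s n.
Proof.
move=> H n; elim/ltn_ind: n => n IHn n0.
have := H n; rewrite newton_coef !big_nat_recr //= subnn revpoly0 !mulr1.
move=> E; apply: (@addrI _ (\sum_(1 <= k < n) - powersum s k * (revpoly s)`_(n - k))).
rewrite E; congr (_ + _); apply: eq_big_nat => k /andP[k0 kn].
by rewrite IHn.
Qed.

Lemma size_revpoly_leq s : (size (revpoly s) <= (size s).+1)%N.
Proof.
elim: s => [|a s IHs]; first by rewrite /revpoly big_nil size_poly1.
rewrite /revpoly big_cons -/(revpoly s) (leq_trans (size_polyMleq _ _)) //=.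
have : (size (1 - a *: 'X : {poly C})%R <= 2)%N.
  rewrite (leq_trans (size_polyD _ _)) // size_poly1 size_polyN geq_max /=.
  by rewrite (leq_trans (size_scale_leq _ _)) // size_polyX.
by move=> h; move: IHs h; move: (size (1 - a *: 'X)%R) (size (revpoly s)) => u v; lia.
Qed.

Lemma revpoly_lead s : (revpoly s)`_(size s) = \prod_(a <- s) (- a).
Proof.
elim: s => [|a s IHs]; first by rewrite /revpoly !big_nil coef1.
rewrite /revpoly !big_cons -/(revpoly s) mulrBl mul1r coefB -scalerAl coefZ coefXM /=.
by rewrite nth_default ?size_revpoly_leq // sub0r IHs mulNr.
Qed.

End NewtonIdentities.

Lemma revpoly_exists (C : closedFieldType) (p : {poly C}) : p`_0 = 1 ->
  exists2 s : seq C, size s = (size p).-1 & p = revpoly s.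
Proof.
move=> p0; have [r pE] := closed_field_poly_normal p.
set l := lead_coef p in pE.
have r0 z : z \in r -> z != 0.
  move=> zr; apply/eqP => z0; have : root p 0.
    by rewrite pE /root hornerZ mulf_eq0 -[X in _ || X]/(root _ _) root_prod_XsubC -z0 zr orbT.
  by rewrite /root horner_coef0 p0 oner_eq0.
have E : p = (l * \prod_(z <- r) - z) *: revpoly [seq z^-1 | z <- r].
  rewrite {1}pE -scalerA; congr (_ *: _); rewrite /revpoly big_map.
  elim: r r0 {pE} => [|z r IHr] r0; first by rewrite !big_nil scale1r.
  rewrite !big_cons IHr => [|y yr]; last by rewrite r0 // in_cons yr orbT.
  have -> : 'X - z%:P = - z *: (1 - z^-1 *: 'X).
    rewrite scalerBr scalerA mulNr mulfV ?r0 ?mem_head // scaleN1r opprK addrC.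
    by rewrite scaleNr alg_polyC.
  by rewrite -scalerAl -scalerAr scalerA.
exists [seq z^-1 | z <- r].
  rewrite size_map pE size_scale ?size_prod_XsubC //.
  by rewrite lead_coef_eq0; apply/eqP => p00; move/eqP: p0; rewrite p00 coef0 eq_sym oner_eq0.
rewrite {1}E; have := p0; rewrite E coefZ revpoly0 mulr1 => ->.
by rewrite scale1r.
Qed.

Section PowerSumBound.
Variable R : realType.
Local Open Scope complex_scope.
Implicit Types (a b : R[i]) (s : seq R[i]).
Notation normc := (@Normc.normc R).

Lemma normc_sum (I : Type) (r : seq I) (G : I -> R[i]) :
  normc (\sum_(i <- r) G i) <= \sum_(i <- r) normc (G i).
Proof.
elim: r => [|i r IHr]; first by rewrite !big_nil Normc.normc0.
by rewrite !big_cons (le_trans (le_normcD _ _)) // lerD2l.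
Qed.

Lemma normcX a n : normc (a ^+ n) = normc a ^+ n.
Proof.
elim: n => [|n IHn]; first by rewrite Normc.normc1.
by rewrite !exprS Normc.normcM IHn.
Qed.

Lemma normc_ge0 a : 0 <= normc a.
Proof. by case: a => x y /=; apply: sqrtr_ge0. Qed.

Lemma expr_unbounded (x B : R) k0 : 1 < x -> exists2 k, (k0 <= k)%N & B < x ^+ k.
Proof.
move=> x1; have bern k : 1 + k%:R * (x - 1) <= x ^+ k.
  elim: k => [|k IHk]; first by rewrite mul0r addr0.
  rewrite exprS -natr1; have h1 : 0 <= k%:R * ((x - 1) * (x - 1)) by rewrite mulr_ge0 ?mulr_ge0 // subr_ge0 ltW.
  have h2 : x * (1 + k%:R * (x - 1)) <= x * x ^+ k by rewrite ler_pM2l // (lt_trans ltr01).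
  by lra.
pose N := Num.Def.archi_bound `|B / (x - 1)|.
exists (maxn k0 N); first exact: leq_maxl.
have BN : B / (x - 1) < N%:R.
  by apply: le_lt_trans (ler_norm _) _; apply: archi_boundP.
rewrite ltr_pdivrMr ?subr_gt0 // in BN; apply: lt_le_trans BN _.
apply: le_trans (bern _); rewrite -[X in X <= _]add0r lerD //.
by rewrite ler_pM2r ?subr_gt0 // ler_nat leq_maxr.
Qed.

(* Weighting the power sums by the coefficients of the product of the 'X - b
   over b != a isolates the powers of a. *)
Lemma powersum_bounded s (B : R) k0 :
  (forall k, (k0 <= k)%N -> normc (powersum s k) <= B) ->
  forall a, a \in s -> normc a <= 1.
Proof.
move=> HB a as_; rewrite leNgt; apply/negP => a1.
pose P : {poly R[i]} := \prod_(b <- rem a (undup s)) ('X - b%:P).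
have au : a \in undup s by rewrite mem_undup.
have Pb b : b \in s -> b != a -> P.[b] = 0.
  move=> bs ba; apply/eqP; rewrite -/(root _ _) root_prod_XsubC.
  by rewrite mem_rem_uniq ?undup_uniq // inE ba mem_undup.
have Pa : P.[a] != 0.
  by rewrite -/(root _ _) root_prod_XsubC mem_rem_uniq ?undup_uniq // inE eqxx.
have sumE k : \sum_(i < size P) P`_i * powersum s (k + i) = (a ^+ k * P.[a]) *+ count_mem a s.
  transitivity (\sum_(b <- s) b ^+ k * P.[b]).
    rewrite /powersum; under eq_bigr do rewrite big_distrr /=.
    rewrite exchange_big /=; apply: eq_bigr => b _; rewrite horner_coef big_distrr /=.
    by apply: eq_bigr => i _; rewrite exprD mulrCA.
  rewrite (bigID (pred1 a)) /= [X in _ + X]big1_seq ?addr0 => [|b /andP[ba bs]]; last first.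
    by rewrite Pb ?mulr0.
  rewrite (eq_bigr (fun=> a ^+ k * P.[a])) => [|b /eqP -> //].
  by rewrite big_const_seq iter_addr_0.
have c0 : 0 < normc P.[a].
  rewrite lt_neqAle normc_ge0 andbT eq_sym; apply: contra Pa => /eqP/Normc.eq0_normc ->.
  by rewrite eqxx.
have bound k : (k0 <= k)%N -> normc a ^+ k * normc P.[a] <= \sum_(i < size P) normc P`_i * B.
  move=> k0k; apply: (@le_trans _ _ (normc ((a ^+ k * P.[a]) *+ count_mem a s))).
    rewrite normcMn Normc.normcM normcX -mulr_natr ler_peMr //.
      by rewrite mulr_ge0 ?exprn_ge0 ?normc_ge0.
    by rewrite ler1n -has_count has_pred1.
  rewrite -sumE (le_trans (normc_sum _ _)) //; apply: ler_sum => i _.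
  by rewrite Normc.normcM ler_wpM2l ?normc_ge0 // HB // (leq_trans k0k) // leq_addr.
have [k k0k] := expr_unbounded ((\sum_(i < size P) normc P`_i * B) / normc P.[a]) k0 a1.
by rewrite ltr_pdivrMr // ltNge bound.
Qed.

Lemma prod_eq_bound (s : seq R) (B : R) : 0 < B -> {in s, forall x, 0 <= x <= B} ->
  \prod_(x <- s) x = B ^+ size s -> {in s, forall x, x = B}.
Proof.
move=> B0; elim: s => [//|x s IHs] Hs; rewrite big_cons /= exprS => E.
have /andP[x0 xB] := Hs x (mem_head _ _).
have Hs' : {in s, forall x, 0 <= x <= B} by move=> y ys; apply: Hs; rewrite in_cons ys orbT.
have ps : \prod_(y <- s) y <= B ^+ size s.
  elim: s Hs' {IHs Hs E} => [|y s IHs] Hs; first by rewrite big_nil expr0.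
  rewrite big_cons exprS; have /andP[y0 yB] := Hs y (mem_head _ _).
  apply: ler_pM => //; last by apply: IHs => z zs; apply: Hs; rewrite in_cons zs orbT.
  rewrite big_seq prodr_ge0 // => z zs.
  have zin : z \in y :: s by rewrite in_cons zs orbT.
  by case/andP: (Hs z zin).
have xBE : x = B.
  apply/eqP; rewrite eq_le xB leNgt; apply/negP => xltB.
  have : B * B ^+ size s <= x * B ^+ size s by rewrite -E ler_wpM2l.
  by rewrite ler_pM2r ?exprn_gt0 // leNgt xltB.
move: E; rewrite xBE => /(mulfI (lt0r_neq0 B0)) E y; rewrite in_cons => /orP[/eqP -> //|].
exact: IHs.
Qed.

Lemma normc_int (z : int) : normc z%:~R = `|z|%:~R.
Proof.
have -> : z%:~R = (z%:~R)%:C :> R[i] by rewrite (rmorph_int (real_complex R)).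
by rewrite /= expr0n addr0 sqrtr_sqr intr_norm.
Qed.

Lemma normc_real (x : R) : 0 <= x -> normc x%:C = x.
Proof. by move=> x0; rewrite /= expr0n addr0 sqrtr_sqr ger0_norm. Qed.

Variables (F : finFieldType) (hq : odd #|F|) (D : {poly F}) (g : nat).
Hypothesis HD : oddHyperelliptic g D.
Local Notation q := #|F|.

(** The bound on [psi] in even degrees bounds the power sums of the a^2/q, hence |a|^2 <= q. The
    product of the |a|^2 is the squared modulus q^(2g) of the leading coefficient, so none of the 2g
    factors can be smaller. *)
Theorem Lfun_eigenvalues : exists s : seq R[i],
  [/\ size s = (2 * g)%N,
      forall n, (Lcoef D n)%:~R = (revpoly s)`_n,
      forall n, (0 < n)%N -> (psi D n)%:~R = - powersum s n &
      {in s, forall a, normc a ^+ 2 = q%:R}].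
Proof.
have [L0 Lz Ln Lsq] := Lcoef_facts hq HD; have [_ psi2] := psi_facts hq HD.
have q0 : (0 < q)%N := ltnW (card_gt1 F).
pose p : {poly R[i]} := \poly_(i < (2 * g).+1) (Lcoef D i)%:~R.
have pE n : (Lcoef D n)%:~R = p`_n.
  by rewrite coef_poly; case: ltnP => // gn; rewrite Lz.
have nL : normc (Lcoef D (2 * g))%:~R ^+ 2 = q%:R ^+ (2 * g).
  by rewrite normc_int -rmorphXn /= -normrX Lsq normr_nat rmorph_nat natrX.
have [|s ss sE] := revpoly_exists (p := p); first by rewrite -pE L0.
have sp : size p = (2 * g).+1.
  apply/eqP; rewrite eqn_leq size_poly /= ltnNge; apply/negP => le.
  have := nL; rewrite pE nth_default // Normc.normc0 expr0n /= => /esym/eqP.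
  by rewrite expf_eq0 pnatr_eq0 => /andP[_ /eqP qE]; rewrite qE in q0.
rewrite sp /= in ss.
have psiE' n : (0 < n)%N -> (psi D n)%:~R = - powersum s n.
  apply: (newton_unique (w := fun n => (psi D n)%:~R)) => {}n.
  have -> : n%:R = (n%:R : int)%:~R :> R[i] by rewrite rmorph_nat.
  rewrite -sE -pE -rmorphM Ln rmorph_sum; apply: eq_bigr => k _.
  by rewrite rmorphM -pE.
have qR0 : 0 < q%:R :> R by rewrite ltr0n.
have nsq : normc (q%:R^-1) = q%:R^-1.
  have -> : (q%:R^-1 : R[i]) = (q%:R^-1)%:C by rewrite (fmorphV (real_complex R)) rmorph_nat.
  by rewrite normc_real // invr_ge0 ltW.
exists s; split => //; first by move=> n; rewrite pE sE.
have le1 a : a \in s -> normc a ^+ 2 <= q%:R.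
  move=> as_; suff : normc (a ^+ 2 * q%:R^-1) <= 1.
    by rewrite Normc.normcM nsq normcX ler_pdivrMr // mul1r.
  (* Here k >= 2g + 3 guarantees q^k >= 2g + 3, and 2 (2g + 1) comes from q^k + 1 <= 2 q^k. *)
  apply: (@powersum_bounded [seq a ^+ 2 * q%:R^-1 | a <- s] (2 * (2 * g + 1)%:R) (2 * g + 3)%N);
    last exact: map_f.
  move=> k gk; have k0 : (0 < k)%N by lia.
  have gqk : (2 * g + 3 <= q ^ k)%N by rewrite (leq_trans gk) // ltnW // ltn_expl // card_gt1.
  have -> : powersum [seq a ^+ 2 * q%:R^-1 | a <- s] k = - (psi D (2 * k))%:~R * q%:R^-1 ^+ k.
    rewrite psiE' ?muln_gt0 // opprK /powersum big_map big_distrl; apply: eq_bigr => b _ /=.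
    by rewrite exprMn exprM.
  rewrite Normc.normcM normcN normcX nsq normc_int exprVn ler_pdivrMr ?exprn_gt0 //.
  have : (`|psi D (2 * k)|%:~R : R) <= (((2 * g + 1) * (q ^ k + 1))%:R : int)%:~R.
    by rewrite ler_int psi2.
  move/le_trans; apply; rewrite rmorph_nat -natrX -natrM -natrM ler_nat.
  by have := leq_trans (isT : (1 <= 3)%N) (leq_trans (leq_addl _ _) gqk); nia.
move=> a as_; apply: (@prod_eq_bound [seq normc a ^+ 2 | a <- s]) => //; last exact: map_f.
  by move=> _ /mapP[b bs ->]; rewrite exprn_ge0 ?normc_ge0 //= le1.
rewrite big_map size_map ss -nL pE sE -ss revpoly_lead prodrXl; congr (_ ^+ 2).
elim: s {ss sE psiE' le1 as_} => [|b s IHs]; first by rewrite !big_nil Normc.normc1.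
by rewrite !big_cons Normc.normcM normcN IHs.
Qed.

End PowerSumBound.

(** * Arguments along paths *)

Section Circle.
Variable R : realType.
Local Open Scope complex_scope.
Implicit Types (x y t : R) (z : R[i]).
Notation normc := (@Normc.normc R).

Lemma cisD x y : cis (x + y) = cis x * cis y :> R[i].
Proof. by rewrite /cis cosD sinD; apply/eqP; rewrite eq_complex /= eqxx /= addrC. Qed.

Lemma cis0 : cis 0 = 1 :> R[i].
Proof. by rewrite /cis cos0 sin0. Qed.

Lemma normc_cis x : normc (cis x) = 1.
Proof. by rewrite /= cos2Dsin2 sqrtr1. Qed.

Lemma cis_sum (I : Type) (s : seq I) (G : I -> R) :
  cis (\sum_(i <- s) G i) = \prod_(i <- s) cis (G i).
Proof. exact: (big_morph cis cisD cis0). Qed.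

Lemma e_D x y : e_ (x + y) = e_ x * e_ y.
Proof. by rewrite /e_ mulrDr cisD. Qed.

Lemma e_0 : e_ 0 = 1 :> R[i].
Proof. by rewrite /e_ mulr0 cis0. Qed.

Lemma e_X x n : e_ x ^+ n = e_ (n%:R * x).
Proof.
elim: n => [|n IHn]; first by rewrite mul0r e_0.
by rewrite exprS IHn -e_D -natr1 mulrDl mul1r addrC.
Qed.

Lemma e_1 : e_ 1 = 1 :> R[i].
Proof.
by rewrite /e_ /cis mulr1 mulrC mulr_natr cos2pi sin2pi.
Qed.

Lemma normC_normc z : `|z| = (normc z)%:C.
Proof. by case: z => a b; rewrite normc_def. Qed.

Lemma ReM_real x z : complex.Re (x%:C * z) = x * complex.Re z.
Proof. by case: z => a b; rewrite /= mul0r subr0. Qed.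

Lemma ImM_real x z : complex.Im (x%:C * z) = x * complex.Im z.
Proof. by case: z => a b; rewrite /= mul0r addr0. Qed.

Lemma unit_angle z : normc z = 1 -> exists t, z = e_ t.
Proof.
case: z => a b /= nz; have ab : a ^+ 2 + b ^+ 2 = 1.
  have : 0 <= a ^+ 2 + b ^+ 2 by rewrite addr_ge0 ?sqr_ge0.
  by move/sqr_sqrtr <-; rewrite nz expr1n.
have a1 : -1 <= a <= 1.
  rewrite -ler_norml -(expr_le1 (n := 2)) // real_normK ?num_real //.
  by rewrite -ab lerDl sqr_ge0.
have sinE : sin (acos a) = `|b|.
  by rewrite sin_acos // -ab addrC addKr sqrtr_sqr.
have pi0 : 2 * pi != 0 :> R by rewrite mulf_neq0 // gt_eqF // pi_gt0.
have [b0|b0] := leP 0 b.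
  exists (acos a / (2 * pi)); rewrite /e_ mulrC divfK // /cis sinE ger0_norm //.
  by rewrite acosK // in_itv.
exists (- acos a / (2 * pi)); rewrite /e_ mulrC divfK // /cis sinN cosN sinE.
by rewrite ltr0_norm // opprK acosK // in_itv.
Qed.

(** The principal argument of 1 - z for Re z < 1, where 1 - z stays in the right half-plane and
    [atan] gives it continuously. *)
Definition arg1m z : R := atan (- complex.Im z / (1 - complex.Re z)).

Lemma arg1mP z : complex.Re z < 1 -> 1 - z = (normc (1 - z))%:C * cis (arg1m z).
Proof.
case: z => a b /= a1; have x0 : 0 < 1 - a by rewrite subr_gt0.
set T := - b / (1 - a).
have nE : Num.sqrt ((1 - a) ^+ 2 + (0 - b) ^+ 2) = (1 - a) * Num.sqrt (1 + T ^+ 2).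
  rewrite -{2}[1 - a]gtr0_norm // -sqrtr_sqr -sqrtrM ?sqr_ge0 // mulrDr mulr1.
  by rewrite -exprMn /T mulrC divfK ?gt_eqF // sub0r.
have s0 : Num.sqrt (1 + T ^+ 2) != 0.
  by rewrite gt_eqF // sqrtr_gt0 ltr_pwDl // sqr_ge0.
have cosE : cos (atan T) = (Num.sqrt (1 + T ^+ 2))^-1 by rewrite cos_atan.
have sinE : sin (atan T) = T * (Num.sqrt (1 + T ^+ 2))^-1.
  have E := atanK T; rewrite /tan cosE invrK in E.
  by rewrite -[X in _ = X * _]E mulfK.
apply/eqP; rewrite eq_complex /= -/T nE cosE sinE !mul0r subr0 addr0 mulfK //.
have x00 : 1 - a != 0 by rewrite gt_eqF.
by rewrite eqxx sub0r mulrA [_ * T]mulrAC mulfK // /T mulrC divfK ?eqxx.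
Qed.

(** Two arguments differ by a continuous function whose cosine is 1. Were it nonzero at 2, the
    intermediate value theorem would give it, up to sign, a value in ]0, pi], where the cosine is
    not 1. *)
Lemma argument_unique q G theta phi1 phi2 :
  is_argument_along q G theta phi1 -> is_argument_along q G theta phi2 ->
  phi1 2 = phi2 2 :> R.
Proof.
wlog le12 : phi1 phi2 / phi1 2 <= phi2 2.
  move=> W H1 H2; case/orP: (le_total (phi1 2) (phi2 2)) => h; first exact: W.
  by apply/esym/W.
case=> c1 z1 a1 [c2 z2 a2]; apply/eqP; rewrite eq_le le12 leNgt; apply/negP => lt12.
pose d t := phi2 t - phi1 t.
have cosd t : 0 <= t <= 2 -> cos (d t) = 1.
  move=> ht; have [G0 E1] := a1 t ht; have [_ E2] := a2 t ht.
  have : cis (phi1 t) = cis (phi2 t).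
    by apply: (mulfI (_ : `|G (Gamma_path q theta t)| != 0)); rewrite ?normr_eq0 // -E1.
  by rewrite /cis => -[ec es]; rewrite cosB ec es -!expr2 cos2Dsin2.
have dc : {within `[0, 2], continuous d}.
  by move=> t; apply: continuousB; [exact: c2|exact: c1].
have d0 : d 0 = 0 by rewrite /d z1 z2 subrr.
have d2 : 0 < d 2 by rewrite subr_gt0.
have pi0 : 0 < pi / 2 :> R by rewrite divr_gt0 // pi_gt0.
have [t tI dt] : exists2 t, t \in `[0, 2]%R & d t = Num.min (d 2) (pi / 2).
  apply: IVT => //; rewrite d0 min_l ?max_r ?(ltW d2) //.
  by rewrite le_min ltW //= ltW //= ge_min lexx.
have cos1 : cos (Num.min (d 2) (pi / 2)) = 1.
  by rewrite -dt cosd //; move: tI; rewrite in_itv.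
have v0 : 0 < Num.min (d 2) (pi / 2) by rewrite lt_min d2.
have vpi : Num.min (d 2) (pi / 2) <= pi.
  by rewrite ge_min; apply/orP; right; have := pi_gt0 R; lra.
move: v0 vpi cos1; move: (Num.min _ _) => v v0 vpi cos1.
have : v = 0; last by move=> E; rewrite E ltxx in v0.
apply: cos_inj; rewrite ?in_itv /= ?lexx ?pi_ge0 ?(ltW v0) ?vpi //.
by rewrite cos1 cos0.
Qed.

Lemma arg_alongE q G theta phi :
  is_argument_along q G theta phi -> arg_along q G theta = - phi 2 :> R.
Proof.
move=> H; rewrite /arg_along; congr (- _).
have [psi Hpsi ->] : [set a | exists2 psi, is_argument_along q G theta psi & a = psi 2]
    (xget 0 [set a | exists2 psi, is_argument_along q G theta psi & a = psi 2]).
  by apply: (xgetPex 0); exists (phi 2), phi.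
exact: argument_unique Hpsi H.
Qed.

Lemma contD (f g : R -> R) t : {for t, continuous f} -> {for t, continuous g} ->
  {for t, continuous (fun u => f u + g u)}.
Proof. exact: continuousD. Qed.

Lemma contM (f g : R -> R) t : {for t, continuous f} -> {for t, continuous g} ->
  {for t, continuous (fun u => f u * g u)}.
Proof. exact: continuousM. Qed.

Lemma contN (f : R -> R) t : {for t, continuous f} ->
  {for t, continuous (fun u => - f u)}.
Proof. exact: continuousN. Qed.

Lemma contX (f : R -> R) n t : {for t, continuous f} ->
  {for t, continuous (fun u => f u ^+ n)}.
Proof.
move=> cf; elim: n => [|n IHn]; first exact: cst_continuous.
have -> : (fun u => f u ^+ n.+1) = (fun u => f u * f u ^+ n).
  by apply/funext => u; rewrite exprS.
exact: contM.
Qed.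

Lemma contnorm (f : R -> R) t : {for t, continuous f} ->
  {for t, continuous (fun u => `|f u|)}.
Proof. by move=> cf; apply: (continuous_comp cf); exact: norm_continuous. Qed.

Section Path.
Variables (q : nat) (theta : R).

(* Single formulas for both pieces of the path, so that continuity is immediate. *)
Definition path_angle t : R := (t + 1 - `|t - 1|) / 2 * theta.
Definition path_radius t : R :=
  q%:R ^- 2 + (t - 1 + `|t - 1|) / 2 * ((Num.sqrt q%:R)^-1 - q%:R ^- 2).

Lemma Gamma_pathE t : Gamma_path q theta t = (path_radius t)%:C * e_ (path_angle t).
Proof.
rewrite /Gamma_path /path_angle /path_radius; case: (leP t 1) => t1.
  rewrite ler0_norm ?subr_le0 //; congr (_%:C * e_ _); last by lra.
  by rewrite subrr !mul0r addr0.
rewrite gtr0_norm ?subr_gt0 //; congr (_%:C * e_ _); last by lra.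
set u := q%:R ^- 2; set v := _^-1; lra.
Qed.

Lemma continuous_path_angle t : {for t, continuous path_angle}.
Proof.
apply: contM; last exact: cst_continuous.
apply: contM; last exact: cst_continuous.
apply: contD; first by apply: contD; [exact: cvg_id|exact: cst_continuous].
apply: contN; apply: contnorm.
by apply: contD; [exact: cvg_id|exact: cst_continuous].
Qed.

Lemma continuous_path_radius t : {for t, continuous path_radius}.
Proof.
apply: contD; first exact: cst_continuous.
apply: contM; last exact: cst_continuous.
apply: contM; last exact: cst_continuous.
apply: contD; first by apply: contD; [exact: cvg_id|exact: cst_continuous].
apply: contnorm.
by apply: contD; [exact: cvg_id|exact: cst_continuous].
Qed.

End Path.

Lemma continuous_sum (I : Type) (s : seq I) (G : I -> R -> R) t :
  (forall i, {for t, continuous (G i)}) ->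
  {for t, continuous (fun u => \sum_(i <- s) G i u)}.
Proof.
move=> HG; elim: s => [|i s IHs].
  have -> : (fun u => \sum_(i <- [::]) G i u) = cst 0 by apply/funext => u; rewrite big_nil.
  exact: cst_continuous.
have -> : (fun u => \sum_(i <- i :: s) G i u) = (G i \+ (fun u => \sum_(i <- s) G i u)).
  by apply/funext => u; rewrite big_cons.
exact: continuousD.
Qed.

End Circle.

(** * Arguments of L and of P_K on the critical circle *)

Section Arguments.
Variable R : realType.
Local Open Scope complex_scope.
Variables (F : finFieldType) (hq : odd #|F|) (D : {poly F}) (g : nat).
Hypothesis HD : oddHyperelliptic g D.
Local Notation q := #|F|.
Notation normc := (@Normc.normc R).
Implicit Types (theta t : R).

Lemma path_radius2 : path_radius q 2 = (Num.sqrt q%:R)^-1 :> R.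
Proof.
have E : (2 : R) - 1 = 1 by lra.
by rewrite /path_radius E normr1; move: (q%:R ^- 2) ((Num.sqrt q%:R)^-1) => u v; lra.
Qed.

Lemma path_angle0 theta : path_angle theta 0 = 0.
Proof. by rewrite /path_angle sub0r normrN normr1 add0r subrr !mul0r. Qed.

Lemma path_angle2 theta : path_angle theta 2 = theta.
Proof.
have E : (2 : R) - 1 = 1 by lra.
by rewrite /path_angle E normr1; lra.
Qed.

Definition PKexp (K : nat) (u : R[i]) : R[i] :=
  \sum_(1 <= k < K.+1) (psi D k)%:~R / k%:R * u ^+ k.

Lemma PKfunE K u : PKfun K D u = cexp (PKexp K u).
Proof.
congr cexp; apply: eq_bigr => k _; rewrite /psi /degsum rmorph_sum big_distrl big_distrl /=.
apply: eq_bigr => f _; rewrite rmorphM /= -pmulrn.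
by rewrite mulrAC.
Qed.

Lemma Im_PKexp K r x : complex.Im (PKexp K (r%:C * e_ x)) =
  \sum_(1 <= k < K.+1) (psi D k)%:~R / k%:R * (r ^+ k * sin (2 * pi * (k%:R * x))).
Proof.
rewrite /PKexp (raddf_sum (@complex.Im R : {additive (Rcomplex R) -> R})) /=.
apply: eq_bigr => k _.
have -> : (psi D k)%:~R / k%:R = ((psi D k)%:~R / k%:R)%:C :> R[i].
  by rewrite rmorphM fmorphV rmorph_int rmorph_nat.
by rewrite exprMn e_X -rmorphXn !ImM_real.
Qed.

(** P_K is an exponential, so the imaginary part of its exponent is a continuous argument, and it is
    0 at the real starting point of the path. *)
Lemma argPKE K theta : argPK K D theta =
  - \sum_(1 <= k < K.+1) (psi D k)%:~R / k%:R *
     ((Num.sqrt q%:R)^-1 ^+ k * sin (2 * pi * (k%:R * theta))).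
Proof.
pose phi t : R := \sum_(1 <= k < K.+1) (psi D k)%:~R / k%:R *
     (path_radius q t ^+ k * sin (2 * pi * (k%:R * path_angle theta t))).
rewrite /argPK (@arg_alongE _ _ _ _ phi); first by rewrite /phi path_radius2 path_angle2.
split.
- apply: continuous_in_subspaceT => t _.
  apply: continuous_sum => k; apply: contM; first exact: cst_continuous.
  apply: contM; first by apply: contX; exact: continuous_path_radius.
  apply: (@continuous_comp _ _ _ (fun u => 2 * pi * (k%:R * path_angle theta u)) (@sin R)).
    apply: contM; first exact: cst_continuous.
    apply: contM; first exact: cst_continuous.
    exact: continuous_path_angle.
  exact: continuous_sin.
- by rewrite /phi path_angle0 big1 // => k _; rewrite !mulr0 sin0 !mulr0.
- move=> t _; rewrite PKfunE Gamma_pathE.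
  set z := PKexp K _.
  have zE : complex.Im z = phi t by rewrite /z Im_PKexp.
  have e0 := expR_gt0 (complex.Re z).
  have nz : normc (cexp z) = expR (complex.Re z).
    by rewrite Normc.normcM normc_cis mulr1 normc_real // ltW.
  split; first by rewrite -normr_eq0 normC_normc nz eq_complex /= gt_eqF.
  by rewrite normC_normc nz -zE.
Qed.

Section Eigenvalues.
Variable s : seq R[i].
Hypothesis size_s : size s = (2 * g)%N.
Hypothesis Lcoef_s : forall n, (Lcoef D n)%:~R = (revpoly s)`_n.
Hypothesis norm_s : {in s, forall a, normc a ^+ 2 = q%:R}.

Lemma normc_s a : a \in s -> normc a = Num.sqrt q%:R.
Proof. by move=> /norm_s <-; rewrite sqrtr_sqr ger0_norm // normc_ge0. Qed.

Lemma LfunE u : Defs.Lfun D u = \prod_(a <- s) (1 - a * u).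
Proof.
have -> : \prod_(a <- s) (1 - a * u) = (revpoly s).[u].
  rewrite /revpoly horner_prod; apply: eq_bigr => a _.
  by rewrite !hornerE.
rewrite /Defs.Lfun; apply: (@lim_near_cst R[i]^o (@norm_hausdorff _ R[i]^o)).
exists (2 * g).+1 => // n /= gn.
rewrite /series /= (@horner_coef_wide _ n); last first.
  by rewrite (leq_trans (size_revpoly_leq _)) // size_s.
rewrite big_mkord; apply: eq_bigr => i _.
by rewrite -Lcoef_s /Lcoef /degsum rmorph_sum big_distrl.
Qed.

(** L has integer coefficients. This normalises the argument of L: at the real starting point of the
    path the arguments of conjugate factors cancel. *)
Lemma conj_s : perm_eq [seq conjc a | a <- s] s.
Proof.
have s0 a : a \in s -> a != 0.
  move=> /norm_s E; apply: contra_eq_neq E => ->; rewrite Normc.normc0 expr0n /=.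
  by rewrite eq_sym pnatr_eq0 -lt0n ltnW // card_gt1.
have revE (r : seq R[i]) : {in r, forall a, a != 0} ->
    revpoly r = (\prod_(a <- r) - a) *: \prod_(z <- [seq a^-1 | a <- r]) ('X - z%:P).
  elim: r => [|a r IHr] r0; first by rewrite /revpoly !big_nil scale1r.
  have a0 := r0 a (mem_head _ _).
  rewrite /revpoly /= !big_cons -/(revpoly r) IHr => [|b br]; last by rewrite r0 // in_cons br orbT.
  have -> : 1 - a *: 'X = - a *: ('X - (a^-1)%:P) :> {poly R[i]}.
    by rewrite scalerBr -[(_^-1)%:P]alg_polyC scalerA mulNr mulfV // scaleN1r opprK addrC scaleNr.
  by rewrite -scalerAl -scalerAr scalerA.
have sc : {in [seq conjc a | a <- s], forall a, a != 0}.
  by move=> _ /mapP[a /s0 a0 ->]; rewrite conjc_eq0.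
have E : revpoly [seq conjc a | a <- s] = revpoly s.
  have -> : revpoly [seq conjc a | a <- s] = map_poly (@conjc R) (revpoly s).
    rewrite /revpoly big_map rmorph_prod; apply: eq_bigr => a _.
    by rewrite rmorphB rmorph1 /= map_polyZ map_polyX.
  apply/polyP => n; rewrite coef_map /= -Lcoef_s.
  by rewrite (rmorph_int (@conjc R)).
have := E; rewrite (revE _ sc) (revE s) // => E2.
have l0 : \prod_(a <- s) - a != 0.
  by rewrite prodf_seq_neq0; apply/allP => a as_; rewrite /= oppr_eq0 s0.
have le : \prod_(a <- [seq conjc a | a <- s]) - a = \prod_(a <- s) - a.
  have := congr1 lead_coef E2; rewrite !lead_coefZ !(monicP (monic_prod_XsubC _ _ _)).
  by rewrite !mulr1.
have : \prod_(z <- [seq a^-1 | a <- [seq conjc a | a <- s]]) ('X - z%:P) =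
       \prod_(z <- [seq a^-1 | a <- s]) ('X - z%:P).
  by apply: (scalerI l0); rewrite -{1}le.
by move/prod_XsubC_eq; apply: perm_map_inj; exact: invr_inj.
Qed.

Lemma arg1m_conj z : arg1m (conjc z) = - arg1m z :> R.
Proof. by case: z => a b; rewrite /arg1m /= mulNr atanN. Qed.

Lemma sum_arg1m_real r : \sum_(a <- s) arg1m (a * r%:C) = 0 :> R.
Proof.
have : \sum_(a <- s) arg1m (a * r%:C) = - \sum_(a <- s) arg1m (a * r%:C) :> R.
  rewrite -{1}(perm_big _ conj_s) big_map -sumrN /=; apply: eq_bigr => a _.
  rewrite -arg1m_conj; congr arg1m; rewrite rmorphM; congr (_ * _).
  by apply/eqP; rewrite eq_complex /= oppr0 !eqxx.
lra.
Qed.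

Lemma Re_lt1 z : normc z <= 1 -> z != 1 -> complex.Re z < 1.
Proof.
case: z => a b /= n1 z1; rewrite ltNge; apply/negP => a1.
have : a ^+ 2 + b ^+ 2 <= 1.
  by rewrite -[X in _ <= X](expr1n R 2) -ler_sqrt // ?sqrtr_sqr ?normr1 // addr_ge0 ?sqr_ge0.
move=> ab; have b0 : b = 0 by apply/eqP; rewrite -sqrf_eq0 eq_le sqr_ge0 andbT; nra.
have a1' : a = 1 by apply/eqP; rewrite eq_le a1 andbT; nra.
by move: z1; rewrite a1' b0 eqxx.
Qed.

Lemma path_radius_le t : 0 <= t <= 2 ->
  [/\ 0 <= path_radius q t, Num.sqrt q%:R * path_radius q t <= 1 &
   t < 2 -> Num.sqrt q%:R * path_radius q t < 1].
Proof.
move=> /andP[t0 t2]; rewrite /path_radius.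
set w := Num.sqrt q%:R.
have w1 : 1 < w by rewrite -sqrtr1 ltr_sqrt ?ltr0n ?ltr1n ?(ltnW (card_gt1 F)) ?card_gt1.
have qw : q%:R = w ^+ 2 by rewrite sqr_sqrtr.
set c := (t - 1 + `|t - 1|) / 2.
have [c0 c1 c2] : [/\ 0 <= c, c <= 1 & t < 2 -> c < 1].
  rewrite /c; case: (leP t 1) => t1.
    by rewrite ler0_norm ?subr_le0 //; split; lra.
  by rewrite gtr0_norm ?subr_gt0 //; split; lra.
have w0 : 0 < w by lra.
set u := q%:R ^- 2; have wu : w * u < 1.
  rewrite /u qw -exprM -[w * _]/(w / _) ltr_pdivrMr ?exprn_gt0 // mul1r.
  by rewrite -{1}[w]expr1 ltr_eXn2l.
have u0 : 0 <= u by rewrite invr_ge0 exprn_ge0.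
have v0 : 0 < w^-1 by rewrite invr_gt0.
have wv : w * w^-1 = 1 by rewrite mulfV // gt_eqF.
have -> : w * (u + c * (w^-1 - u)) = w * u + c * (w * w^-1 - w * u) by ring.
by rewrite wv; split; [nra|nra|move/c2; nra].
Qed.

Variable theta : R.
Hypothesis theta_reg : {in s, forall a, a * critical_point q theta != 1}.

Let z a t := a * Gamma_path q theta t.

Let Re_z a t : a \in s -> 0 <= t <= 2 -> complex.Re (z a t) < 1.
Proof.
move=> as_ ht; have [r0 r1 r2] := path_radius_le ht.
have nz : normc (z a t) = Num.sqrt q%:R * path_radius q t.
  by rewrite /z Gamma_pathE !Normc.normcM normc_cis mulr1 normc_s // normc_real.
case/andP: (ht) => _; rewrite le_eqVlt => /orP[/eqP t2|/r2 lt1].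
  apply: Re_lt1; rewrite ?nz //; have := theta_reg as_.
  by rewrite /z t2 Gamma_pathE path_radius2 path_angle2.
apply: Re_lt1; first by rewrite nz.
by apply: contraTneq lt1 => z1; rewrite -nz z1 Normc.normc1 ltxx.
Qed.

Let cont_z a t : {for t, continuous (fun u => complex.Re (z a u))} /\
  {for t, continuous (fun u => complex.Im (z a u))}.
Proof.
case: a => x y; have cs (f : R -> R) : continuous f ->
    {for t, continuous (fun u => f (2 * pi * path_angle theta u))}.
  move=> cf; apply: (@continuous_comp _ _ _ (fun u => 2 * pi * path_angle theta u) f); last exact: cf.
  apply: contM; first exact: cst_continuous.
  exact: continuous_path_angle.
have cc := cs _ (@continuous_cos R); have ss := cs _ (@continuous_sin R).
have cr := @continuous_path_radius R q t.
split.
  have -> : (fun u => complex.Re (z (x +i* y) u)) = (fun u => path_radius q u *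
     (x * cos (2 * pi * path_angle theta u) + - (y * sin (2 * pi * path_angle theta u)))).
    apply/funext => u; rewrite /z Gamma_pathE mulrCA ReM_real; congr (_ * _).
  apply: contM => //; apply: contD; last apply: contN; by apply: contM => //; exact: cst_continuous.
have -> : (fun u => complex.Im (z (x +i* y) u)) = (fun u => path_radius q u *
     (x * sin (2 * pi * path_angle theta u) + y * cos (2 * pi * path_angle theta u))).
  apply/funext => u; rewrite /z Gamma_pathE mulrCA ImM_real; congr (_ * _).
by apply: contM => //; apply: contD; apply: contM => //; exact: cst_continuous.
Qed.

(** On the path |a u| < 1 except at the end point, where a u has modulus 1 but differs from 1 by
    [theta_reg]. So each factor 1 - a u remains in the right half-plane, and the principal arguments
    add up to a continuous argument of L. *)
Lemma argLE : argL D theta = - \sum_(a <- s) arg1m (a * critical_point q theta).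
Proof.
have Gamma2 : Gamma_path q theta 2 = critical_point q theta.
  by rewrite Gamma_pathE path_radius2 path_angle2.
have nz : {in s, forall a, 1 - a * critical_point q theta != 0}.
  by move=> a /theta_reg; rewrite subr_eq0 eq_sym.
rewrite /argL LfunE; case: eqP => [/eqP|_].
  by rewrite prodf_seq_eq0 => /hasP[a /nz /negPf ->].
rewrite (@arg_alongE _ _ _ _ (fun t => \sum_(a <- s) arg1m (z a t))).
  by rewrite /z Gamma2.
split.
- apply: continuous_in_subspaceT => t; rewrite inE /= in_itv /= => ht.
  have -> : (fun t => \sum_(a <- s) arg1m (z a t)) =
     (fun t => \sum_(i < size s) arg1m (z (nth 0 s i) t)).
    by apply/funext => u; rewrite (big_nth 0) big_mkord.
  apply: continuous_sum => i; set a := nth 0 s i.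
  have as_ : a \in s by apply: mem_nth.
  have [cR cI] := cont_z a t.
  apply: (@continuous_comp _ _ _ (fun u => - complex.Im (z a u) / (1 - complex.Re (z a u))) (@atan R));
    last exact: continuous_atan.
  apply: contM; first exact: contN.
  apply: continuousV; first by rewrite subr_eq0 gt_eqF // Re_z.
  by apply: contD; [exact: cst_continuous|exact: contN].
- rewrite -[RHS](sum_arg1m_real (path_radius q 0)); apply: eq_bigr => a _.
  by rewrite /z Gamma_pathE path_angle0 e_0 mulr1.
- move=> t ht; rewrite LfunE.
  have zE a : a \in s -> 1 - z a t = (normc (1 - z a t))%:C * cis (arg1m (z a t)).
    by move=> as_; apply: arg1mP; apply: Re_z.
  split.
    rewrite prodf_seq_neq0; apply/allP => a as_ /=; rewrite subr_eq0.
    by have := Re_z as_ ht; rewrite /z; apply: contraTneq => <-; rewrite ltxx.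
  rewrite cis_sum normr_prod -big_split /=; apply: eq_big_seq => a as_.
  by rewrite normC_normc -zE.
Qed.

End Eigenvalues.

End Arguments.

(** * Angles of the zeros *)

Section Sawtooth.
Variable R : realType.
Implicit Types (x y t theta : R) (ts : seq R).

Definition fracpart x : R := x - (Num.floor x)%:~R.
Definition sawtooth x : R := 1 / 2 - fracpart x.

Lemma fracpart_ge0 x : 0 <= fracpart x.
Proof. by rewrite subr_ge0 floor_le. Qed.

Lemma fracpart_lt1 x : fracpart x < 1.
Proof. by rewrite ltrBlDl; have := floorD1_gt x; rewrite intrD. Qed.

Lemma fracpartDz x (z : int) : fracpart (x + z%:~R) = fracpart x.
Proof.
by rewrite /fracpart floorDrz ?intr_int // intrKfloor intrD opprD addrACA subrr addr0.
Qed.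

Lemma fracpart_id x : 0 <= x < 1 -> fracpart x = x.
Proof.
by move=> x01; rewrite /fracpart (floor_def (m := 0)) ?subr0 // add0r.
Qed.

Local Open Scope complex_scope.

Lemma e_int (z : int) : e_ z%:~R = 1 :> R[i].
Proof.
have nat_case n : e_ n%:R = 1 :> R[i].
  by rewrite -[n%:R]mulr1 -e_X e_1 expr1n.
case: z => n; first exact: nat_case.
rewrite NegzE mulrNz; apply: (mulfI (x := e_ n.+1%:R)); first by rewrite nat_case oner_eq0.
by rewrite -e_D addrN e_0 nat_case mulr1.
Qed.

Lemma e_fracpart x : e_ (fracpart x) = e_ x :> R[i].
Proof.
have E : x = fracpart x + (Num.floor x)%:~R by rewrite subrK.
by rewrite [in RHS]E e_D e_int mulr1.
Qed.

(** With v = pi y, -sin(2v)/(1 - cos(2v)) = -cot v = tan(v - pi/2), and v - pi/2 lies in the range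
    of [atan]. *)
Lemma arg1m_e x : 0 < fracpart x -> arg1m (e_ x) = - pi * sawtooth x.
Proof.
move=> x0; have x1 := fracpart_lt1 x; rewrite -e_fracpart /sawtooth; set y := fracpart x in x0 x1 *.
have pi0 := pi_gt0 R.
rewrite /arg1m /e_ /=.
have y2 : 2 * pi * y = (pi * y) *+ 2 by rewrite -mulrA mulr_natl.
have s0 : 0 < sin (pi * y).
  by apply: sin_gt0_pi; rewrite mulr_gt0 //= -[X in _ < X]mulr1 ltr_pM2l.
have -> : - sin (2 * pi * y) / (1 - cos (2 * pi * y)) = tan (pi * y - pi / 2).
  rewrite /tan sinBpihalf cosBpihalf y2 sin_mulr2n cos_mulr2n cos2sin2.
  set c := cos _; set s := sin _ in s0 *.
  have -> : 1 - ((1 - s ^+ 2) *+ 2 - 1) = (s * s) *+ 2 by ring.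
  field; lra.
rewrite tanK; first by field.
have py0 : 0 < pi * y by rewrite mulr_gt0.
rewrite in_itv /=; apply/andP; split; first lra.
have : pi * y < pi * 1 by rewrite ltr_pM2l.
lra.
Qed.

Lemma e_eq1 x : e_ x = 1 :> R[i] -> fracpart x = 0.
Proof.
move=> ex; apply/eqP; rewrite eq_le fracpart_ge0 andbT leNgt; apply/negP => x0.
have := ex; rewrite -e_fracpart => -[+ _]; set y := fracpart x in x0 *.
have y1 : y < 1 := fracpart_lt1 x; have pi0 := pi_gt0 R.
have s0 : 0 < sin (pi * y).
  by apply: sin_gt0_pi; rewrite mulr_gt0 //= -[X in _ < X]mulr1 ltr_pM2l.
have -> : 2 * pi * y = (pi * y) *+ 2 by rewrite -mulrA mulr_natl.
by rewrite cos_mulr2n cos2sin2; nra.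
Qed.

Definition sawsum ts theta : R := \sum_(t <- ts) sawtooth (theta - t).
Definition regular ts theta : Prop := {in ts, forall t, fracpart (theta - t) != 0}.

Variables (F : finFieldType) (hq : odd #|F|) (D : {poly F}) (g : nat).
Hypothesis HD : oddHyperelliptic g D.
Local Notation q := #|F|.

(** The eigenvalues are written a = sqrt(q) e(-t), so that 1 - a u vanishes at the critical point of
    angle t. [S_] is identified away from the zeros only; [sawsum_bound] carries bounds over to all
    angles. The sums of e(-k t) equal -psi_k/q^(k/2), which is real, so the sums of sin(2 pi k t)
    vanish, and the last clause is the trivial bound on psi_k divided by q^(k/2). *)
Theorem S_angles : exists ts : seq R, [/\ size ts = (2 * g)%N,
  forall theta, regular ts theta -> S_ theta D = sawsum ts theta,
  forall K theta, SK K theta D =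
    \sum_(t <- ts) \sum_(1 <= k < K.+1) sin (2 * pi * (k%:R * (theta - t))) / (pi * k%:R) &
  forall k theta, (0 < k)%N ->
    `|\sum_(t <- ts) cos (2 * pi * (k%:R * (theta - t)))| <= Num.sqrt q%:R ^+ k /\
    `|\sum_(t <- ts) sin (2 * pi * (k%:R * (theta - t)))| <= Num.sqrt q%:R ^+ k].
Proof.
have [s [ss Ls ps ns]] := Lfun_eigenvalues R hq HD.
set w := Num.sqrt (q%:R : R).
have w0 : 0 < w by rewrite sqrtr_gt0 ltr0n ltnW // card_gt1.
have [f fE] : exists f : R[i] -> R, {in s, forall a, a = w%:C * e_ (- f a)}.
  have ex a : exists t, a \in s -> a = w%:C * e_ (- t).
    case: (boolP (a \in s)) => as_; last by exists 0.
    have [|t tE] := @unit_angle R (w^-1%:C * a).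
      by rewrite Normc.normcM (normc_s ns as_) normc_real ?invr_ge0 ?ltW // mulVf ?gt_eqF.
    exists (- t) => _; rewrite opprK -tE mulrA -rmorphM mulfV ?gt_eqF //.
    by rewrite mul1r.
  have [f Hf] := choice ex; exists f => a; exact: Hf.
pose ts := [seq f a | a <- s].
have crit theta a : a \in s -> a * critical_point q theta = e_ (theta - f a).
  move=> as_; rewrite {1}(fE a as_) /critical_point mulrACA -rmorphM mulfV ?gt_eqF //.
  by rewrite mul1r -e_D addrC.
have psiE k : (0 < k)%N -> \sum_(t <- ts) e_ (- (k%:R * t)) = - ((psi D k)%:~R / w ^+ k)%:C.
  move=> k0; have wk : (w ^+ k)%:C != 0 :> R[i] by rewrite eq_complex /= gt_eqF ?exprn_gt0.
  rewrite rmorphM fmorphV rmorph_int -mulNr ps // opprK; apply: (mulIf wk); rewrite divfK //.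
  rewrite /powersum big_map big_distrl; apply: eq_big_seq => a as_.
  transitivity ((w%:C * e_ (- f a)) ^+ k); last by rewrite -fE.
  by rewrite exprMn e_X mulrN -rmorphXn /= mulrC.
have cosE k : (0 < k)%N -> \sum_(t <- ts) cos (2 * pi * (k%:R * t)) = - ((psi D k)%:~R / w ^+ k).
  move=> /psiE/(congr1 (@complex.Re R)).
  rewrite (raddf_sum (@complex.Re R : {additive (Rcomplex R) -> R})) /= => <-.
  by apply: eq_bigr => t _; rewrite mulrN cosN.
have sinE k : (0 < k)%N -> \sum_(t <- ts) sin (2 * pi * (k%:R * t)) = 0.
  move=> /psiE/(congr1 (@complex.Im R)).
  rewrite (raddf_sum (@complex.Im R : {additive (Rcomplex R) -> R})) /= oppr0 => E.
  apply/eqP; rewrite -oppr_eq0 -sumrN; apply/eqP/(etrans _ E).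
  by apply: eq_bigr => t _; rewrite mulrN sinN.
have sinD k theta : (0 < k)%N -> \sum_(t <- ts) sin (2 * pi * (k%:R * (theta - t))) =
    - (sin (2 * pi * (k%:R * theta)) * ((psi D k)%:~R / w ^+ k)).
  move=> k0; transitivity
    (sin (2 * pi * (k%:R * theta)) * (\sum_(t <- ts) cos (2 * pi * (k%:R * t))) -
     cos (2 * pi * (k%:R * theta)) * (\sum_(t <- ts) sin (2 * pi * (k%:R * t)))).
    rewrite !big_distrr -sumrB; apply: eq_bigr => t _.
    by rewrite mulrBr mulrBr sinB.
  by rewrite cosE // sinE // mulr0 subr0 mulrN.
have cosD k theta : (0 < k)%N -> \sum_(t <- ts) cos (2 * pi * (k%:R * (theta - t))) =
    - (cos (2 * pi * (k%:R * theta)) * ((psi D k)%:~R / w ^+ k)).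
  move=> k0; transitivity
    (cos (2 * pi * (k%:R * theta)) * (\sum_(t <- ts) cos (2 * pi * (k%:R * t))) +
     sin (2 * pi * (k%:R * theta)) * (\sum_(t <- ts) sin (2 * pi * (k%:R * t)))).
    rewrite !big_distrr -big_split; apply: eq_bigr => t _.
    by rewrite mulrBr mulrBr cosB.
  by rewrite cosE // sinE // mulr0 addr0 mulrN.
exists ts; split.
- by rewrite size_map.
- move=> theta reg; rewrite /S_ (argLE ss Ls ns).
    rewrite /sawsum big_map -sumrN big_distrr; apply: eq_big_seq => a as_ /=.
    rewrite crit // arg1m_e.
      by rewrite mulNr opprK mulKf // gt_eqF // pi_gt0.
    by rewrite lt_neqAle fracpart_ge0 eq_sym reg // map_f.
  move=> a as_; rewrite crit //; apply/eqP => /e_eq1 /eqP; apply/negP.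
  by apply: reg; apply: map_f.
- move=> K theta; rewrite /SK argPKE exchange_big mulrN -mulNr big_distrr.
  apply: eq_big_nat => k /andP[k0 _]; rewrite -big_distrl sinD //= exprVn.
  rewrite invfM; set a := pi^-1; set b := k%:R^-1; set c := sin _.
  by ring.
- move=> k theta k0.
  have pb : `|(psi D k)%:~R / w ^+ k| <= w ^+ k.
    rewrite normrM normfV (ger0_norm (exprn_ge0 _ (ltW w0))) ler_pdivrMr ?exprn_gt0 //.
    rewrite -expr2 -exprM mulnC exprM sqr_sqrtr // -intr_norm.
    have [pb _] := psi_facts hq HD; have := pb k k0; rewrite -(ler_int R) rmorph_nat.
    by rewrite natrX.
  have mb c : `|c| <= 1 -> `|c * ((psi D k)%:~R / w ^+ k)| <= w ^+ k.
    by move=> c1; rewrite normrM -[X in _ <= X]mul1r ler_pM.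
  by rewrite cosD // sinD // !normrN !mb // ?cos_max ?sin_max.
Qed.

End Sawtooth.

(** * Tails of the Fourier series of the sawtooth *)

Section Derivatives.
Variable R : realType.
Implicit Types (f g df dg : R -> R) (x y a b c : R).

Lemma derD f g x a b : is_derive x 1 f a -> is_derive x 1 g b ->
  is_derive x 1 (fun u => f u + g u) (a + b).
Proof. by move=> ? ?; exact: is_deriveD. Qed.

Lemma derB f g x a b : is_derive x 1 f a -> is_derive x 1 g b ->
  is_derive x 1 (fun u => f u - g u) (a - b).
Proof. by move=> ? ?; exact: is_deriveB. Qed.

Lemma derM f g x a b : is_derive x 1 f a -> is_derive x 1 g b ->
  is_derive x 1 (fun u => f u * g u) (f x * b + g x * a).
Proof. by move=> ? ?; exact: is_deriveM. Qed.

Lemma derV f x a : f x != 0 -> is_derive x 1 f a ->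
  is_derive x 1 (fun u => (f u)^-1) (- f x ^- 2 * a).
Proof. by move=> ? ?; exact: is_deriveV. Qed.

Lemma der_cst c x : is_derive x 1 (fun=> c) 0.
Proof. exact: is_derive_cst. Qed.

Lemma der_scale c f x a : is_derive x 1 f a -> is_derive x 1 (fun u => c * f u) (c * a).
Proof.
move=> fa; have := derM (der_cst c x) fa.
by rewrite mulr0 addr0.
Qed.

Lemma der_id x : is_derive x 1 (fun u : R => u) 1.
Proof. exact: is_derive_id. Qed.

Lemma der_mulc c x : is_derive x 1 (fun u => c * u) c.
Proof. by have := der_scale c (der_id x); rewrite mulr1. Qed.

Lemma der_sin c x : is_derive x 1 (fun u => sin (c * u)) (c * cos (c * x)).
Proof. by rewrite mulrC; exact: (is_derive1_comp (is_derive_sin _) (der_mulc c x)). Qed.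

Lemma der_cos c x : is_derive x 1 (fun u => cos (c * u)) (- (c * sin (c * x))).
Proof.
by rewrite mulrC -mulNr; exact: (is_derive1_comp (is_derive_cos _) (der_mulc c x)).
Qed.

Lemma der_sum (I : Type) (s : seq I) (f df : I -> R -> R) x :
  (forall i, is_derive x 1 (f i) (df i x)) ->
  is_derive x 1 (fun u => \sum_(i <- s) f i u) (\sum_(i <- s) df i x).
Proof.
move=> fd; elim: s => [|i s IHs].
  have -> : (fun u => \sum_(i <- [::]) f i u) = cst 0 by apply/funext => u; rewrite big_nil.
  by rewrite big_nil; exact: der_cst.
have -> : (fun u => \sum_(j <- i :: s) f j u) = (fun u => f i u + \sum_(j <- s) f j u).
  by apply/funext => u; rewrite big_cons.
by rewrite big_cons; exact: derD.
Qed.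

Lemma der_ndecr f df a b : a <= b ->
  (forall x, a <= x <= b -> is_derive x 1 f (df x)) ->
  (forall x, a <= x <= b -> 0 <= df x) -> f a <= f b.
Proof.
move=> ab fd df0.
have sub x : x \in `]a, b[ -> a <= x <= b by rewrite in_itv /= => /andP[/ltW -> /ltW ->].
apply: (@ger0_derive1_ndecr _ f a b) => //.
- by move=> x /sub/fd[].
- by move=> x /sub ax; rewrite derive1E; have [_ ->] := fd x ax; exact: df0.
- by apply: derivable_within_continuous => x; rewrite in_itv => /fd[].
Qed.

Lemma sin_abs x : 0 <= x -> `|sin x| <= x.
Proof.
move=> x0; have mono c : c = 1 \/ c = -1 -> 0 <= x - c * sin x.
  move=> c1; have H := @der_ndecr (fun u => u - c * sin (1 * u))
    (fun u => 1 - c * (1 * cos (1 * u))) 0 x x0.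
  have := H _ _; rewrite mulr0 sin0 mulr0 subr0 mul1r; apply.
    by move=> u _; exact: (derB (der_id u) (der_scale c (der_sin 1 u))).
  by move=> u _; have := cos_le1 (1 * u); have := cos_geN1 (1 * u); case: c1 => ->; lra.
rewrite ler_norml; apply/andP; split.
  by have := mono (-1) (or_intror erefl); lra.
by have := mono 1 (or_introl erefl); lra.
Qed.

Lemma cos_ge_half x : `|x| <= pi / 4 -> 1 / 2 <= cos x.
Proof.
rewrite ler_norml => /andP[x0 x1]; have p0 := pi_gt0 R.
have c0 : 0 <= cos x by apply: cos_ge0_pihalf; apply/andP; split; lra.
have c2 : 0 <= cos (x *+ 2) by apply: cos_ge0_pihalf; apply/andP; split; lra.
move: c2; rewrite cos_mulr2n; set c := cos x in c0 *.
by case: (lerP (1 / 2) c) => // ?; nra.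
Qed.

(** With v = pi y / 2 <= pi / 4, the cosine is at least 1/2 on [0, v], so sin v >= v/2 and sin(2v)
    >= v/2 >= y/2. *)
Lemma sinpi_ge y : 0 <= y <= 1 / 2 -> y / 2 <= sin (pi * y).
Proof.
move=> /andP[y0 y1]; have p2 := pi_ge2 R; have p0 := pi_gt0 R.
pose v := pi * y / 2.
have v0 : 0 <= v by rewrite /v divr_ge0 // mulr_ge0 // ltW.
have v1 : v <= pi / 4.
  have : pi * y <= pi * (1 / 2) by rewrite ler_pM2l.
  by rewrite /v; lra.
have cosv u : 0 <= u <= v -> 1 / 2 <= cos u.
  by move=> /andP[u0 uv]; apply: cos_ge_half; rewrite ger0_norm //; lra.
have sv : v / 2 <= sin v.
  rewrite -subr_ge0.
  have H := @der_ndecr (fun u => sin (1 * u) - (1 / 2) * u) (fun u => 1 * cos (1 * u) - 1 / 2) 0 v v0.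
  have := H _ _; rewrite !mulr0 sin0 subr0 mul1r => {}H.
  rewrite [v / 2]mulrC -[in sin _](mul1r v); apply: H.
    by move=> u _; exact: (derB (der_sin 1 u) (der_mulc 2^-1 u)).
  by move=> u /cosv; rewrite !mul1r subr_ge0.
have -> : pi * y = v *+ 2 by rewrite /v; lra.
rewrite sin_mulr2n; have cv : 1 / 2 <= cos v by apply: cosv; rewrite v0 lexx.
have y4 : y <= v by rewrite /v; nra.
set c := cos v in cv *; set s := sin v in sv *; nra.
Qed.

End Derivatives.

Section FourierTail.
Variable R : realType.
Implicit Types (x y d : R) (K : nat).

(** [pi] times the remainder of the Fourier series of [sawtooth] on [0, 1[ after K terms. Its
    derivative [dtail] is - pi times the Dirichlet kernel. *)
Definition tail K y : R :=
  pi * (1 / 2 - y) - \sum_(1 <= k < K.+1) sin (2 * pi * k%:R * y) / k%:R.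

Definition dtail K y : R :=
  - pi - \sum_(1 <= k < K.+1) 2 * pi * cos (2 * pi * k%:R * y).

Lemma der_tail K y : is_derive y 1 (tail K) (dtail K y).
Proof.
apply: derB.
  rewrite -[X in is_derive _ _ _ X]mulrN1; apply: der_scale.
  by rewrite -[X in is_derive _ _ _ X]sub0r; exact: (derB (der_cst (1 / 2) y) (der_id y)).
rewrite big_add1; under eq_fun do rewrite big_add1.
apply: (@der_sum _ _ _ (fun k u => sin (2 * pi * k.+1%:R * u) / k.+1%:R)
  (fun k u => 2 * pi * cos (2 * pi * k.+1%:R * u))) => k.
have -> : 2 * pi * cos (2 * pi * k.+1%:R * y) =
    k.+1%:R^-1 * (2 * pi * k.+1%:R * cos (2 * pi * k.+1%:R * y)).
  by field; rewrite nat1r pnatr_eq0.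
by under eq_fun do rewrite mulrC; exact/der_scale/der_sin.
Qed.

Lemma dirichlet K y : dtail K y * sin (pi * y) = - (pi * sin ((2 * K + 1)%:R * pi * y)).
Proof.
elim: K => [|K IHK].
  by rewrite /dtail big_geq // subr0 muln0 add0n mul1r mulNr.
have -> : dtail K.+1 y = dtail K y - 2 * pi * cos (2 * pi * K.+1%:R * y).
  by rewrite /dtail [in LHS]big_nat_recr //=; set z := \sum_(_ <= _ < _) _; ring.
rewrite mulrBl {}IHK.
have -> : (2 * K + 1)%:R * pi * y = 2 * pi * K.+1%:R * y - pi * y.
  by rewrite natrD natrM -natr1; ring.
have -> : (2 * K.+1 + 1)%:R * pi * y = 2 * pi * K.+1%:R * y + pi * y.
  by rewrite natrD natrM; ring.
by rewrite sinB sinD; ring.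
Qed.

Lemma sin_natpi k : sin (pi *+ k) = 0 :> R.
Proof.
by elim: k => [|k IHk]; rewrite ?mulr0n ?sin0 // mulrSr sinDpi IHk oppr0.
Qed.

(** The base point for integration: on ]0, 1/2] the tail is recovered from its derivative. *)
Lemma tail_half K : tail K (1 / 2) = 0.
Proof.
rewrite /tail subrr mulr0 sub0r big1 ?oppr0 // => k _.
have -> : 2 * pi * k%:R * (1 / 2) = pi *+ k :> R by rewrite -[_ *+ k]mulr_natr; field.
by rewrite sin_natpi mul0r.
Qed.

Lemma tail_sym K y : tail K (1 - y) = - tail K y.
Proof.
rewrite /tail [RHS]opprD opprK.
have -> : pi * (1 / 2 - (1 - y)) = - (pi * (1 / 2 - y)) by field.
congr (_ + _); rewrite -sumrN; apply: eq_bigr => k _; rewrite -mulNr; congr (_ / _).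
have -> : 2 * pi * k%:R * (1 - y) = pi *+ k *+ 2 - 2 * pi * k%:R * y.
  by rewrite -[pi *+ k]mulr_natr; ring.
have c1 : cos (pi *+ k *+ 2) = 1 :> R.
  by rewrite cos_mulr2n cos2sin2 sin_natpi expr0n subr0; lra.
by rewrite sinB sin_mulr2n sin_natpi mulr0 mul0rn mul0r sub0r c1 mul1r opprK.
Qed.

(* The main term accounts for the oscillation of the tail to first order;
   integrating by parts twice bounds what is left. *)
Lemma tail_second K y : 0 < y <= 1 / 2 ->
  `|tail K y - ((2 * K + 1)%:R * sin (pi * y))^-1 * cos ((2 * K + 1)%:R * pi * y)|
    <= 2 * ((2 * K + 1)%:R * sin (pi * y)) ^- 2.
Proof.
move=> /andP[y0 y1]; have p0 := pi_gt0 R.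
set N : R := (2 * K + 1)%:R; have N0 : 0 < N by rewrite ltr0n addn1.
have Nn : N != 0 by rewrite gt_eqF.
pose S u : R := sin (pi * u); pose c u : R := cos (pi * u).
pose C u : R := cos (N * pi * u); pose Z u : R := sin (N * pi * u).
have dS (u : R) : is_derive u 1 S (pi * c u) by exact: der_sin.
have dc (u : R) : is_derive u 1 c (- (pi * S u)) by exact: der_cos.
have dC (u : R) : is_derive u 1 C (- (N * pi * Z u)) by exact: der_cos.
have dZ (u : R) : is_derive u 1 Z (N * pi * C u) by exact: der_sin.
have S0 u : y <= u <= 1 / 2 -> 0 < S u.
  by move=> /andP[yu u1]; have /= := @sinpi_ge R u; rewrite u1 andbT /S; lra.
pose W u := c u * (S u * S u)^-1.
pose dW u := - (pi * (S u ^+ 2 + 2 * c u ^+ 2) / S u ^+ 3).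
have dWP u : y <= u <= 1 / 2 -> is_derive u 1 W (dW u).
  move=> /S0 Su; have Sn : S u * S u != 0 by rewrite mulf_neq0 ?gt_eqF.
  have dV := @derV _ (fun u => S u * S u) u _ Sn (derM (dS u) (dS u)).
  have := derM (dc u) dV.
  by congr is_derive; rewrite /dW; field; rewrite gt_eqF.
(* [Q] is what remains of [tail] once the boundary terms of two integrations by parts are removed;
   up to the factor - pi, [W] is the derivative of 1/sin(pi u). *)
pose Q u := tail K u - N^-1 * (C u * (S u)^-1) - N ^- 2 * (Z u * W u).
pose dQ u := - (N ^- 2 * (Z u * dW u)).
have dQP u : y <= u <= 1 / 2 -> is_derive u 1 Q (dQ u).
  move=> uy; have Su := S0 u uy; have Sn : S u != 0 by rewrite gt_eqF.
  have := derB (derB (der_tail K u) (der_scale N^-1 (derM (dC u) (derV Sn (dS u)))))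
    (der_scale (N ^- 2) (derM (dZ u) (dWP u uy))).
  congr is_derive; have := dirichlet K u; rewrite -/N -/(S u) -/(Z u) => E.
  have -> : dtail K u = - (pi * Z u) / S u by rewrite -E mulfK.
  by clearbody N; rewrite /dQ /W; field; rewrite Sn Nn.
have c1 : c (1 / 2) = 0.
  have : pi * (1 / 2) = pi / 2 :> R by field.
  by rewrite /c => ->; exact: cos_pihalf.
have Q1 : Q (1 / 2) = 0.
  rewrite /Q /W c1 mul0r !mulr0 tail_half sub0r subr0 /C.
  have -> : N * pi * (1 / 2) = pi *+ K + pi / 2 by rewrite -[pi *+ K]mulr_natr /N natrD natrM; field.
  by rewrite cosDpihalf sin_natpi oppr0 mul0r mulr0 oppr0.
(* As |Z| <= 1 and [W] decreases, |Q'| <= - N^-2 W'; since [Q] and [W] vanish at 1/2, |Q y| <= N^-2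
   W y. *)
have mono (d : R) : d = 1 \/ d = - 1 -> d * Q y - N ^- 2 * W y <= 0.
  move=> d1; have := @der_ndecr _ (fun u => d * Q u - N ^- 2 * W u)
    (fun u => d * dQ u - N ^- 2 * dW u) _ _ y1.
  rewrite Q1 /W c1 mul0r !mulr0 subr0; apply.
    by move=> u uy; exact: (derB (der_scale d (dQP u uy)) (der_scale (N ^- 2) (dWP u uy))).
  move=> u uy; have Su := S0 u uy.
  have -> : d * dQ u - N ^- 2 * dW u = N ^- 2 * - dW u * (1 + d * Z u) by rewrite /dQ; ring.
  have Z1 : -1 <= Z u <= 1 by rewrite sin_geN1 sin_le1.
  apply: mulr_ge0; last by case: d1 => ->; lra.
  rewrite mulr_ge0 ?invr_ge0 ?exprn_ge0 ?(ltW N0) // opprK.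
  have sc : 0 <= S u ^+ 2 + 2 * c u ^+ 2.
    by have := sqr_ge0 (S u); have := sqr_ge0 (c u); lra.
  by rewrite divr_ge0 ?exprn_ge0 ?(ltW Su) // mulr_ge0 // ltW.
have yy : y <= y <= 1 / 2 by rewrite lexx.
have Sy := S0 y yy; have Sn : S y != 0 by rewrite gt_eqF.
have QW : `|Q y| <= N ^- 2 * W y.
  rewrite ler_norml; apply/andP; split.
    by have := mono (-1) (or_intror erefl); lra.
  by have := mono 1 (or_introl erefl); lra.
have V0 : 0 <= (N * S y) ^- 2 by rewrite invr_ge0 sqr_ge0.
have WE : N ^- 2 * W y = (N * S y) ^- 2 * c y by clearbody N; rewrite /W; field; rewrite Sn Nn.
have -> : tail K y - (N * S y)^-1 * C y = Q y + (N * S y) ^- 2 * (Z y * c y).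
  by rewrite /Q; clearbody N; rewrite /W; field; rewrite Sn Nn.
have -> : 2 * (N * S y) ^- 2 = (N * S y) ^- 2 * 1 + (N * S y) ^- 2 * 1 by ring.
rewrite (le_trans (ler_normD _ _)) // lerD //.
  by rewrite (le_trans QW) // WE ler_wpM2l // cos_le1.
rewrite normrM (ger0_norm V0) ler_wpM2l // normrM.
by rewrite mulr_ile1 // ?sin_max ?cos_max.
Qed.

Lemma scaled_sin_ge K y d : 0 <= d <= y -> y <= 1 / 2 ->
  K%:R * d <= (2 * K + 1)%:R * sin (pi * y).
Proof.
move=> /andP[d0 dy] y1; have := @sinpi_ge R y; rewrite y1 (le_trans d0 dy) => /(_ isT) Sy.
have K0 : 0 <= K%:R :> R by [].
rewrite natrD natrM; set s := sin _ in Sy *; set k := K%:R in K0 *.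
have : k * d <= k * y by rewrite ler_wpM2l.
have : k * (y / 2) <= k * s by rewrite ler_wpM2l.
by lra.
Qed.

Lemma tail_decay K y d : 0 <= d <= y -> y <= 1 / 2 -> 1 <= K%:R * d ->
  `|tail K y| <= 3 / (K%:R * d).
Proof.
move=> /[dup] ddy /andP[d0 dy] y1 Kd; have := scaled_sin_ge K ddy y1.
have y0 : 0 < y.
  rewrite lt_neqAle (le_trans d0 dy) andbT; apply/eqP => E.
  move: Kd; have -> : d = 0 by apply/eqP; rewrite eq_le d0 E dy.
  by rewrite mulr0 ler10.
have := @tail_second K y; rewrite y0 y1 => /(_ isT).
set X := _%:R * sin _; set C := cos _; move: Kd; move: (K%:R * d) => x x1 T xX.
have X1 : X^-1 <= x^-1 by rewrite lef_pV2 ?posrE //; lra.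
have x1' : x^-1 <= 1 by rewrite invf_le1; lra.
have X0 : 0 <= X^-1 by rewrite invr_ge0; lra.
have CX : `|X^-1 * C| <= X^-1 by rewrite normrM (ger0_norm X0) ler_piMr // cos_max.
have -> : tail K y = (tail K y - X^-1 * C) + X^-1 * C by rewrite subrK.
rewrite (le_trans (ler_normD _ _)) //.
move: T; rewrite -exprVn; move: (X^-1) X0 X1 CX => u u0 ux h1 h2.
have : u ^+ 2 <= u by rewrite expr2 ler_piMl //; lra.
lra.
Qed.

Lemma tail_trivial K y : 0 <= y <= 1 / 2 -> `|tail K y| <= 2 + 8 * (K%:R * y).
Proof.
move=> /andP[y0 y1]; have p0 := pi_gt0 R.
have p4 : pi <= 4 :> R by have := pihalf_lt2 R; lra.
rewrite (le_trans (ler_normB _ _)) // lerD //.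
  have -> : `|pi * (1 / 2 - y)| = pi * (1 / 2 - y).
    by rewrite ger0_norm // mulr_ge0 ?subr_ge0 // ltW.
  nra.
rewrite (le_trans (ler_norm_sum _ _ _)) //.
rewrite (@le_trans _ _ (\sum_(1 <= k < K.+1) 8 * y)) //; last first.
  rewrite sumr_const_nat subn1 /= -mulr_natl; set a := K%:R; lra.
apply: ler_sum_nat => k /andP[k0 _].
have kr : 0 < k%:R :> R by rewrite ltr0n.
rewrite normrM normfV (gtr0_norm kr) ler_pdivrMr //.
have x0 : 0 <= 2 * pi * k%:R * y by rewrite !mulr_ge0 // ltW.
apply: (le_trans (sin_abs x0)).
have : pi * (k%:R * y) <= 4 * (k%:R * y) by rewrite ler_wpM2r // mulr_ge0 // ltW.
lra.
Qed.

(** By symmetry y <= 1/2. The constant is 2 + 8 from [tail_trivial] when K y <= 1; beyond,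
    [tail_decay] gives 3. *)
Lemma tail_le K y : 0 <= y <= 1 -> `|tail K y| <= 10.
Proof.
move=> /andP[y0 y1].
wlog y2 : y y0 y1 / y <= 1 / 2.
  move=> W; case: (lerP y (1 / 2)) => y2; first exact: W.
  by rewrite -normrN -tail_sym; apply: W; lra.
case: (lerP (K%:R * y) 1) => Ky.
  by apply: (le_trans (tail_trivial _ _)); rewrite ?y0 //; lra.
apply: (le_trans (@tail_decay K y y _ y2 (ltW Ky))); first by rewrite y0 lexx.
by rewrite ler_pdivrMr; lra.
Qed.

(** The constant 10 makes the bound hold also for K d < 1, by [tail_le]. *)
Lemma tail_decay_sym K y d : (0 < K)%N -> 0 < d -> d <= y -> d <= 1 - y ->
  `|tail K y| <= 10 / (K%:R * d).
Proof.
move=> K0 d0; wlog y2 : y / y <= 1 / 2.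
  move=> W; case: (lerP y (1 / 2)) => y2; first exact: W.
  by move=> dy dy'; rewrite -normrN -tail_sym; apply: W; lra.
move=> dy dy'; have Kr : 0 < K%:R :> R by rewrite ltr0n.
have Kd := mulr_gt0 Kr d0; case: (lerP 1 (K%:R * d)) => h.
  apply: (le_trans (@tail_decay K y d _ y2 h)); first by rewrite ltW.
  by rewrite ler_pM2r ?invr_gt0 //; lra.
apply: (le_trans (@tail_le K y _)); first by apply/andP; split; lra.
by rewrite ler_pdivlMr //; lra.
Qed.

End FourierTail.

(** * Counting angles in short intervals *)

Section Blocks.
Variable R : realType.
Implicit Types (x y t b theta delta M B : R).

Definition in_block b delta x : R := (b <= x <= b + delta)%R%:R.

Lemma sawtoothE x : sawtooth x = 1 / 2 - x + (Num.floor x)%:~R.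
Proof. by rewrite /sawtooth /fracpart opprB addrA addrAC. Qed.

Lemma floor_lt_of x (z : int) y : x = y + z%:~R -> y < 0 -> Num.floor x < z.
Proof.
move=> -> y0; rewrite -[_ < z](ltr_int R); apply: le_lt_trans (floor_le _) _.
by rewrite gtrDr.
Qed.

(** The shift is 2 delta rather than delta so that the jump is strictly crossed even from the closed
    right end of the block. *)
Lemma sawtooth_jump x b delta : 0 < delta ->
  sawtooth (x - b - 2 * delta) - sawtooth (x - b) <=
    2 * delta - in_block b delta (fracpart x).
Proof.
move=> d0; rewrite !sawtoothE.
set f1 := Num.floor (x - b - 2 * delta); set f2 := Num.floor (x - b).
suff : f1%:~R + in_block b delta (fracpart x) <= f2%:~R :> R by lra.
rewrite /in_block; case: (boolP (_ <= _ <= _)) => [/andP[bx xb]|_]; last first.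
  rewrite addr0 ler_int; apply: le_floor; lra.
have xE : x = fracpart x + (Num.floor x)%:~R by rewrite subrK.
have f2z : Num.floor x <= f2 by rewrite floor_ge_int {2}xE; lra.
have f1z : f1 < Num.floor x.
  apply: (@floor_lt_of _ _ (fracpart x - b - 2 * delta)); last lra.
  by rewrite {1}xE; ring.
have : f1 + 1 <= f2 by rewrite lezD1 (lt_le_trans f1z).
by rewrite -(ler_int R) intrD.
Qed.

Variable ts : seq R.
Local Notation N := (size ts)%:R.

(* Moving back by 2 * delta raises each sawtooth by 2 * delta, minus one when
   its jump is crossed. *)
Lemma block_sawsum M b delta theta : (forall x, `|sawsum ts x| <= M) -> 0 < delta ->
  \sum_(t <- ts) in_block b delta (fracpart (theta - t)) <= 2 * M + 2 * N * delta.
Proof.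
move=> HM d0.
have : sawsum ts (theta - b - 2 * delta) - sawsum ts (theta - b) <=
    \sum_(t <- ts) (2 * delta - in_block b delta (fracpart (theta - t))).
  rewrite -sumrB; apply: ler_sum => t _.
  have -> : theta - b - 2 * delta - t = theta - t - b - 2 * delta by ring.
  have -> : theta - b - t = theta - t - b by ring.
  exact: sawtooth_jump.
rewrite sumrB big_const_seq count_predT iter_addr addr0 -[_ *+ size ts]mulr_natl.
have := HM (theta - b - 2 * delta); have := HM (theta - b).
rewrite !ler_norml => /andP[_ h1] /andP[h2 _].
set n : R := N; set S := \sum_(_ <- _) _; lra.
Qed.

(** Seen from one of the angles, the block at 0 contains at least that angle; the length 1/(4N)
    leaves 1 <= 2M + 1/2. So an arbitrary bound [M] is bounded away from 0. *)
Lemma sawsum_max_ge M : (forall x, `|sawsum ts x| <= M) -> (0 < size ts)%N -> 1 / 4 <= M.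
Proof.
move=> HM; case E: ts => [//|t0 s] _.
have n0 : 0 < N :> R by rewrite ltr0n E.
have := @block_sawsum M 0 (4 * N)^-1 t0 HM; rewrite invr_gt0 mulr_gt0 // => /(_ isT).
have -> : 2 * N * (4 * N)^-1 = 1 / 2 :> R by field; rewrite gt_eqF.
suff : (1 : R) <= \sum_(t <- ts) in_block 0 (4 * N)^-1 (fracpart (t0 - t)) by lra.
rewrite E big_cons -E subrr (_ : fracpart 0 = 0); last by rewrite fracpart_id // lexx ltr01.
have -> : in_block 0 (4 * N)^-1 0 = 1.
  by rewrite /in_block lexx add0r invr_ge0 mulr_ge0 // ltW.
by rewrite lerDl sumr_ge0 // => t _; rewrite ler0n.
Qed.

Lemma sawsum_fracpart theta : sawsum ts (fracpart theta) = sawsum ts theta.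
Proof.
apply: eq_bigr => t _; rewrite /sawtooth; congr (_ - _).
have -> : fracpart theta - t = theta - t + (- Num.floor theta)%:~R.
  by rewrite /fracpart intrN; ring.
by rewrite fracpartDz.
Qed.

Lemma gap theta : exists2 eta : R, 0 < eta & {in ts, forall t, fracpart (theta - t) + eta < 1}.
Proof.
elim: ts => [|t s [eta e0 He]]; first by exists 1.
have x1 := fracpart_lt1 (theta - t).
exists (Num.min eta ((1 - fracpart (theta - t)) / 2)).
  by rewrite lt_min e0 divr_gt0 // subr_gt0.
move=> u; rewrite inE => /orP[/eqP ->|/He ue].
  have : Num.min eta ((1 - fracpart (theta - t)) / 2) <= (1 - fracpart (theta - t)) / 2.
    by rewrite ge_min lexx orbT.
  lra.
have : Num.min eta ((1 - fracpart (theta - t)) / 2) <= eta by rewrite ge_min lexx.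
lra.
Qed.

(* A point just to the right of theta is regular, and sawsum is right-continuous. *)
Lemma sawsum_bound M :
  (forall theta, 0 <= theta <= 1 -> regular ts theta -> `|sawsum ts theta| <= M) ->
  forall theta, `|sawsum ts theta| <= M.
Proof.
move=> HM theta; rewrite -sawsum_fracpart; set th := fracpart theta.
have [th0 th1] : 0 <= th /\ th < 1 by rewrite fracpart_ge0 fracpart_lt1.
apply/ler_addgt0Pr => e e0.
have [eta0 eta00 Heta] := gap th.
pose n1 : R := N + 1; have n10 : 0 < n1 by rewrite ltr_wpDl.
pose eta := Num.min eta0 (Num.min (1 - th) (e / n1)).
have eta_gt0 : 0 < eta by rewrite !lt_min eta00 subr_gt0 th1 divr_gt0.
have [le1 le2 le3] : [/\ eta <= eta0, eta <= 1 - th & eta <= e / n1].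
  by split; rewrite /eta !ge_min lexx ?orbT.
have fE t : t \in ts -> fracpart (th + eta - t) = fracpart (th - t) + eta.
  move=> /Heta te; set y := fracpart _ in te *; have y0 : 0 <= y := fracpart_ge0 _.
  have -> : th + eta - t = y + eta + (Num.floor (th - t))%:~R by rewrite /y /fracpart; ring.
  by rewrite fracpartDz fracpart_id //; lra.
have reg : regular ts (th + eta).
  by move=> t /fE ->; have := fracpart_ge0 (th - t); apply: contraTneq => h; lra.
have := HM (th + eta) _ reg.
have -> : sawsum ts (th + eta) = sawsum ts th - N * eta.
  rewrite /sawsum -[N * eta]/(_ : R) mulr_natl -[_ *+ _]addr0 -iter_addr.
  rewrite -[X in iter X](count_predT ts) -big_const_seq -sumrB.
  by apply: eq_big_seq => t /fE tE; rewrite /sawtooth tE opprD addrA.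
have ne : N * eta <= e.
  have : n1 * eta <= e by rewrite mulrC -ler_pdivlMr.
  by rewrite /n1 mulrDl; lra.
have ne0 : 0 <= N * eta by rewrite mulr_ge0 // ltW.
move=> /(_ _); rewrite !ler_norml; set S := sawsum ts th; set u := N * eta in ne ne0 *.
by move=> H; have /andP[] := H ltac:(lra); lra.
Qed.

End Blocks.

Section BlockSum.
Variable R : realType.

(** Sort the points by m, the integer part of their distance to the nearer end of [0, 1] divided by
    delta. Each m corresponds to two blocks, one near either end, whence the factor 2; the condition
    on [Mb] covers all distances up to 1/2. *)
Lemma block_sum (ys : seq R) (w : R -> R) (omega : nat -> R) (delta B : R) Mb :
  0 < delta -> 1 / 2 < Mb%:R * delta ->
  (forall y, y \in ys -> 0 <= y <= 1) ->
  (forall b, \sum_(y <- ys) in_block b delta y <= B) ->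
  (forall m, 0 <= omega m) ->
  (forall m y, y \in ys -> m%:R * delta <= y -> m%:R * delta <= 1 - y -> w y <= omega m) ->
  \sum_(y <- ys) w y <= 2 * B * \sum_(m < Mb) omega m.
Proof.
move=> d0 Mbd ys01 HB om0 wom.
pose I1 (m : nat) y : R := in_block (m%:R * delta) delta y.
pose I2 (m : nat) y : R := in_block (1 - m%:R * delta - delta) delta y.
apply: (@le_trans _ _ (\sum_(y <- ys) \sum_(m < Mb) omega m * (I1 m y + I2 m y))); last first.
  rewrite exchange_big mulrC big_distrl /=; apply: ler_sum => m _.
  rewrite -big_distrr /= ler_wpM2l // big_split /=.
  have -> : 2 * B = B + B by ring.
  by apply: lerD; apply: HB.
rewrite !big_seq; apply: ler_sum => y yys; have /andP[y0 y1] := ys01 y yys.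
have I0 m : 0 <= I1 m y + I2 m y by rewrite addr_ge0.
pose d := Num.min y (1 - y).
have d00 : 0 <= d by rewrite le_min y0 subr_ge0.
have dy : d <= y by rewrite ge_min lexx.
have dy' : d <= 1 - y by rewrite ge_min lexx orbT.
have [m m1 m2] : exists2 m, m%:R * delta <= d & d < m.+1%:R * delta.
  have := @truncn_itv R (d / delta); rewrite divr_ge0 ?(ltW d0) // => /(_ isT) /andP[h1 h2].
  by exists (Num.truncn (d / delta)); rewrite -?ler_pdivlMr -?ltr_pdivrMr.
have mMb : (m < Mb)%N.
  have : m%:R * delta < Mb%:R * delta by lra.
  by rewrite ltr_pM2r // ltr_nat.
have I1m : 1 <= I1 m y + I2 m y.
  have : d = y \/ d = 1 - y by rewrite /d /Num.min; case: ifP => _; [left|right].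
  move: m1 m2; rewrite -natr1 mulrDl mul1r => m1 m2 [dE|dE].
    have -> : I1 m y = 1 by rewrite /I1 /in_block; case: andP => // -[]; split; lra.
    by rewrite lerDl.
  have -> : I2 m y = 1 by rewrite /I2 /in_block; case: andP => // -[]; split; lra.
  by rewrite lerDr.
rewrite (bigD1 (Ordinal mMb)) //= -[w y]addr0 lerD //; last first.
  by apply: sumr_ge0 => i _; rewrite mulr_ge0.
apply: (le_trans (wom m y yys _ _)); rewrite ?(le_trans m1) //.
by rewrite -[leLHS]mulr1 ler_wpM2l.
Qed.

Lemma harmonic_le n : (0 < n)%N -> \sum_(1 <= k < n.+1) k%:R^-1 <= 1 + ln n%:R :> R.
Proof.
case: n => // n _; elim: n => [|n IHn]; first by rewrite big_nat1 invr1 ln1 addr0.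
rewrite big_nat_recr //=.
have n0 : 0 < n.+2%:R :> R by [].
have := @le_ln1Dx R (- n.+2%:R^-1).
have -> : 1 - n.+2%:R^-1 = n.+1%:R / n.+2%:R :> R.
  have -> : n.+2%:R = n.+1%:R + 1 :> R by rewrite natr1.
  have : 0 < n.+1%:R :> R by [].
  by move: (n.+1%:R) => a a0; field; rewrite gt_eqF // ltr_wpDl // ltW.
rewrite ln_div ?posrE // => /(_ _); rewrite ltrN2 invf_lt1 // ltr1n => /(_ isT).
move: IHn; move: (\sum_(1 <= k < n.+2) _) (ln n.+1%:R) (ln n.+2%:R) (n.+2%:R^-1 : R).
by move=> a b c d; lra.
Qed.

End BlockSum.

(** * Partial sums bounded by the sawtooth sum *)

Section Truncated.
Variable R : realType.
Implicit Types (x y t theta M c : R) (ts : seq R) (K : nat).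

Lemma sin_fracpart k x : sin (2 * pi * (k%:R * x)) = sin (2 * pi * k%:R * fracpart x).
Proof.
have : e_ (k%:R * x) = e_ (k%:R * fracpart x) by rewrite -!e_X e_fracpart.
by case=> _ ->; rewrite mulrA.
Qed.

Lemma truncated_sumE ts K theta :
  \sum_(t <- ts) \sum_(1 <= k < K.+1) sin (2 * pi * (k%:R * (theta - t))) / (pi * k%:R) =
  sawsum ts theta - pi^-1 * \sum_(t <- ts) tail K (fracpart (theta - t)).
Proof.
have p0 := pi_gt0 R; rewrite /sawsum big_distrr -sumrB; apply: eq_bigr => t _.
rewrite /= /tail mulrBr mulKf ?gt_eqF // opprB addrCA subrr addr0 big_distrr.
by apply: eq_bigr => k _; rewrite sin_fracpart invfM mulrCA.
Qed.

(** The choice delta = M/N balances the block count 2M + 2N delta = 4M. The weights are 10 for m = 0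
    and 10/(K delta m) after; their harmonic sum is at most 1 + ln(2N), absorbed by the hypothesis
    on K. As M >= 1/4, 2N + 1 blocks suffice. *)
Lemma tail_sum_bound ts M K c theta :
  (forall x, `|sawsum ts x| <= M) -> (0 < size ts)%N -> (0 < K)%N ->
  1 + ln (2 * size ts)%:R <= c * (K%:R * (M / (size ts)%:R)) ->
  `|\sum_(t <- ts) tail K (fracpart (theta - t))| <= 8 * M * (10 + 10 * c).
Proof.
move=> HM s0 K0 Hc; set N := (size ts)%:R : R; set delta := M / N.
have N0 : 0 < N by rewrite ltr0n.
have M4 := sawsum_max_ge HM s0.
have d0 : 0 < delta by rewrite divr_gt0 //; lra.
have Kr : 0 < K%:R :> R by rewrite ltr0n.
rewrite (le_trans (ler_norm_sum _ _ _)) //.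
pose omega (m : nat) : R := if m is m'.+1 then 10 / (K%:R * delta) * m%:R^-1 else 10.
have om0 m : 0 <= omega m.
  by case: m => // m; rewrite mulr_ge0 ?invr_ge0 // divr_ge0 // mulr_ge0 // ltW.
have := @block_sum R [seq fracpart (theta - t) | t <- ts] (fun y => `|tail K y|) omega delta
  (4 * M) (2 * size ts).+1 d0.
rewrite big_map => H; apply: (le_trans (H _ _ _ om0 _)).
- have -> : (2 * size ts).+1%:R * delta = 2 * M + delta.
    by rewrite -natr1 natrM mulrDl mul1r -mulrA [_ * delta]mulrC divfK ?gt_eqF.
  by lra.
- move=> y /mapP[t _ ->]; rewrite fracpart_ge0 ltW //; exact: fracpart_lt1.
- move=> b; rewrite big_map; apply: (le_trans (block_sawsum _ _ HM d0)).
  by rewrite -/N -mulrA [N * _]mulrC divfK ?gt_eqF //; lra.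
- move=> [|m] y /mapP[t _ ->] yd yd'.
    by apply: tail_le; rewrite fracpart_ge0 ltW //; exact: fracpart_lt1.
  rewrite /omega -mulrA -invfM -[K%:R * delta * _]mulrA [delta * _]mulrC.
  by apply: tail_decay_sym => //; rewrite mulr_gt0.
have -> : 8 * M * (10 + 10 * c) = 2 * (4 * M) * (10 + 10 * c) by ring.
apply: ler_wpM2l; first lra.
rewrite big_ord_recl lerD2l.
have -> : \sum_(i < 2 * size ts) omega (lift ord0 i) =
    10 / (K%:R * delta) * \sum_(1 <= k < (2 * size ts).+1) k%:R^-1.
  by rewrite big_add1 big_mkord big_distrr; apply: eq_bigr.
have Kd : 0 < K%:R * delta by rewrite mulr_gt0.
rewrite mulrAC ler_pdivrMr // -mulrA ler_pM2l //.
by apply: (le_trans (harmonic_le _ _)); rewrite ?muln_gt0.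
Qed.

Lemma ln4_le (g : nat) : (4 <= g)%N -> 1 <= ln g%:R :> R /\ ln (4 * g)%:R <= 2 * ln g%:R :> R.
Proof.
move=> g4; have g0 : 0 < g%:R :> R by rewrite ltr0n; lia.
have l4 : ln 4%:R <= ln g%:R :> R by rewrite ler_ln ?posrE // ler_nat.
have l1 : 1 <= ln 4%:R :> R.
  have -> : 4%:R = 2 * 2 :> R by ring.
  have := @le_ln1Dx R (- (1 / 2)); rewrite lnM ?posrE //.
  have -> : 1 - 1 / 2 = 2^-1 :> R by field.
  rewrite lnV ?posrE // => /(_ ltac:(lra)); set l := ln _; lra.
split; first exact: le_trans l4.
by rewrite natrM lnM ?posrE //; move: (ln 4%:R) (ln g%:R) l4 => a b ab; lra.
Qed.

Lemma truncated_sum_bound ts g K M theta :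
  (forall theta, 0 <= theta <= 1 -> regular ts theta -> `|sawsum ts theta| <= M) ->
  size ts = (2 * g)%N -> (4 <= g)%N -> g%:R * ln g%:R <= K%:R * M ->
  `|\sum_(t <- ts) \sum_(1 <= k < K.+1) sin (2 * pi * (k%:R * (theta - t))) / (pi * k%:R)|
    <= 561 * M.
Proof.
move=> /sawsum_bound HM sz g4 HK; have p2 := pi_ge2 R.
have [l1 l4] := ln4_le g4.
have g0 : 0 < g%:R :> R by rewrite ltr0n; lia.
have s0 : (0 < size ts)%N by rewrite sz; lia.
have M4 := sawsum_max_ge HM s0.
have K0 : (0 < K)%N.
  case: K HK => //; rewrite mul0r leNgt mulr_gt0 //; lra.
(* With N = 2g, K M / N >= (ln g)/2 while 1 + ln(4g) <= 3 ln g, so c = 6. Then 561 = 1 + 8 (10 +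
   60), the 1 accounting for the sawtooth sum. *)
have := @tail_sum_bound ts M K 6 theta HM s0 K0.
rewrite sz mulnA => H; have {}H := H _.
have /H : 1 + ln (2 * 2 * g)%:R <= 6 * (K%:R * (M / (2 * g)%:R)) :> R.
  have -> : 6 * (K%:R * (M / (2 * g)%:R)) = 3 * (K%:R * M / g%:R) :> R.
    by rewrite natrM; field; rewrite gt_eqF.
  have : ln g%:R <= K%:R * M / g%:R by rewrite ler_pdivlMr // mulrC.
  move: (ln g%:R) (K%:R * M / g%:R) (ln (4 * g)%:R) l1 l4 => a b c *.
  by rewrite -/c; lra.
rewrite truncated_sumE; set T := \sum_(_ <- _) _ => HT.
rewrite (le_trans (ler_normB _ _)) //; have := HM theta.
have : `|pi^-1 * T| <= `|T|.
  have pv : 0 <= pi^-1 :> R by rewrite invr_ge0; lra.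
  rewrite normrM (ger0_norm pv) ler_piMl // invf_le1; lra.
by move: `|T| HT `|pi^-1 * T| `|sawsum ts theta| => a *; lra.
Qed.

End Truncated.

(** * Smoothed tails *)

Section Averages.
Variable R : realType.
Implicit Types (x y t theta d A c : R) (ts : seq R).

Lemma sum_const_ord n c : \sum_(i < n) c = n%:R * c.
Proof. by rewrite sumr_const card_ord mulr_natl. Qed.

Lemma abel_bound (a b : nat -> R) (beta : R) n : (forall i, a i.+1 <= a i) ->
  (forall i, 0 <= a i) ->
  (forall m, `|\sum_(i < m) b i| <= beta) -> `|\sum_(i < n) a i * b i| <= a 0%N * beta.
Proof.
move=> aS a0 Hb; have claim m :
    `|\sum_(i < m) a i * b i - a m * \sum_(i < m) b i| <= (a 0%N - a m) * beta.
  elim: m => [|m IHm]; first by rewrite !big_ord0 mulr0 !subrr normr0 mul0r.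
  have -> : (a 0%N - a m.+1) * beta = (a 0%N - a m) * beta + (a m - a m.+1) * beta by ring.
  have -> : \sum_(i < m.+1) a i * b i - a m.+1 * \sum_(i < m.+1) b i =
      (\sum_(i < m) a i * b i - a m * \sum_(i < m) b i) + (a m - a m.+1) * \sum_(i < m.+1) b i.
    by rewrite !big_ord_recr /=; ring.
  rewrite (le_trans (ler_normD _ _)) // lerD // normrM ger0_norm ?subr_ge0 //.
  by rewrite ler_wpM2l // subr_ge0.
have -> : \sum_(i < n) a i * b i = (\sum_(i < n) a i * b i - a n * \sum_(i < n) b i) +
    a n * \sum_(i < n) b i by rewrite subrK.
have -> : a 0%N * beta = (a 0%N - a n) * beta + a n * beta by ring.
by rewrite (le_trans (ler_normD _ _)) // lerD // normrM ger0_norm // ler_wpM2l.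
Qed.

(** Multiplication by 2 sin(pi y) makes the sum telescope. *)
Lemma cos_odd_sum n m y : 0 < sin (pi * y) ->
  `|\sum_(i < m) cos ((2 * (n + i) + 1)%:R * pi * y)| <= (sin (pi * y))^-1.
Proof.
set S := sin (pi * y) => S0.
have E : 2 * S * \sum_(i < m) cos ((2 * (n + i) + 1)%:R * pi * y) =
    sin ((2 * (n + m))%:R * pi * y) - sin ((2 * n)%:R * pi * y).
  elim: m => [|m IHm]; first by rewrite big_ord0 addn0 mulr0 subrr.
  rewrite big_ord_recr mulrDr IHm /=; set v := (2 * (n + m) + 1)%:R * pi * y.
  have -> : (2 * (n + m))%:R * pi * y = v - pi * y by rewrite /v natrD; ring.
  have -> : (2 * (n + m.+1))%:R * pi * y = v + pi * y by rewrite /v addnS mulnS !natrD; ring.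
  by rewrite sinB sinD /S; ring.
rewrite -[_^-1]mul1r ler_pdivlMr //.
have : `|2 * S * \sum_(i < m) cos ((2 * (n + i) + 1)%:R * pi * y)| <= 2.
  rewrite E (le_trans (ler_normB _ _)) //.
  by have := sin_max ((2 * (n + m))%:R * pi * y); have := sin_max ((2 * n)%:R * pi * y); lra.
rewrite !normrM (gtr0_norm S0) (ger0_norm (ler0n _ _)); lra.
Qed.

(* Averaging over K cancels the oscillating main term of tail_second. *)
Definition average n y : R := n%:R^-1 * \sum_(i < n) tail (n + i) y.

Lemma average_le n y : (0 < n)%N -> 0 <= y <= 1 -> `|average n y| <= 10.
Proof.
move=> n0 y01; have nr : 0 < n%:R :> R by rewrite ltr0n.
rewrite normrM gtr0_norm ?invr_gt0 // mulrC ler_pdivrMr //.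
rewrite (le_trans (ler_norm_sum _ _ _)) //.
rewrite (@le_trans _ _ (\sum_(i < n) 10)) //; first by apply: ler_sum => i _; apply: tail_le.
by rewrite sum_const_ord mulrC.
Qed.

(** By symmetry y <= 1/2, so S = sin(pi y) >= d/2. The remainders in [tail_second], and the averaged
    main terms by Abel summation, each contribute at most 1/(2 n^2 S^2). *)
Lemma average_decay n y d : (0 < n)%N -> 0 < d -> d <= y -> d <= 1 - y ->
  `|average n y| <= 4 * (n%:R * d) ^- 2.
Proof.
move=> n0 d0; wlog y2 : y / y <= 1 / 2.
  move=> W; case: (lerP y (1 / 2)) => y2; first exact: W.
  move=> dy dy'; suff -> : average n y = - average n (1 - y) by rewrite normrN; apply: W; lra.
  by rewrite /average -mulrN -sumrN; congr (_ * _); apply: eq_bigr => i _; rewrite tail_sym opprK.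
move=> dy dy'; have nr : 0 < n%:R :> R by rewrite ltr0n.
have y0 : 0 < y by lra.
have Sy : d / 2 <= sin (pi * y) by have := @sinpi_ge R y; rewrite y2 ltW // => /(_ isT); lra.
have := @cos_odd_sum n ^~ y; have := @tail_second R ^~ y; rewrite y0 y2.
set S := sin (pi * y) in Sy *; have S0 : 0 < S by lra.
move=> T /(_ _ S0) C.
pose a i : R := (2 * (n + i) + 1)%:R^-1.
pose b i : R := cos ((2 * (n + i) + 1)%:R * pi * y).
have a0 i : 0 <= a i by rewrite invr_ge0.
have an i : a i <= (2 * n%:R)^-1.
  by rewrite lef_pV2 ?posrE ?mulr_gt0 // ?ltr0n ?addn1 // -natrM ler_nat; lia.
have aS i : a i.+1 <= a i by rewrite lef_pV2 ?posrE ?ltr0n ?addn1 // ler_nat; lia.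
have main : `|\sum_(i < n) a i * b i| <= a 0%N * S^-1 by exact: abel_bound.
have rest i : `|tail (n + i) y - S^-1 * (a i * b i)| <= (2 * n%:R ^+ 2 * S ^+ 2)^-1.
  have -> : S^-1 * (a i * b i) = ((2 * (n + i) + 1)%:R * S)^-1 * b i by rewrite invfM mulrA [S^-1 * _]mulrC.
  apply: (le_trans (T (n + i)%N isT)); rewrite exprMn invfM -exprVn -/(a i).
  have -> : (2 * n%:R ^+ 2 * S ^+ 2)^-1 = 2 * ((2 * n%:R)^-1 ^+ 2 * S ^- 2) :> R.
    by field; rewrite !gt_eqF.
  rewrite ler_pM2l // ler_pM2r ?invr_gt0 ?exprn_gt0 //.
  by rewrite lerXn2r ?nnegrE // invr_ge0 mulr_ge0.
rewrite normrM gtr0_norm ?invr_gt0 // mulrC ler_pdivrMr //.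
have -> : \sum_(i < n) tail (n + i) y =
    \sum_(i < n) (tail (n + i) y - S^-1 * (a i * b i)) + S^-1 * \sum_(i < n) a i * b i.
  by rewrite big_distrr -big_split; apply: eq_bigr => i _ /=; rewrite subrK.
apply: (@le_trans _ _ ((n%:R * S ^+ 2)^-1)); last first.
  have -> : 4 * (n%:R * d) ^- 2 * n%:R = (n%:R * (d / 2) ^+ 2)^-1 :> R.
    by field; rewrite !gt_eqF.
  rewrite lef_pV2 ?posrE ?mulr_gt0 ?exprn_gt0 // ?divr_gt0 // ler_pM2l //.
  by rewrite lerXn2r ?nnegrE ?(ltW S0) // divr_ge0 // ltW.
have -> : (n%:R * S ^+ 2)^-1 = n%:R * (2 * n%:R ^+ 2 * S ^+ 2)^-1 + S^-1 * ((2 * n%:R)^-1 * S^-1) :> R.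
  by field; rewrite !gt_eqF.
rewrite (le_trans (ler_normD _ _)) // lerD //.
  rewrite (le_trans (ler_norm_sum _ _ _)) //.
  rewrite (@le_trans _ _ (\sum_(i < n) (2 * n%:R ^+ 2 * S ^+ 2)^-1)) //.
    by apply: ler_sum => i _; exact: rest.
  by rewrite sum_const_ord.
rewrite normrM gtr0_norm ?invr_gt0 // ler_pM2l ?invr_gt0 //.
by rewrite (le_trans main) // ler_pM2r ?invr_gt0.
Qed.

(** Uses a geometric sum of n terms centred at the middle of the block: for length 1/(8n) its phases
    stay within pi/8 on the block, so its real part is at least n/2. In the expanded squares, each
    of the n diagonal terms gives N and every other term at most A. *)
Lemma block_fejer ts n A b theta : (0 < n)%N ->
  (forall k x, (0 < k < n)%N -> `|\sum_(t <- ts) cos (2 * pi * (k%:R * (x - t)))| <= A) ->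
  0 <= A ->
  \sum_(t <- ts) in_block b (8 * n%:R)^-1 (fracpart (theta - t)) <=
    4 * ((size ts)%:R / n%:R + A).
Proof.
move=> n0 HA A0; have nr : 0 < n%:R :> R by rewrite ltr0n.
have p0 := pi_gt0 R.
set h : R := (8 * n%:R)^-1; have h0 : 0 < h by rewrite invr_gt0 mulr_gt0.
(* The squared modulus D t of the geometric sum is at least n ^+ 2 / 4 on the block. *)
pose x t := theta - b - h / 2 - t.
pose C t k := cos (2 * pi * (k%:R * x t)); pose S t k := sin (2 * pi * (k%:R * x t)).
pose D t := (\sum_(k < n) C t k) ^+ 2 + (\sum_(k < n) S t k) ^+ 2.
have DE t : D t = \sum_(k < n) \sum_(l < n) cos (2 * pi * (k%:R * x t) - 2 * pi * (l%:R * x t)).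
  rewrite /D !expr2 !big_distrl -big_split; apply: eq_bigr => k _ /=.
  rewrite !big_distrr -big_split; apply: eq_bigr => l _ /=.
  by rewrite cosB.
have D0 t : 0 <= D t by rewrite addr_ge0 // sqr_ge0.
have sumD : \sum_(t <- ts) D t <= n%:R * (size ts)%:R + n%:R ^+ 2 * A.
  under eq_bigr do rewrite DE.
  rewrite exchange_big /=.
  under eq_bigr do rewrite exchange_big.
  have kl (k l : 'I_n) : \sum_(t <- ts) cos (2 * pi * (k%:R * x t) - 2 * pi * (l%:R * x t)) <=
      (k == l)%:R * (size ts)%:R + A.
    wlog kl : k l / (l <= k)%N.
      move=> W; case/orP: (leq_total l k) => h1; first exact: W.
      rewrite eq_sym; apply: le_trans (W _ _ h1).
      by apply: ler_sum => t _; rewrite -cosN opprB.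
    have E t : cos (2 * pi * (k%:R * x t) - 2 * pi * (l%:R * x t)) =
        cos (2 * pi * ((k - l)%:R * x t)) by congr cos; rewrite natrB //; ring.
    under eq_bigr do rewrite E.
    move: kl; rewrite leq_eqVlt => /orP[/eqP kl|kl].
      have {}kl : k = l by apply: val_inj; rewrite /= kl.
      rewrite kl eqxx mul1r subnn -[X in X <= _]addr0 lerD //.
      under eq_bigr do rewrite mul0r mulr0 cos0.
      by rewrite big_const_seq count_predT iter_addr addr0.
    have -> : (k == l) = false by apply/negbTE; apply/eqP => e; rewrite e ltnn in kl.
    rewrite mul0r add0r; apply: (le_trans (ler_norm _)); apply: HA.
    by rewrite subn_gt0 kl (leq_ltn_trans (leq_subr _ _)).
  apply: (@le_trans _ _ (\sum_(k < n) \sum_(l < n) ((k == l)%:R * (size ts)%:R + A))).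
    by apply: ler_sum => k _; apply: ler_sum => l _; exact: kl.
  have E (k : 'I_n) : \sum_(l < n) ((k == l)%:R * (size ts)%:R + A) = (size ts)%:R + n%:R * A.
    rewrite big_split /= sum_const_ord; congr (_ + _).
    rewrite (bigD1 k) //= eqxx mul1r big1 ?addr0 // => l lk.
    by rewrite eq_sym (negbTE lk) mul0r.
  under eq_bigr do rewrite E.
  by rewrite sum_const_ord mulrDr mulrA expr2.
have low t : in_block b h (fracpart (theta - t)) <= 4 / n%:R ^+ 2 * D t.
  rewrite /in_block; case: (boolP (_ <= _ <= _)) => [/andP[b1 b2]|_]; last first.
    by rewrite mulr_ge0 // divr_ge0 // exprn_ge0.
  pose u := fracpart (theta - t) - b - h / 2.
  have uh : `|u| <= h / 2 by rewrite ler_norml /u; apply/andP; split; lra.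
  have Ck (k : 'I_n) : 1 / 2 <= C t k.
    have -> : C t k = cos (2 * pi * (k%:R * u)).
      have xu : x t = u + (Num.floor (theta - t))%:~R by rewrite /x /u /fracpart; ring.
      have : e_ (k%:R * x t) = e_ (k%:R * u) by rewrite -!e_X xu e_D e_int mulr1.
      by case=> + _; rewrite /C.
    apply: cos_ge_half.
    have kn : k%:R * `|u| <= n%:R * (h / 2) by rewrite ler_pM // ler_nat ltnW.
    rewrite !normrM (gtr0_norm p0) !normr_nat.
    have hE : n%:R * (h / 2) = 1 / 16 by rewrite /h; field; rewrite gt_eqF.
    rewrite hE in kn; have : 2 * pi * (k%:R * `|u|) <= 2 * pi * (1 / 16) by rewrite ler_pM2l // mulr_gt0.
    by lra.
  have sC : n%:R / 2 <= \sum_(k < n) C t k.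
    apply: (@le_trans _ _ (\sum_(k < n) 1 / 2)); last by apply: ler_sum => k _; exact: Ck.
    by rewrite sum_const_ord mul1r.
  have : n%:R ^+ 2 / 4 <= D t.
    have -> : n%:R ^+ 2 / 4 = (n%:R / 2) ^+ 2 :> R by field.
    rewrite /D -[X in X <= _]addr0 lerD ?sqr_ge0 // lerXn2r // nnegrE ?divr_ge0 //.
    by rewrite (le_trans _ sC) // divr_ge0.
  have n2 : 0 < n%:R ^+ 2 / 4 :> R by rewrite divr_gt0 // exprn_gt0.
  by rewrite -(ler_pM2l (x := (n%:R ^+ 2 / 4)^-1)) ?invr_gt0 // mulVf ?gt_eqF // invf_div.
apply: (@le_trans _ _ (\sum_(t <- ts) 4 / n%:R ^+ 2 * D t)); first by apply: ler_sum => t _; exact: low.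
rewrite -big_distrr /=.
have -> : 4 * ((size ts)%:R / n%:R + A) = 4 / n%:R ^+ 2 * (n%:R * (size ts)%:R + n%:R ^+ 2 * A) :> R.
  by field; rewrite gt_eqF.
by rewrite ler_wpM2l // divr_ge0 // exprn_ge0.
Qed.

Lemma sum_inv_sqr_le n : (0 < n)%N -> \sum_(1 <= k < n.+1) k%:R ^- 2 <= 2 - n%:R^-1 :> R.
Proof.
case: n => // n _; elim: n => [|n IHn]; first by rewrite big_nat1 expr1n invr1; lra.
rewrite big_nat_recr //=; have -> : n.+2%:R = n.+1%:R + 1 :> R by rewrite natr1.
have : 0 < n.+1%:R :> R by [].
move: IHn; move: (\sum_(1 <= k < n.+2) _) (n.+1%:R : R) => s a sa a0.
rewrite (le_trans (lerD sa (lexx _))) //.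
rewrite -subr_ge0.
have -> : 2 - (a + 1)^-1 - (2 - a^-1 + (a + 1) ^- 2) = (a * (a + 1) ^+ 2)^-1.
  by field; rewrite !gt_eqF //; lra.
by rewrite invr_ge0 mulr_ge0 ?exprn_ge0 //; lra.
Qed.

(** Split [sawsum] into partial sum and tail, and average over n <= K < 2n. A partial sum has at
    most 2n terms, each at most A. For the tails, blocks of length h = 1/(8n) carry weights 10 at m
    = 0 and 4 (n m h)^-2 = 256/m^2 after, in total at most 10 + 512 = 522; the factor 8 is 2 from
    the two ends times 4 from [block_fejer]. *)
Lemma sawsum_small ts n A theta : (0 < n)%N -> 0 <= A ->
  (forall k x, (0 < k <= 2 * n)%N ->
    `|\sum_(t <- ts) cos (2 * pi * (k%:R * (x - t)))| <= A /\
    `|\sum_(t <- ts) sin (2 * pi * (k%:R * (x - t)))| <= A) ->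
  `|sawsum ts theta| <= 2 * n%:R * A + 8 * 522 * ((size ts)%:R / n%:R + A).
Proof.
move=> n0 A0 HA; have nr : 0 < n%:R :> R by rewrite ltr0n.
have p2 := pi_ge2 R; have p0 := pi_gt0 R.
pose T K := \sum_(t <- ts) \sum_(1 <= k < K.+1) sin (2 * pi * (k%:R * (theta - t))) / (pi * k%:R).
have sE : sawsum ts theta = n%:R^-1 * \sum_(i < n) T (n + i)%N +
    pi^-1 * \sum_(t <- ts) average n (fracpart (theta - t)).
  have nc (z : R) : z = n%:R^-1 * \sum_(i < n) z.
    by rewrite sum_const_ord mulKf // gt_eqF.
  rewrite [LHS]nc.
  transitivity (n%:R^-1 * \sum_(i < n)
      (T (n + i)%N + pi^-1 * \sum_(t <- ts) tail (n + i) (fracpart (theta - t)))).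
    by congr (_ * _); apply: eq_bigr => i _; rewrite /T truncated_sumE subrK.
  rewrite big_split mulrDr /=; congr (_ + _).
  rewrite -big_distrr mulrCA /=; congr (_ * _).
  by rewrite /average -big_distrr exchange_big.
rewrite sE (le_trans (ler_normD _ _)) // lerD //.
  have TA i : (i < n)%N -> `|T (n + i)%N| <= 2 * n%:R * A.
    move=> ni; rewrite /T exchange_big (le_trans (ler_norm_sum _ _ _)) //=.
    apply: (@le_trans _ _ (\sum_(1 <= k < (n + i).+1) A)).
      apply: ler_sum_nat => k /andP[k0 kn]; rewrite -big_distrl normrM /=.
      have [_ sA] := HA k theta ltac:(lia).
      have pk : 1 <= pi * k%:R :> R.
        by rewrite (le_trans _ (ler_pM _ _ p2 (_ : 1 <= k%:R))) ?mulr1 ?ler1n // lra.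
      rewrite -[A]mulr1 ler_pM // ger0_norm ?invr_ge0 ?invf_le1 //; lra.
    rewrite sumr_const_nat subn1 /= -[_ *+ _]mulr_natl ler_wpM2r //.
    by rewrite -natrM ler_nat; lia.
  rewrite normrM gtr0_norm ?invr_gt0 // mulrC ler_pdivrMr //.
  rewrite (le_trans (ler_norm_sum _ _ _)) //.
  apply: (@le_trans _ _ (\sum_(i < n) 2 * n%:R * A)); first by apply: ler_sum => i _; exact: TA.
  by rewrite sum_const_ord mulrC.
have pv : 0 <= pi^-1 :> R by rewrite invr_ge0 ltW.
rewrite normrM (ger0_norm pv) (@le_trans _ _ `|\sum_(t <- ts) average n (fracpart (theta - t))|) //.
  by rewrite ler_piMl // invf_le1; lra.
rewrite (le_trans (ler_norm_sum _ _ _)) //.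
pose h : R := (8 * n%:R)^-1; have h0 : 0 < h by rewrite invr_gt0 mulr_gt0.
pose omega (m : nat) : R := if m is m'.+1 then 256 * m%:R ^- 2 else 10.
have om0 m : 0 <= omega m by case: m => // m; rewrite /omega divr_ge0 ?exprn_ge0.
have := @block_sum R [seq fracpart (theta - t) | t <- ts] (fun y => `|average n y|) omega h
  (4 * ((size ts)%:R / n%:R + A)) (8 * n)%N h0.
rewrite big_map => H; apply: (le_trans (H _ _ _ om0 _)).
- by rewrite natrM /h mulfV ?gt_eqF ?mulr_gt0 //; lra.
- by move=> y /mapP[t _ ->]; rewrite fracpart_ge0 ltW //; exact: fracpart_lt1.
- move=> b; rewrite big_map; apply: block_fejer => // k x /andP[k0 kn].
  by have [] := HA k x ltac:(lia).
- move=> [|m] y /mapP[t _ ->] yd yd'.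
    by apply: average_le; rewrite // fracpart_ge0 ltW //; exact: fracpart_lt1.
  have m0 : 0 < m.+1%:R :> R by [].
  have := @average_decay n (fracpart (theta - t)) (m.+1%:R * h) n0.
  rewrite mulr_gt0 // => /(_ isT yd yd') /le_trans; apply.
  rewrite /omega /h le_eqVlt; apply/orP; left; apply/eqP.
  by move: (m.+1%:R : R) m0 => a a0; field; rewrite !gt_eqF.
have -> : 8 * 522 * ((size ts)%:R / n%:R + A) =
    2 * (4 * ((size ts)%:R / n%:R + A)) * (10 + 256 * 2) by ring.
have B0 : 0 <= (size ts)%:R / n%:R + A by rewrite addr_ge0 // divr_ge0.
apply: ler_wpM2l; first by rewrite !mulr_ge0.
have : (8 * n = (8 * n).-1.+1)%N by lia.
have : (0 < (8 * n).-1)%N by lia.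
move: (8 * n).-1 => M M0 ->; rewrite big_ord_recl lerD2l.
have -> : \sum_(i < M) omega (lift ord0 i) = 256 * \sum_(1 <= k < M.+1) k%:R ^- 2.
  by rewrite big_add1 big_mkord big_distrr; apply: eq_bigr.
apply: ler_wpM2l => //; apply: (le_trans (sum_inv_sqr_le M0)).
by rewrite lerBlDr lerDl invr_ge0.
Qed.

End Averages.

(** * Conclusion *)

Section Main.
Variables (R : realType) (F : finFieldType) (hq : odd #|F|).
Local Notation q := #|F|.
Implicit Types (D : {poly F}) (g K : nat) (theta M : R).

(** Take n with q^(2n) <= g < q^(2n + 2). Then log_q g < 2n + 2 <= 4n, and n^2 <= 3^n <= q^n gives
    n^2 q^n <= g. *)
Lemma trunc_log_facts g : (q ^ 2 <= g)%N -> exists n, [/\ (0 < n)%N, (n ^ 2 * q ^ n <= g)%N &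
  logb q g%:R <= 4 * n%:R :> R].
Proof.
move=> qg; have q1 : (1 < q)%N := card_gt1 F.
have q3 : (3 <= q)%N by move: hq q1; case: q => [|[|[|]]].
have q2 : (1 < q ^ 2)%N by rewrite -(exp1n 2) ltn_exp2r.
exists (trunc_log (q ^ 2) g).
have g0 : (0 < g)%N by apply: leq_trans qg; lia.
have h1 := trunc_logP q2 g0; have h2 := trunc_log_ltn g q2.
have n0 : (0 < trunc_log (q ^ 2) g)%N by rewrite trunc_log_gt0 q2 /= prednK // ltnW.
move: (trunc_log _ _) h1 h2 n0 => n h1 h2 n0; split => //.
  have n2 : (n ^ 2 <= q ^ n)%N.
    apply: (@leq_trans (3 ^ n)); last by rewrite leq_exp2r.
    elim: n {h1 h2 n0} => // -[|[|n]] IHn //.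
    rewrite expnS; apply: leq_trans (leq_mul (leqnn 3) IHn).
    by rewrite -!mulnn; nia.
  by apply: leq_trans h1; rewrite -expnM mul2n -addnn expnD leq_mul.
have lq : 0 < ln q%:R :> R by rewrite ln_gt0 // ltr1n.
have q0 : 0 < q%:R :> R by rewrite ltr0n; lia.
rewrite /logb ler_pdivrMr //.
have -> : 4 * n%:R * ln q%:R = ln (q%:R ^+ (4 * n)) :> R.
  by rewrite lnXn // -[RHS]mulr_natl natrM.
rewrite ler_ln ?posrE ?exprn_gt0 ?ltr0n ?(ltnW q1) //.
rewrite -natrX ler_nat (leq_trans (ltnW h2)) // -expnM leq_pexp2l //; lia.
Qed.

(** For y = g/n and A = q^n, both n A and A are at most y, so [sawsum_small] gives 2y + 4176 (2y +
    y) <= 4180 * 3 y; the remaining factor 4 comes from y <= 4 g / log_q g. *)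
Lemma sawsum_angles_small g ts theta : (q ^ 2 <= g)%N -> size ts = (2 * g)%N ->
  (forall k x, (0 < k)%N ->
    `|\sum_(t <- ts) cos (2 * pi * (k%:R * (x - t)))| <= Num.sqrt q%:R ^+ k /\
    `|\sum_(t <- ts) sin (2 * pi * (k%:R * (x - t)))| <= Num.sqrt q%:R ^+ k) ->
  `|sawsum ts theta| <= 4180 * 12 * (g%:R / logb q g%:R) :> R.
Proof.
move=> qg sz HA; have [n [n0 nq nlog]] := trunc_log_facts qg.
have q1 : 1 <= Num.sqrt q%:R :> R.
  by rewrite -[leLHS]sqrtr1 ler_wsqrtr // ler1n ltnW // card_gt1.
have qn k : (k <= 2 * n)%N -> Num.sqrt q%:R ^+ k <= q%:R ^+ n :> R.
  move=> kn; have -> : q%:R ^+ n = Num.sqrt q%:R ^+ (2 * n) :> R by rewrite exprM sqr_sqrtr.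
  exact: ler_weXn2l.
have := @sawsum_small R ts n (q%:R ^+ n) theta n0 (exprn_ge0 _ (ler0n _ _)) _.
rewrite sz => /(_ _)/le_trans; apply.
  move=> k x /andP[k0 kn]; have [c s] := HA k x k0.
  by split; [apply: le_trans c _|apply: le_trans s _]; exact: qn.
have nr : 0 < n%:R :> R by rewrite ltr0n.
have n1 : 1 <= n%:R :> R by rewrite ler1n.
have A1 : n%:R * q%:R ^+ n <= g%:R / n%:R :> R.
  rewrite ler_pdivlMr //; move: nq; rewrite -(ler_nat R) natrM !natrX => /(le_trans _); apply.
  by rewrite le_eqVlt; apply/orP; left; apply/eqP; ring.
have g0 : (0 < g)%N by apply: leq_trans qg; rewrite expn_gt0 ltnW // card_gt1.
have A2 : q%:R ^+ n <= g%:R / n%:R :> R.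
  by apply: le_trans A1; rewrite ler_peMl // exprn_ge0.
have l0 : 0 < logb q g%:R :> R.
  rewrite divr_gt0 // ln_gt0 // ltr1n ?card_gt1 // (leq_trans _ qg) //.
  by rewrite -(exp1n 2) ltn_exp2r // card_gt1.
have A3 : g%:R / n%:R <= 4 * (g%:R / logb q g%:R) :> R.
  rewrite mulrCA ler_pM2l ?ltr0n // ler_pdivlMr // mulrC ler_pdivrMr //.
have -> : (2 * g)%:R / n%:R = 2 * (g%:R / n%:R) :> R by rewrite natrM mulrA.
have gl0 : 0 <= g%:R / logb q g%:R :> R by rewrite divr_ge0 // ltW.
move: A1 A2 A3 gl0; rewrite -[2 * n%:R * _]mulrA.
by move: (q%:R ^+ n : R) (g%:R / n%:R : R) (g%:R / logb q g%:R : R) => b c d *; lra.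
Qed.

End Main.

Theorem theorem10 (R : realType) (F : finFieldType) (hq : odd #|F|) :
  (forall Phi : nat -> R,
     (forall g : nat, 0 < Phi g) ->
     (exists C : R, \forall g \near \oo,
        forall (D : {poly F}) (theta : R),
          oddHyperelliptic g D -> 0 <= theta <= 1 ->
          `|S_ theta D| <= C * Phi g) ->
     exists C : R, \forall g \near \oo,
       forall K : nat, g%:R * ln g%:R / Phi g <= K%:R ->
         forall (D : {poly F}) (theta : R),
           oddHyperelliptic g D -> 0 <= theta <= 1 ->
           `|SK K theta D| <= C * Phi g)
  /\
  (exists C : R, \forall g \near \oo,
     forall K : nat, logb #|F| g%:R * ln g%:R <= (K%:R : R) ->
       forall (D : {poly F}) (theta : R),
         oddHyperelliptic g D -> 0 <= theta <= 1 ->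
         `|SK K theta D| <= C * (g%:R / logb #|F| g%:R)).
Proof.
split=> [Phi Phi0 [C HC]|].
  (* [C] may be less than 1, and K Phi >= g log g has to yield K M >= g log g for M = max(C, 1)
     Phi. *)
  exists (561 * Num.max C 1); near=> g => K HK D theta HD _.
  have [ts [sz SE SKE _]] := S_angles R hq HD.
  have C1 : 1 <= Num.max C 1 by rewrite le_max lexx orbT.
  have CC : C <= Num.max C 1 by rewrite le_max lexx.
  rewrite SKE -mulrA; apply: (@truncated_sum_bound _ _ g) => //.
  - move=> x x01 /SE <-.
    have /(_ D x HD x01)/le_trans : forall (D : {poly F}) (theta : R),
      oddHyperelliptic g D -> 0 <= theta <= 1 -> `|S_ theta D| <= C * Phi g by near: g.
    by apply; rewrite ler_pM2r.
  - by near: g; exists 4%N.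
  - move: HK; rewrite ler_pdivrMr // => /le_trans; apply.
    by rewrite ler_wpM2l // ler_peMl // ltW.
(* The same bound with M a constant multiple of g / log_q g, the constant being at least 1, so that
   K >= log_q g log g gives K M >= g log g. *)
exists (561 * (4180 * 12)); near=> g => K HK D theta HD _.
have [ts [sz _ SKE HA]] := S_angles R hq HD.
have qg : (#|F| ^ 2 <= g)%N by near: g; exists (#|F| ^ 2)%N.
have g4 : (4 <= g)%N by near: g; exists 4%N.
rewrite SKE -mulrA; apply: (@truncated_sum_bound _ _ g) => //.
  by move=> x _ _; exact: (sawsum_angles_small hq x qg sz HA).
have q1 : 0 < ln #|F|%:R :> R by rewrite ln_gt0 // ltr1n card_gt1.
have [l1 _] := ln4_le R g4.
have l0 : 0 < logb #|F| g%:R :> R by rewrite divr_gt0 //; lra.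
have gl0 : 0 <= g%:R / logb #|F| g%:R :> R by rewrite divr_ge0 // ltW.
have -> : g%:R * ln g%:R = logb #|F| g%:R * ln g%:R * (g%:R / logb #|F| g%:R) :> R.
  by field; rewrite gt_eqF.
apply: ler_pM => //; first by rewrite mulr_ge0 ?ltW //; lra.
by rewrite ler_peMl //; lra.
Unshelve. all: by end_near.
Qed.
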